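(* Let $d \in \mathbb{N}$, let $m \ge 2$ be an integer, and let $K \in \mathcal{K}^d$ be a convex body such that $\mathcal{T}(K)$ is an $m$-fold tiling having exactly $2N$ collision vectors. Then the following hold: (a) $m \le N+1$. (b) If $d \ge 2$, then the equality $m = N+1$ is attained if and only if some translate of $2K$ is a cylindrical $m$-lifting of a $(d-1)$-dimensional extremal convex body.
   Context: $\mathcal{K}^d$ is the family of convex bodies in $\mathbb{R}^d$ (compact convex sets with non-empty interior), and $\mathcal{K}_o^d$ the subfamily of those that are centrally symmetric with respect to the origin $o$. For $A\subseteq\mathbb{R}^d$, $\mathcal{T}(A) := \{A+z : z \in \mathbb{Z}^d\}$. A family $\mathcal{T}$ of subsets of $\mathbb{R}^d$ is an $m$-fold packing if each $x \in \mathbb{R}^d$ lies in the interior of at most $m$ members of $\mathcal{T}$; an $m$-fold covering if each $x \in \mathbb{R}^d$ lies in at least $m$ members of $\mathcal{T}$; an $m$-fold tiling if it is both an $m$-fold packing and an $m$-fold covering. A vector $z \in \mathbb{Z}^d \setminus \{o\}$ is a collision vector of $\mathcal{T}(K)$ if $\operatorname{int}(K) \cap (\operatorname{int}(K)+z) \neq \emptyset$. Collision vectors come in pairs $\pm z$, so their number is even. For $n \in \mathbb{N}$, an $n$-dimensional extremal convex body is a $B \in \mathcal{K}_o^n$ having the origin as its only point of $\mathbb{Z}^n$ in the interior and with $\operatorname{vol}(B)=2^n$. For $d\ge2$, $B \subseteq \mathbb{R}^{d-1}$ and $f,g:\mathbb{R}^{d-1}\to\mathbb{R}$, let $L(B,f,g)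 := \{(y,t)\in B\times\mathbb{R} : f(y)\le t\le g(y)\}$. A unimodular transformation is an affine transformation $\phi:\mathbb{R}^d\to\mathbb{R}^d$ with $\phi(\mathbb{Z}^d)=\mathbb{Z}^d$. For $C\in\mathcal{K}_o^d$ and $B\in\mathcal{K}_o^{d-1}$, $C$ is a cylindrical $m$-lifting of $B$ if $C=\phi(L(B,a-m,a+m))$ for some linear unimodular transformation $\phi$ of $\mathbb{R}^d$ and some linear function $a:\mathbb{R}^{d-1}\to\mathbb{R}$. *)

(* Defs.v *)
From HB Require Import structures.
From mathcomp Require Import all_boot all_order all_algebra.
From mathcomp Require Import all_classical all_reals all_analysis.

Set Implicit Arguments.
Unset Strict Implicit.
Unset Printing Implicit Defensive.

Import Order.TTheory GRing.Theory Num.Theory.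
Import numFieldNormedType.Exports.

Local Open Scope classical_set_scope.
Local Open Scope card_scope.
Local Open Scope ring_scope.

(* Points of R^n are row vectors 'rV[R]_n, with the library's (product)
   topology. *)

Section Defs.
Context {R : realType}.

Section AnyDimension.
Context {n : nat}.
Implicit Types (A B K : set 'rV[R]_n) (F : set (set 'rV[R]_n)).

Definition int_points : set 'rV[R]_n :=
  [set x | forall i, x ord0 i \is a Num.int].

Definition translate (z : 'rV[R]_n) A : set 'rV[R]_n := [set x + z | x in A].

Definition dilate (c : R) A : set 'rV[R]_n := [set c *: x | x in A].

Definition convex_body K := [/\ compact K, convex_set K & interior K !=set0].

Definition sym_convex_body K := convex_body K /\ [set - x | x in K] = K.

Definition lattice_translates A : set (set 'rV[R]_n) :=
  [set translate z A | z in int_points].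

(* A family is a set of sets. For A bounded and nonempty the translates of A
   are pairwise distinct, so no multiplicity is lost in lattice_translates A. *)
Definition mfold_packing (m : nat) F :=
  forall x, [set A | F A /\ interior A x] #<= `I_m.

Definition mfold_covering (m : nat) F :=
  forall x, `I_m #<= [set A | F A /\ A x].

Definition mfold_tiling (m : nat) F := mfold_packing m F /\ mfold_covering m F.

Definition collision_vectors K : set 'rV[R]_n :=
  [set z | [/\ int_points z, z != 0 &
     interior K `&` translate z (interior K) !=set0]].

End AnyDimension.

(* Lebesgue measure of R^n as the n-fold product of the one-dimensional one:
   as for the library's product measures, the measure of A is the integral of
   the measures of its sections, here those at a fixed first coordinate t.
   As a function on all sets it is only meaningful on Borel sets, such as
   convex bodies. *)
Fixpoint vol (n : nat) : set 'rV[R]_n -> \bar R :=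
  match n with
  | 0 => fun A => (\1_A (0 : 'rV[R]_0))%:E
  | n'.+1 => fun A =>
      (\int[@lebesgue_measure R]_t
         vol [set y : 'rV[R]_n' | A (row_mx (t%:M : 'rV[R]_1) y)])%E
  end.

Definition extremal_convex_body n (B : set 'rV[R]_n) :=
  [/\ sym_convex_body B,
      interior B `&` int_points = [set 0] &
      vol B = (2 ^+ n)%:E].

(* L(B, f, g); a point x = (y, t) of R^(n+1) has last coordinate
   t = x ord0 ord_max, and y = col' ord_max x collects the first n. *)
Definition between n (B : set 'rV[R]_n) (f g : 'rV[R]_n -> R) :
    set 'rV[R]_n.+1 :=
  [set x | let y : 'rV[R]_n := col' ord_max x in
           B y /\ f y <= x ord0 ord_max <= g y].

(* No separate bijectivity requirement: Z^n spans R^n, so a linear map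
   satisfying this is onto. *)
Definition unimodular n (phi : {linear 'rV[R]_n -> 'rV[R]_n}) :=
  phi @` int_points = int_points.

Definition cylindrical_lifting n (m : nat) (B : set 'rV[R]_n)
    (C : set 'rV[R]_n.+1) :=
  [/\ sym_convex_body C, sym_convex_body B &
    exists (phi : {linear 'rV[R]_n.+1 -> 'rV[R]_n.+1})
           (a : {linear 'rV[R]_n -> R^o}),
      unimodular phi /\
      C = phi @` between B (fun y => a y - m%:R) (fun y => a y + m%:R)].

End Defs.

(* Main.v *)
(* Order the lattice by an integer linear functional w that does not vanish on
   collision vectors. Near a point of K where w is almost minimal the m-fold
   covering supplies, besides K itself, m - 1 translates K + z, and each of
   these z is a collision vector with w z < 0; hence N >= m - 1.

   If N = m - 1, these m - 1 vectors are all the collision vectors on which w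
   is negative. The same translates cover a whole neighbourhood, so differences
   of these vectors are again collision vectors; subtracting repeatedly the one,
   u, on which w is largest shows that they are u, 2 u, ..., (m - 1) u, and u is
   primitive. In coordinates with u the last basis vector, every chord of K in
   direction u has length exactly m, so K lies between two vertical translates
   of one graph over its projection P. That function is both convex and concave,
   hence affine, and P is a lattice tile. Counting cells of fine grids by
   residue class gives vol P = 1. The body (P - P) / 2 is again a lattice
   packing, so its volume is at most 1, and the equality case of Brunn-Minkowski
   makes P centrally symmetric; then 2 P, centred, is extremal. The converse
   counts the lattice points in the interior of a cylindrical lifting.

   The equality case of Brunn-Minkowski is proved by induction on the dimension
   through the monotone transport between the section volume profiles. *)

Require Import Defs.
From HB Require Import structures.
From mathcomp Require Import all_boot all_order all_algebra.
From mathcomp Require Import all_classical all_reals all_analysis.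
From mathcomp Require Import perm measurable_realfun.
From mathcomp Require Import ring lra zify.

Set Implicit Arguments.
Unset Strict Implicit.
Unset Printing Implicit Defensive.

Import Order.TTheory GRing.Theory Num.Theory.
Import numFieldNormedType.Exports.

Local Open Scope classical_set_scope.
Local Open Scope card_scope.
Local Open Scope ring_scope.

(** * Concave functions and the Prékopa-Leindler inequality on the line *)

(** [vol] is an iterated integral defined on all sets, and it is handled essentially through three
    facts: it is monotone, it is the integral of the section volumes, and a finite union of grid
    cells has the expected value. This is why the volumes of the tile P, of -P and of 2 P are each
    obtained by a count of cells, and why packing and covering carry a lattice scale q. The obstacle
    in the rigidity of Brunn-Minkowski is that the induction hypothesis makes corresponding sections
    differ by a translation v(s) that may depend on the height s. The sections of (A + B) / 2 yield
    an inequality between second differences of a concave function and increments of v; telescoping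
    it in both directions forces v to be constant. P packs because the chords of K over P have
    length m >= 2: if the interiors of P and P + z met, two such chords could be matched up to an
    integer vertical shift, giving a collision vector off the axis of u. *)

Section OneDim.
Context {R : realType}.
Implicit Types (f g h : R -> R) (x y s t l a b : R).

Lemma nbhs_dist_lt x d : 0 < d -> \forall y \near x, `|x - y| < d.
Proof. by move=> d0; near=> y; near: y; apply/nbhs_ballP; exists d.
Unshelve. all: by end_near. Qed.

Definition concave_on a b g := forall s t l, a < s < b -> a < t < b -> 0 < l < 1 ->
  l * g s + (1 - l) * g t <= g (l * s + (1 - l) * t).

(** With e of length d on the side of y, concavity between x and x + e bounds g y from below, and
    concavity between x - e and y, with x in between, bounds it from above. So [|g x - g y|] is at
    most [|x - y| / d * C]. *)
Lemma concave_continuous a b g x : concave_on a b g -> a < x < b ->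
  {for x, continuous g}.
Proof.
move=> cg /andP[ax xb].
pose d := Num.min (x - a) (b - x) / 2.
have d0 : 0 < d by rewrite divr_gt0// lt_min !subr_gt0 ax.
have dl : d <= (x - a) / 2 by rewrite ler_pM2r ?invr_gt0// ge_min lexx.
have dr : d <= (b - x) / 2 by rewrite ler_pM2r ?invr_gt0// ge_min lexx orbT.
pose C := `|g x - g (x + d)| + `|g x - g (x - d)|.
have C0 : 0 <= C by rewrite addr_ge0.
have key y : `|x - y| < d -> `|g x - g y| <= `|x - y| / d * C.
  move=> xyd.
  have [->|xy] := eqVneq x y; first by rewrite !subrr normr0 !mul0r.
  pose e := Num.sg (y - x) * d.
  set th := `|x - y| / d.
  have th0 : 0 < th by rewrite divr_gt0// normr_gt0 subr_eq0.
  have th1 : th < 1 by rewrite ltr_pdivrMr// mul1r.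
  have ye : y = x + th * e.
    rewrite /th /e mulrA (mulrAC _ d^-1) divfK ?gt_eqF// distrC.
    by rewrite mulrC -numEsg; ring.
  have eC : `|g x - g (x + e)| <= C /\ `|g x - g (x - e)| <= C.
    rewrite /C /e; case: sgrP => [yx|_|_]; rewrite ?mul1r ?mulN1r ?opprK ?mul0r ?addr0 ?subr0.
    - by move: xy; rewrite -subr_eq0 -normr_eq0 distrC yx normr0 eqxx.
    - by rewrite lerDl lerDr !normr_ge0.
    - by rewrite lerDl lerDr !normr_ge0.
  have ein : a < x + e < b /\ a < x - e < b.
    have : `|e| <= d by rewrite /e normrM (gtr0_norm d0) ler_piMl ?(ltW d0)// normr_sg; case: eqP.
    rewrite ler_norml => /andP[? ?]; split; lra.
  case: ein => e1 e2; case: eC => C1 C2.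
  have yin : a < y < b by rewrite ye; move/andP: e1 => [? ?]; move/andP: e2 => [? ?]; nra.
  have lo : th * g (x + e) + (1 - th) * g x <= g y.
    have -> : y = th * (x + e) + (1 - th) * x by rewrite ye; ring.
    by apply: cg => //; rewrite ?ax// th0.
  have hi : (1 + th)^-1 * g y + (1 - (1 + th)^-1) * g (x - e) <= g x.
    have xe : x = (1 + th)^-1 * y + (1 - (1 + th)^-1) * (x - e).
      by rewrite ye; field; lra.
    rewrite [X in _ <= g X]xe; apply: cg => //; rewrite invr_gt0 invf_lt1; lra.
  have {}hi : g y + th * g (x - e) <= (1 + th) * g x.
    move: hi; rewrite -(ler_pM2l (_ : 0 < 1 + th)); last by lra.
    rewrite mulrDr mulrA mulfV ?mul1r; last by lra.
    by rewrite mulrA mulrBr mulfV; lra.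
  rewrite ler_norml; move: C1 C2; rewrite !ler_norml => /andP[? ?] /andP[? ?].
  apply/andP; split; nra.
apply/cvgrPdist_lt => e e0.
have ec0 : 0 < e * d / (C + 1) by apply: divr_gt0; [exact: mulr_gt0|exact: ltr_wpDl].
near=> y.
have yd : `|x - y| < d by near: y; exact: nbhs_dist_lt.
apply: le_lt_trans (key _ yd) _.
rewrite mulrAC ltr_pdivrMr//.
apply: le_lt_trans (_ : `|x - y| * (C + 1) < _); first by rewrite ler_wpM2l// lerDl.
rewrite -ltr_pdivlMr; last exact: ltr_wpDl.
by near: y; exact: nbhs_dist_lt.
Unshelve. all: by end_near. Qed.

Local Notation mu := (@lebesgue_measure R).

(** Sum ln w <= w - 1 at w = x / p and w = y / p with weights l and 1 - l: when p is the weighted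
    geometric mean, the logarithms cancel. *)
Lemma powR_amgm l x y : 0 < l < 1 -> 0 < x -> 0 < y ->
  x `^ l * y `^ (1 - l) <= l * x + (1 - l) * y.
Proof.
move=> /andP[l0 l1] x0 y0.
have p0 : 0 < x `^ l * y `^ (1 - l) by rewrite mulr_gt0 ?powR_gt0.
have key z : 0 < z -> ln z - ln (x `^ l * y `^ (1 - l)) <= z / (x `^ l * y `^ (1 - l)) - 1.
  move=> z0; rewrite -ln_div ?posrE//.
  set w := z / _; have w0 : 0 < w by rewrite divr_gt0.
  have -> : ln w = ln (1 + (w - 1)) by rewrite addrC subrK.
  by apply: le_ln1Dx; rewrite ltrBrDl subrr.
have := key _ x0; have := key _ y0.
set p := _ * _ in p0 key *.
have -> : ln p = l * ln x + (1 - l) * ln y by rewrite lnM ?posrE ?powR_gt0// !ln_powR.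
move=> kx ky.
have : 0 <= l * (x / p - 1) + (1 - l) * (y / p - 1).
  apply: le_trans (_ : l * (ln x - (l * ln x + (1 - l) * ln y)) + (1 - l) * (ln y - (l * ln x + (1 - l) * ln y)) <= _).
    by rewrite le_eqVlt; apply/orP; left; apply/eqP; ring.
  by apply: lerD; rewrite ler_pM2l// subr_gt0.
have -> : l * (x / p - 1) + (1 - l) * (y / p - 1) = (l * x + (1 - l) * y) / p - 1.
  by field; rewrite gt_eqF.
by rewrite subr_ge0 ler_pdivlMr// mul1r.
Qed.

(** * Log-concave functions and profiles *)

Definition logconcave f := forall l s t, 0 < l < 1 ->
  f s `^ l * f t `^ (1 - l) <= f (l * s + (1 - l) * t).

Lemma powR_onem_ge l u v m : 0 < l < 1 -> 0 < m -> m <= u -> m <= v ->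
  m <= u `^ l * v `^ (1 - l).
Proof.
move=> /andP[l0 l1] m0 mu_ mv.
have {1}-> : m = m `^ l * m `^ (1 - l).
  rewrite -powRD; last by rewrite (gt_eqF m0) implybT.
    by rewrite (_ : l + (1 - l) = 1) ?powRr1 ?(ltW m0)//; ring.
by apply: ler_pM; rewrite ?powR_ge0// ge0_ler_powR ?nnegrE//; lra.
Qed.

Lemma between_convex s x t : s < x < t ->
  exists2 l, 0 < l < 1 & x = l * s + (1 - l) * t.
Proof.
move=> /andP[sx xt]; exists ((t - x) / (t - s)).
  by rewrite divr_gt0 ?ltr_pdivrMr ?mul1r; lra.
by field; lra.
Qed.

Lemma logconcave_min f s x t m : logconcave f -> 0 < m -> s <= x <= t ->
  m <= f s -> m <= f t -> m <= f x.
Proof.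
move=> lf m0 /andP[]; rewrite le_eqVlt => /predU1P[<-//|sx].
rewrite le_eqVlt => /predU1P[->//|xt] ms mt.
have [|l l01 ->] := @between_convex s x t; first by rewrite sx.
by apply: le_trans (lf _ _ _ l01); exact: powR_onem_ge.
Qed.

(* A profile is the model for the volumes of the parallel sections of a compact
   convex set. *)
Definition profile M f := [/\ forall x, 0 <= f x, logconcave f,
  forall x, M <= `|x| -> f x = 0 & exists C, forall x, f x <= C].

(** Superlevel sets of a log-concave function at positive levels are intervals. *)
Lemma profile_measurable M f : profile M f -> measurable_fun setT f.
Proof.
move=> [f0 lf _ _].
apply: (measurability (@RGenCInfty.G R)) => [|/= _ [_] [r] -> <-].
  exact: RGenCInfty.measurableE.
rewrite setTI; have [r0|r0] := leP r 0.
  rewrite [X in measurable X](_ : _ = setT)//; apply/seteqP; split => // x _ /=.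
  by rewrite in_itv/= andbT (le_trans r0).
apply: is_interval_measurable => s t/=.
rewrite !in_itv/= !andbT => fs ft u /andP[su ut].
by rewrite in_itv/= andbT; apply: (@logconcave_min f s u t) => //; rewrite su.
Qed.

Lemma itv_finite_measure (b0 b1 : bool) a b :
  (mu [set` Interval (BSide b0 a) (BSide b1 b)] < +oo)%E.
Proof. by rewrite lebesgue_measure_itv/=; case: ifP => _; rewrite ?ltry. Qed.

Lemma cst_integrable a b m : mu.-integrable `[a, b] (EFin \o cst m).
Proof.
apply: measurable_bounded_integrable => //; first exact: itv_finite_measure.
exists `|m|; split; [by rewrite num_real|by move=> D ? ? _ /=; exact: ltW].
Qed.

Lemma profile_integrable M f (b0 b1 : bool) a b : profile M f ->
  mu.-integrable [set` Interval (BSide b0 a) (BSide b1 b)] (EFin \o f).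
Proof.
move=> pf; apply: measurable_bounded_integrable => //.
- exact: itv_finite_measure.
- exact: measurable_funS (profile_measurable pf).
- case: pf => f0 _ _ [C fC]; exists C; split; first by rewrite num_real.
  by move=> D CD x _ /=; rewrite ger0_norm// (le_trans (fC _))// ltW.
Qed.

(** The distribution function of a profile. As a profile vanishes where [|x| >= M], [mass M f M] is
    its total integral. *)
Definition mass M f x := \int[mu]_(t in `[- M, x]) f t.

Lemma mass_itv M f x y : profile M f -> - M <= x -> x <= y ->
  mass M f y - mass M f x = \int[mu]_(t in `[x, y]) f t.
Proof.
move=> pf Mx xy; rewrite /mass Rintegral_itvB ?bnd_simp//; last exact: profile_integrable pf.
rewrite Rintegral_itv_obnd_cbnd//.
exact: profile_integrable pf.
Qed.

Lemma fine_mu_itv x y : x <= y -> fine (mu `[x, y]%classic) = y - x.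
Proof.
rewrite lebesgue_measure_itv/= lte_fin le_eqVlt => /predU1P[->|->//].
by rewrite ltxx subrr.
Qed.

Lemma mass_lower M f x y m : profile M f -> - M <= x -> x <= y ->
  (forall t, x <= t <= y -> m <= f t) -> m * (y - x) <= mass M f y - mass M f x.
Proof.
move=> pf Mx xy mf; rewrite (mass_itv pf)//.
have -> : m * (y - x) = \int[mu]_(t in `[x, y]) m.
  by rewrite Rintegral_cst//= fine_mu_itv.
apply: le_Rintegral => //; last exact: profile_integrable pf.
exact: cst_integrable.
Qed.

Lemma mass_upper M f x y m : profile M f -> - M <= x -> x <= y ->
  (forall t, x <= t <= y -> f t <= m) -> mass M f y - mass M f x <= m * (y - x).
Proof.
move=> pf Mx xy mf; rewrite (mass_itv pf)//.
have -> : m * (y - x) = \int[mu]_(t in `[x, y]) m.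
  by rewrite Rintegral_cst//= fine_mu_itv.
apply: le_Rintegral => //; first exact: profile_integrable pf.
exact: cst_integrable.
Qed.

Lemma mass_start M f : mass M f (- M) = 0.
Proof. by rewrite /mass set_itv1 Rintegral_set1. Qed.

Lemma profile_abs M f x : profile M f -> 0 < f x -> - M < x < M.
Proof.
move=> [_ _ fM _] fx; rewrite -ltr_norml ltNge; apply/negP => /fM fx0.
by rewrite fx0 ltxx in fx.
Qed.

(** If f, bounded by C, were positive at a single point, its mass would be at most 2 * e * C for
    every small window of radius e around that point. *)
Lemma profile_spread M f : profile M f -> 0 < mass M f M ->
  exists s t, [/\ 0 < f s, 0 < f t & s < t].
Proof.
move=> pf V0; have [f0 lf fM [C fC]] := pf.
have C0 : 0 <= C by apply: le_trans (fC 0).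
have MM : - M <= M.
  rewrite leNgt; apply/negP => MM; move: V0; rewrite /mass set_itv_ge ?bnd_simp -?ltNge//.
  by rewrite Rintegral_set0 ltxx.
have [p fp] : exists p, 0 < f p.
  apply: contrapT => /forallNP np.
  suff : mass M f M - mass M f (- M) <= 0 * (M - - M).
    by rewrite mass_start subr0 mul0r leNgt V0.
  by apply: (mass_upper pf) => // t _; rewrite leNgt; exact/negP.
apply: contrapT => H.
have f0p t : t != p -> f t <= 0.
  rewrite neq_lt => /orP[] tp; rewrite leNgt; apply/negP => ft; apply: H.
    by exists t, p.
  by exists p, t.
have /andP[Mp pM] := profile_abs pf fp.
(* The last bound makes 2 * e * C at most half of the mass; C + 1 covers the case C = 0. *)
pose e := Num.min (Num.min (M - p) (p + M)) (mass M f M / (4 * (C + 1))).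
have e0 : 0 < e.
  rewrite !lt_min; apply/andP; split; first by apply/andP; split; lra.
  by apply: divr_gt0 => //; lra.
have e1 : e <= M - p by rewrite /e !ge_min lexx.
have e2 : e <= p + M by rewrite /e !ge_min lexx orbT.
have e3 : e * (4 * (C + 1)) <= mass M f M.
  by rewrite -ler_pdivlMr; [rewrite /e !ge_min lexx !orbT|lra].
have := @mass_upper M f (- M) (p - e) 0 pf (lexx _).
have := @mass_upper M f (p - e) (p + e) C pf.
have := @mass_upper M f (p + e) M 0 pf.
rewrite mass_start => h1 h2 h3.
have {}h1 : mass M f M - mass M f (p + e) <= 0 * (M - (p + e)).
  apply: h1; [lra|lra|move=> t /andP[pt _]; apply: f0p].
  by rewrite gt_eqF//; lra.
have {}h2 : mass M f (p + e) - mass M f (p - e) <= C * (p + e - (p - e)).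
  by apply: h2 => //; lra.
have {}h3 : mass M f (p - e) - 0 <= 0 * (p - e - - M).
  apply: h3; [lra|move=> t /andP[_ pt]; apply: f0p].
  by rewrite lt_eqF//; lra.
nra.
Qed.

(** Log-concavity makes the positivity set an interval, so its infimum and supremum serve. The
    values of f at the two endpoints are left open. *)
Lemma profile_support M f : profile M f -> 0 < mass M f M ->
  exists a b, [/\ - M <= a, a < b, b <= M, forall x, a < x < b -> 0 < f x &
    forall x, 0 < f x -> a <= x <= b].
Proof.
move=> pf V0; have [s [t [fs ft st]]] := profile_spread pf V0.
pose S := [set x | 0 < f x].
have Ss : S s by []. have St : S t by [].
have lbS : has_lbound S by exists (- M) => x /(profile_abs pf)/andP[/ltW].
have ubS : has_ubound S by exists M => x /(profile_abs pf)/andP[_ /ltW].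
have infS : has_inf S by split => //; exists s.
have supS : has_sup S by split => //; exists s.
exists (inf S), (sup S); split.
- by apply: lb_le_inf; [exists s|move=> x /(profile_abs pf)/andP[/ltW]].
- apply: le_lt_trans (ge_inf lbS Ss) _; apply: lt_le_trans st _.
  exact: ub_le_sup.
- by apply: ge_sup; [exists s|move=> x /(profile_abs pf)/andP[_ /ltW]].
- move=> x /andP[ix xs].
  have [u Su ux] := inf_lt (proj1 infS) ix.
  have [v Sv xv] := sup_gt (proj1 supS) xs.
  have m0 : 0 < Num.min (f u) (f v) by rewrite lt_min; apply/andP.
  apply: lt_le_trans (m0) _; case: pf => _ lf _ _.
  apply: (@logconcave_min f u x v _ lf m0); first by rewrite !ltW.
    by rewrite ge_min lexx.
  by rewrite ge_min lexx orbT.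
- by move=> x Sx; rewrite ge_inf//= ub_le_sup.
Qed.

Lemma logconcave_continuous f a b x : logconcave f ->
  (forall y, a < y < b -> 0 < f y) -> a < x < b -> {for x, continuous f}.
Proof.
move=> lf fpos abx.
have cl : concave_on a b (@ln R \o f).
  move=> l s t abs abt l01 /=.
  have fs := fpos _ abs; have ft := fpos _ abt.
  rewrite -!ln_powR -lnM ?posrE ?powR_gt0// ler_ln ?posrE ?mulr_gt0 ?powR_gt0//; last first.
    by apply: lt_le_trans (lf _ _ _ l01); rewrite mulr_gt0 ?powR_gt0.
  exact: lf.
have c1 := concave_continuous cl abx.
have c2 : {for x, continuous (@expR R \o (@ln R \o f))}.
  by apply: continuous_comp => //; exact: continuous_expR.
have fE : {near x, @expR R \o (@ln R \o f) =1 f}.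
  near=> y; rewrite /= lnK// posrE; apply: fpos; near: y.
  have := @near_in_itvoo R a b x; rewrite in_itv/= => /(_ abx).
  by apply: filterS => z; rewrite in_itv.
have fx : (@expR R \o (@ln R \o f)) x = f x by rewrite /= lnK// posrE fpos.
rewrite /prop_for/= /continuous_at -fx; apply: cvg_trans c2; apply: near_eq_cvg.
by apply: filterS fE => z /= ->.
Unshelve. all: by end_near. Qed.

Lemma mass_left M f a x : profile M f -> (forall y, 0 < f y -> a <= y) ->
  x <= a -> mass M f x = 0.
Proof.
move=> pf fa xa; rewrite /mass -Rintegral_itv_bndo_bndc; last exact: profile_integrable pf.
rewrite (_ : \int[mu]_(t in _) _ = \int[mu]_(t in `[- M, x[) 0); last first.
  apply: eq_Rintegral => t; rewrite inE/= in_itv/= => /andP[_ tx].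
  apply/eqP; rewrite eq_le; case: pf => -> _ _ _; rewrite andbT leNgt.
  by apply/negP => /fa; rewrite leNgt (lt_le_trans tx).
by rewrite Rintegral_cst//= mul0r.
Qed.

Lemma mass_right M f b x : profile M f -> (forall y, 0 < f y -> y <= b) ->
  - M <= x <= M -> b <= x -> mass M f x = mass M f M.
Proof.
move=> pf fb /andP[Mx xM] bx; apply/esym/eqP; rewrite -subr_eq0.
rewrite /mass Rintegral_itvB ?bnd_simp//; last exact: profile_integrable pf.
rewrite (_ : \int[mu]_(t in _) _ = \int[mu]_(t in `]x, M]) 0); last first.
  apply: eq_Rintegral => t; rewrite inE/= in_itv/= => /andP[tx _].
  apply/eqP; rewrite eq_le; case: pf => -> _ _ _; rewrite andbT leNgt.
  by apply/negP => /fb; rewrite leNgt (le_lt_trans bx).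
by rewrite Rintegral_cst//= mul0r.
Qed.

Lemma mass_is_derive M f a b x : profile M f -> - M <= a ->
  (forall y, a < y < b -> 0 < f y) -> a < x < b ->
  is_derive x 1 (mass M f) (f x).
Proof.
move=> pf Ma fpos abx; have [f0 lf _ _] := pf.
have cf := logconcave_continuous lf fpos abx.
move/andP: abx => [ax xb].
have [] := @continuous_FTC1_closed R f (- M) x (x + 1) _ (profile_integrable _ _ _ _ pf) _ cf.
- by rewrite ltrDl.
- exact: le_lt_trans ax.
- by move=> df dfx; apply: DeriveDef; [exact: df|rewrite -derive1E; exact: dfx].
Qed.

Lemma mass_lt M f a b x y : profile M f -> - M <= a ->
  (forall t, a < t < b -> 0 < f t) -> a < x -> x < y -> y < b ->
  mass M f x < mass M f y.
Proof.
move=> pf Ma fpos ax xy yb; have [_ lf _ _] := pf.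
have m0 : 0 < Num.min (f x) (f y).
  by rewrite lt_min !fpos//; [apply/andP; split; lra|apply/andP; split; lra].
rewrite -subr_gt0; apply: lt_le_trans (@mass_lower M f x y (Num.min (f x) (f y)) pf _ _ _).
- by rewrite mulr_gt0// subr_gt0.
- by apply: le_trans Ma _; exact: ltW.
- exact: ltW.
- move=> t xty; apply: (logconcave_min lf m0 xty); first by rewrite ge_min lexx.
  by rewrite ge_min lexx orbT.
Qed.

Lemma mass_nd M f x y : profile M f -> - M <= x -> x <= y -> mass M f x <= mass M f y.
Proof.
move=> pf Mx xy; rewrite -subr_ge0.
by have := @mass_lower M f x y 0 pf Mx xy; rewrite mul0r; apply=> t _; case: pf.
Qed.

(** [q t] is the t-quantile of f normalised to total mass one. Pairing the quantiles of two profiles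
    at equal t is the monotone transport between them. *)
Definition quantile M f a b (q : R -> R) :=
  (forall t, 0 < t < 1 -> [/\ a < q t < b, mass M f (q t) = t * mass M f M &
    is_derive t 1 q (mass M f M / f (q t))]) /\
  (forall x, a < x < b -> exists2 t, 0 < t < 1 & q t = x).

Lemma quantile_exists M f a b : profile M f -> 0 < mass M f M ->
  - M <= a -> a < b -> b <= M -> (forall x, a < x < b -> 0 < f x) ->
  (forall x, 0 < f x -> a <= x <= b) -> exists q, quantile M f a b q.
Proof.
move=> pf V0 Ma ab bM fpos fsupp; set V := mass M f M in V0 *.
have ex t : 0 < t < 1 -> exists x, a < x < b /\ mass M f x = t * V.
  move=> /andP[t0 t1].
  have [|||c cM cE] := @IVT _ (mass M f) (- M) M (t * V).
  - by lra.
  - apply: parameterized_integral_continuous; first by lra.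
    exact: profile_integrable pf.
  - rewrite mass_start -/V; apply/andP; split.
      by rewrite ge_min mulr_ge0// ltW.
    by rewrite le_max; apply/orP; right; rewrite ger_pMl// ltW.
  (* Outside ]a, b[ the mass is 0 or V, never t * V with 0 < t < 1. *)
  exists c; split=> //; move: cM; rewrite in_itv/= => cM; apply/andP; split.
    rewrite ltNge; apply/negP => ca.
    have := mass_left pf (fun y fy => proj1 (andP (fsupp y fy))) ca.
    by rewrite cE => /eqP; rewrite mulf_eq0 !gt_eqF.
  rewrite ltNge; apply/negP => bc.
  have := mass_right pf (fun y fy => proj2 (andP (fsupp y fy))) cM bc.
  by rewrite cE -/V => h; nra.
pose q t := if pselect (exists x, a < x < b /\ mass M f x = t * V) is left h
  then projT1 (cid h) else 0.
have qP t : 0 < t < 1 -> a < q t < b /\ mass M f (q t) = t * V.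
  by move=> /ex h; rewrite /q; case: pselect => // h'; case: cid.
have mass01 x : a < x < b -> 0 < mass M f x / V < 1.
  move=> /andP[ax xb]; rewrite divr_gt0//=; last first.
    apply: le_lt_trans (_ : mass M f ((a + x) / 2) < _).
      by rewrite -(mass_start M f); apply: mass_nd => //; lra.
    by apply: (mass_lt pf Ma fpos) => //; lra.
  rewrite ltr_pdivrMr// mul1r.
  apply: lt_le_trans (_ : mass M f ((x + b) / 2) <= _).
    by apply: (mass_lt pf Ma fpos) => //; lra.
  by apply: mass_nd => //; lra.
have qK x : a < x < b -> q (mass M f x / V) = x.
  move=> abx; have [/andP[aq qb]] := qP _ (mass01 _ abx).
  rewrite divfK ?gt_eqF// => qE; move/andP: (abx) => [ax xb].
  case: (ltgtP (q (mass M f x / V)) x) => // h.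
    by have := mass_lt pf Ma fpos aq h xb; rewrite qE ltxx.
  by have := mass_lt pf Ma fpos ax h qb; rewrite qE ltxx.
exists q; split; last by move=> x abx; exists (mass M f x / V); [exact: mass01|exact: qK].
move=> t t01; have [abq qE] := qP _ t01; split=> //.
(* The normalised distribution function: q inverts it on ]a, b[, and the inverse function theorem
   gives the derivative of q. *)
pose g x := mass M f x * V^-1.
have gq : g (q t) = t by rewrite /g qE mulfK ?gt_eqF.
have dg y : a < y < b -> is_derive y 1 g (f y / V).
  move=> aby; have dm := mass_is_derive pf Ma fpos aby.
  have -> : g = V^-1 *: (mass M f : R -> R^o) by apply/funext => z; rewrite /g /= mulrC.
  by apply: is_derive_eq; rewrite mulrC.
have nab : \forall y \near q t, a < y < b.
  have := @near_in_itvoo R a b (q t); rewrite in_itv/= => /(_ abq).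
  by apply: filterS => z; rewrite in_itv.
rewrite -[X in is_derive X](gq) -invf_div.
apply: is_derive_inverse.
- by apply: filterS nab => y aby; exact: qK.
- apply: filterS nab => y aby.
  by apply: differentiable_continuous; apply/derivable1_diffP; case: (dg _ aby).
- exact: dg.
- by rewrite gt_eqF// divr_gt0// fpos.
Qed.

Lemma powR_div l x y : 0 < x -> 0 < y -> (x / y) `^ l = x `^ l / y `^ l.
Proof.
move=> x0 y0; have xy0 : 0 < x / y by rewrite divr_gt0.
have -> : x `^ l = (x / y) `^ l * y `^ l by rewrite -powRM ?(ltW xy0) ?ltW// divfK// gt_eqF.
by rewrite mulfK// gt_eqF ?powR_gt0.
Qed.

Lemma conv_mono l x y x' y' : 0 < l < 1 -> x <= x' -> y <= y' ->
  l * x + (1 - l) * y <= l * x' + (1 - l) * y'.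
Proof. by move=> /andP[l0 l1] xx yy; apply: lerD; rewrite ler_pM2l// subr_gt0. Qed.

Lemma conv_smono l x y x' y' : 0 < l < 1 -> x < x' -> y < y' ->
  l * x + (1 - l) * y < l * x' + (1 - l) * y'.
Proof. by move=> /andP[l0 l1] xx yy; apply: ltrD; rewrite ltr_pM2l// subr_gt0. Qed.

Lemma conv_ge l m x y : 0 < l < 1 -> m <= x -> m <= y -> m <= l * x + (1 - l) * y.
Proof.
move=> l01 mx my; have := conv_mono l01 mx my.
by rewrite (_ : l * m + (1 - l) * m = m)//; ring.
Qed.

Lemma conv_le l m x y : 0 < l < 1 -> x <= m -> y <= m -> l * x + (1 - l) * y <= m.
Proof.
move=> l01 mx my; have := conv_mono l01 mx my.
by rewrite (_ : l * m + (1 - l) * m = m)//; ring.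
Qed.

(** * Monotone transport between two profiles *)

Section Transport.
Variables (M l : R) (f g h qf qg : R -> R) (af bf ag bg : R).
Hypotheses (l01 : 0 < l < 1) (pf : profile M f) (pg : profile M g) (ph : profile M h).
Hypotheses (Vf : 0 < mass M f M) (Vg : 0 < mass M g M).
Hypothesis fgh : forall s t, f s `^ l * g t `^ (1 - l) <= h (l * s + (1 - l) * t).
Hypotheses (Maf : - M <= af) (abf : af < bf) (bMf : bf <= M)
  (fpos : forall x, af < x < bf -> 0 < f x) (Qf : quantile M f af bf qf).
Hypotheses (Mag : - M <= ag) (abg : ag < bg) (bMg : bg <= M)
  (gpos : forall x, ag < x < bg -> 0 < g x) (Qg : quantile M g ag bg qg).

(** [r] interpolates the t-quantiles of f and g, and [D t] is the mass of h to the left of [r t].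
    [D] has slope at least [W] and values between 0 and the mass of h; this gives the inequality
    and, when the mass of h is at most [W], the linearity of [D]. *)
Let r t := l * qf t + (1 - l) * qg t.
Let W := mass M f M `^ l * mass M g M `^ (1 - l).
Let D t := mass M h (r t).
Let dD t := h (r t) * (l * (mass M f M / f (qf t)) + (1 - l) * (mass M g M / g (qg t))).

(** Such an x is the combination of the two points that sit at the same relative position th in the
    two supports. *)
Lemma transport_hpos x : l * af + (1 - l) * ag < x < l * bf + (1 - l) * bg -> 0 < h x.
Proof.
move=> /andP[ax xb]; move/andP: l01 => [l0 l1].
pose th := (x - (l * af + (1 - l) * ag)) / (l * bf + (1 - l) * bg - (l * af + (1 - l) * ag)).
have d0 : 0 < l * bf + (1 - l) * bg - (l * af + (1 - l) * ag).
  by rewrite subr_gt0 conv_smono.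
have th0 : 0 < th by rewrite divr_gt0//; lra.
have th1 : th < 1 by rewrite ltr_pdivrMr// mul1r; lra.
have -> : x = l * (af + th * (bf - af)) + (1 - l) * (ag + th * (bg - ag)).
  suff : x = (l * af + (1 - l) * ag) + th * (l * bf + (1 - l) * bg - (l * af + (1 - l) * ag)).
    by move=> {1}->; ring.
  by rewrite /th divfK ?gt_eqF//; ring.
apply: lt_le_trans (fgh _ _).
have inside a b : a < b -> a < a + th * (b - a) < b.
  by move=> ab; rewrite ltrDl mulr_gt0 ?subr_gt0//= -ltrBrDl gtr_pMl// subr_gt0.
by rewrite mulr_gt0// powR_gt0//; [apply: fpos|apply: gpos]; exact: inside.
Qed.

Lemma transport_r t : 0 < t < 1 ->
  l * af + (1 - l) * ag < r t < l * bf + (1 - l) * bg.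
Proof.
move=> t01; have [/andP[? ?] _ _] := Qf.1 t t01; have [/andP[? ?] _ _] := Qg.1 t t01.
by rewrite /r !conv_smono.
Qed.

Lemma transport_derive t : 0 < t < 1 -> is_derive t 1 D (dD t).
Proof.
move=> t01; have [qfi _ dqf] := Qf.1 t t01; have [qgi _ dqg] := Qg.1 t t01.
have Ma : - M <= l * af + (1 - l) * ag by exact: conv_ge.
have dm := mass_is_derive ph Ma transport_hpos (transport_r t01).
have dr : is_derive t 1 r (l * (mass M f M / f (qf t)) + (1 - l) * (mass M g M / g (qg t))).
  have -> : r = (l *: (qf : R -> R^o) + (1 - l) *: (qg : R -> R^o)) by apply/funext => x.
  exact: is_deriveD (is_deriveZ l dqf) (is_deriveZ (1 - l) dqg).
by apply: is_derive_eq (is_derive1_comp dm dr) _.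
Qed.

(** Weighted AM-GM on the two quantile slopes gives [W] divided by the weighted geometric mean of
    the values of f and g, and [fgh] bounds that mean by h. *)
Lemma transport_lower t : 0 < t < 1 -> W <= dD t.
Proof.
move=> t01; have [qfi _ _] := Qf.1 t t01; have [qgi _ _] := Qg.1 t t01.
have f0 := fpos qfi; have g0 := gpos qgi.
have := powR_amgm l01 (divr_gt0 Vf f0) (divr_gt0 Vg g0).
rewrite !powR_div// => am.
have p0 : 0 < f (qf t) `^ l * g (qg t) `^ (1 - l) by rewrite mulr_gt0 ?powR_gt0.
apply: le_trans (_ : f (qf t) `^ l * g (qg t) `^ (1 - l) *
  (l * (mass M f M / f (qf t)) + (1 - l) * (mass M g M / g (qg t))) <= _).
  rewrite -ler_pdivrMl//; apply: le_trans am.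
  rewrite le_eqVlt; apply/orP; left; apply/eqP; rewrite /W.
  by field; rewrite !gt_eqF ?powR_gt0.
rewrite ler_pM2r; first exact: fgh.
by move/andP: l01 => [? ?]; rewrite addr_gt0// mulr_gt0 ?divr_gt0 ?subr_gt0.
Qed.

Lemma transport_growth s t : 0 < s -> s <= t -> t < 1 -> W * (t - s) <= D t - D s.
Proof.
move=> s0; rewrite le_eqVlt => /predU1P[->|st] t1; first by rewrite !subrr mulr0.
have in01 x : s <= x <= t -> 0 < x < 1 by move=> /andP[? ?]; lra.
have [||c + ->] := @MVT _ D dD s t st.
- by move=> x; rewrite in_itv/= => /andP[? ?]; apply: transport_derive; apply: in01; rewrite !ltW.
- apply: derivable_within_continuous => x; rewrite in_itv/= => /in01 x01.
  by case: (transport_derive x01).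
rewrite in_itv/= => /andP[? ?]; rewrite ler_pM2r ?subr_gt0//.
by apply: transport_lower; apply: in01; rewrite !ltW.
Qed.

Lemma transport_bounds t : 0 < t < 1 -> 0 <= D t <= mass M h M.
Proof.
move=> t01; have /andP[r1 r2] := transport_r t01; move/andP: l01 => [l0 l1].
have rM : - M <= r t.
  by apply: le_trans (ltW r1); exact: conv_ge.
have {}r2 : r t <= M by apply: le_trans (ltW r2) _; exact: conv_le.
rewrite -(mass_start M h); apply/andP; split; first exact: mass_nd.
by apply: mass_nd.
Qed.

Lemma transport_le : W <= mass M h M.
Proof.
rewrite leNgt; apply/negP => mW.
have m0 : 0 <= mass M h M by have := @transport_bounds (1/2) ltac:(lra); lra.
(* Growth over [e, 1 - e] loses only 2 * e * W, half of the assumed gap. *)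
pose e := (W - mass M h M) / (4 * W).
have e0 : 0 < e by rewrite divr_gt0//; lra.
have eE : e * (4 * W) = W - mass M h M by rewrite divfK//; lra.
have e1 : e < 1 / 2 by nra.
have /andP[? ?] := @transport_bounds e ltac:(lra).
have /andP[? ?] := @transport_bounds (1 - e) ltac:(lra).
have := @transport_growth e (1 - e) e0 ltac:(lra) ltac:(lra).
nra.
Qed.

(** When the mass of h is at most [W], the growth bounds on [e, t] and on [t, 1 - e] leave no slack
    on either side as e becomes small. *)
Lemma transport_tight t : mass M h M <= W -> 0 < t < 1 -> D t = W * t.
Proof.
move=> hW t01; have W0 : 0 < W by rewrite mulr_gt0 ?powR_gt0.
apply/eqP; rewrite eq_le; apply/andP; split; rewrite leNgt; apply/negP => lt.
  pose e := Num.min ((1 - t) / 2) ((D t - W * t) / (2 * W)).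
  have e0 : 0 < e by rewrite lt_min !divr_gt0//; lra.
  have e1 : e <= (1 - t) / 2 by rewrite ge_min lexx.
  have e2 : e * (2 * W) <= D t - W * t by rewrite -ler_pdivlMr ?ge_min ?lexx ?orbT//; lra.
  have /andP[? ?] := @transport_bounds (1 - e) ltac:(lra).
  have := @transport_growth t (1 - e) ltac:(lra) ltac:(lra) ltac:(lra).
  nra.
pose e := Num.min (t / 2) ((W * t - D t) / (2 * W)).
have e0 : 0 < e by rewrite lt_min !divr_gt0//; lra.
have e1 : e <= t / 2 by rewrite ge_min lexx.
have e2 : e * (2 * W) <= W * t - D t by rewrite -ler_pdivlMr ?ge_min ?lexx ?orbT//; lra.
have /andP[? ?] := @transport_bounds e ltac:(lra).
have := @transport_growth e t ltac:(lra) ltac:(lra) ltac:(lra).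
nra.
Qed.

Lemma transport_tight_derive t : mass M h M <= W -> 0 < t < 1 -> dD t = W.
Proof.
move=> hW t01; have dDt := transport_derive t01.
have dW : is_derive t 1 (W *: (id : R -> R^o)) W.
  by apply: is_derive_eq; rewrite /GRing.scale/= mulr1.
have nE : {near t, D =1 (W *: (id : R -> R^o))}.
  have := @near_in_itvoo R 0 1 t; rewrite in_itv/= => /(_ t01).
  by apply: filterS => x; rewrite in_itv/= => x01; rewrite transport_tight.
rewrite -(@derive_val _ _ _ _ _ _ _ dDt) -[RHS](@derive_val _ _ _ _ _ _ _ dW).
by apply: near_eq_derive => //; rewrite oner_eq0.
Qed.

End Transport.

Theorem prekopa_leindler M l f g h : 0 < l < 1 ->
  profile M f -> profile M g -> profile M h ->
  (forall s t, f s `^ l * g t `^ (1 - l) <= h (l * s + (1 - l) * t)) ->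
  mass M f M `^ l * mass M g M `^ (1 - l) <= mass M h M.
Proof.
move=> l01 pf pg ph fgh; have /andP[l0 l1] := l01.
have m0 k : profile M k -> 0 <= mass M k M.
  by move=> [k0 _ _ _]; apply: Rintegral_ge0.
have [Vf|Vf] := ltP 0 (mass M f M); last first.
  have -> : mass M f M = 0 by apply/eqP; rewrite eq_le Vf m0.
  by rewrite powR0 ?gt_eqF// mul0r m0.
have [Vg|Vg] := ltP 0 (mass M g M); last first.
  have -> : mass M g M = 0 by apply/eqP; rewrite eq_le Vg m0.
  by rewrite powR0 ?gt_eqF ?subr_gt0// mulr0 m0.
have [af [bf [Maf abf bMf fpos fsupp]]] := profile_support pf Vf.
have [ag [bg [Mag abg bMg gpos gsupp]]] := profile_support pg Vg.
have [qf Qf] := quantile_exists pf Vf Maf abf bMf fpos fsupp.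
have [qg Qg] := quantile_exists pg Vg Mag abg bMg gpos gsupp.
exact: (@transport_le M l f g h qf qg af bf ag bg).
Qed.

Definition support_itv f a b :=
  (forall x, a < x < b -> 0 < f x) /\ (forall x, 0 < f x -> a <= x <= b).

(** Tight transport has constant slope V, which at each t reads H * (F + G) = 2 * F * G; with F * G
    <= H ^ 2 this forces F = G = H. The two quantile functions then have equal derivatives, so they
    differ by a constant c. *)
Theorem prekopa_leindler_eq M f g h :
  profile M f -> profile M g -> profile M h ->
  (forall s t, f s * g t <= h ((s + t) / 2) ^+ 2) ->
  0 < mass M f M -> mass M g M = mass M f M -> mass M h M <= mass M f M ->
  exists af bf ag bg c, [/\ support_itv f af bf, support_itv g ag bg,
    forall s, af < s < bf ->
      [/\ ag < s + c < bg, g (s + c) = f s & h (s + c / 2) = f s] &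
    forall t, ag < t < bg -> af < t - c < bf].
Proof.
move=> pf pg ph fgh Vf Vgf Vh; set V := mass M f M in Vf Vgf Vh.
pose l : R := 1 / 2.
have l01 : 0 < l < 1 by rewrite /l; lra.
have lE : 1 - l = l by rewrite /l; lra.
have [f0 _ _ _] := pf; have [g0 _ _ _] := pg; have [h0 _ _ _] := ph.
have sqrtE x y : 0 <= x -> 0 <= y -> x `^ l * y `^ l = Num.sqrt (x * y).
  by move=> x0 y0; rewrite -powRM// /l div1r powR12_sqrt ?mulr_ge0.
have fgh' s t : f s `^ l * g t `^ (1 - l) <= h (l * s + (1 - l) * t).
  rewrite lE sqrtE// -(ger0_norm (h0 _)) -sqrtr_sqr ler_wsqrtr//.
  by apply: le_trans (fgh _ _) _; rewrite (_ : (s + t) / 2 = l * s + l * t)// /l; lra.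
have Vg : 0 < mass M g M by rewrite Vgf.
have [af [bf [Maf abf bMf fpos fsupp]]] := profile_support pf Vf.
have [ag [bg [Mag abg bMg gpos gsupp]]] := profile_support pg Vg.
have [qf Qf] := quantile_exists pf Vf Maf abf bMf fpos fsupp.
have [qg Qg] := quantile_exists pg Vg Mag abg bMg gpos gsupp.
have WE : mass M f M `^ l * mass M g M `^ (1 - l) = V.
  by rewrite Vgf lE sqrtE ?ltW// -expr2 sqrtr_sqr ger0_norm ?ltW.
have key t : 0 < t < 1 -> f (qf t) = g (qg t) /\ h (l * qf t + (1 - l) * qg t) = f (qf t).
  move=> t01; have : h (l * qf t + (1 - l) * qg t) *
      (l * (mass M f M / f (qf t)) + (1 - l) * (mass M g M / g (qg t))) = V.
    by rewrite (@transport_tight_derive M l f g h qf qg af bf ag bg) ?WE.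
  rewrite Vgf -/V.
  have [qfi _ _] := Qf.1 t t01; have [qgi _ _] := Qg.1 t t01.
  have fq := fpos _ qfi; have gq := gpos _ qgi.
  have := fgh (qf t) (qg t).
  rewrite (_ : (qf t + qg t) / 2 = l * qf t + (1 - l) * qg t); last by rewrite /l; lra.
  set H := h _; set F := f _ in fq *; set G := g _ in gq * => FGH HE.
  have {}HE : H * (F + G) = 2 * (F * G).
    have : H * (l * (V / F) + (1 - l) * (V / G)) * (2 * (F * G)) = V * (2 * (F * G)) by rewrite HE.
    rewrite lE /l => e; apply: (mulfI (lt0r_neq0 Vf)).
    rewrite -/V -e; field.
    by rewrite !gt_eqF.
  have FG : F = G.
    have : F * G * (F + G) ^+ 2 <= F * G * (4 * (F * G)).
      have -> : F * G * (4 * (F * G)) = (H * (F + G)) ^+ 2 by rewrite HE; ring.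
      by rewrite exprMn ler_wpM2r// sqr_ge0.
    rewrite ler_pM2l ?mulr_gt0// => FG4.
    have : (F - G) ^+ 2 <= 0 by nra.
    by rewrite real_exprn_even_le0//= subr_eq0 => /eqP.
  split=> //; apply: (mulIf (lt0r_neq0 (addr_gt0 fq gq))).
  by rewrite HE -FG; ring.
pose d t := qg t - qf t.
have dd t : 0 < t < 1 -> is_derive t 1 d 0.
  move=> t01; have [_ _ dqf] := Qf.1 t t01; have [_ _ dqg] := Qg.1 t t01.
  have [FG _] := key t t01.
  have -> : d = (qg : R -> R^o) - (qf : R -> R^o) by apply/funext.
  by apply: is_derive_eq; rewrite Vgf FG subrr.
have dcst s t : 0 < s -> s < t -> t < 1 -> d s = d t.
  move=> s0 st t1.
  have in01 x : s <= x <= t -> 0 < x < 1 by move=> /andP[? ?]; lra.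
  have [||c _] := @MVT _ d (fun=> 0) s t st.
  - by move=> x; rewrite in_itv/= => /andP[? ?]; apply: dd; apply: in01; rewrite !ltW.
  - apply: derivable_within_continuous => x; rewrite in_itv/= => /in01 x01.
    by case: (dd _ x01).
  by rewrite mul0r => /eqP; rewrite subr_eq0 => /eqP.
pose c := d l.
have dE t : 0 < t < 1 -> qg t = qf t + c.
  move=> /andP[t0 t1]; suff <- : d t = c by rewrite /d; ring.
  have /andP[l0 l1] := l01; rewrite /c.
  by case: (ltgtP t l) => [tl|lt|->//]; [exact: dcst|rewrite (dcst l t)].
exists af, bf, ag, bg, c; split => //.
- move=> s /(Qf.2)[t t01 <-]; have [FG HF] := key t t01.
  have [qgi _ _] := Qg.1 t t01.
  rewrite -dE//; split=> //; rewrite -HF; congr h.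
  by rewrite lE dE// /l; lra.
- move=> t /(Qg.2)[u u01 <-]; have [qfi _ _] := Qf.1 u u01.
  by rewrite dE// addrK.
Qed.

End OneDim.

(** * The Brunn-Minkowski inequality *)

Section RowVectors.
Context {R : realType}.

Lemma normr_coord n (x : 'rV[R]_n) i : `|x ord0 i| <= `|x|.
Proof.
rewrite [leRHS]/Num.norm /= mx_normrE.
by apply/bigmax_geP; right => /=; exists (ord0, i).
Qed.

Lemma normr_rV_le n (x : 'rV[R]_n) c : 0 <= c ->
  (forall i, `|x ord0 i| <= c) -> `|x| <= c.
Proof.
move=> c0 xc; rewrite [leLHS]/Num.norm /= mx_normrE.
by apply/bigmax_leP; split => // -[i j] _ /=; rewrite ord1.
Qed.

Lemma linear_continuous_rV n (W : normedModType R) (f : {linear 'rV[R]_n -> W}) :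
  continuous f.
Proof.
apply: bounded_linear_continuous.
pose C := \sum_(i < n) `|f (delta_mx 0 i)|.
have fC x : `|f x| <= `|x| * C.
  rewrite {1}(row_sum_delta x) linear_sum; apply: le_trans (ler_norm_sum _ _ _) _.
  rewrite mulr_sumr; apply: ler_sum => i _.
  by rewrite linearZ/= normrZ ler_wpM2r// normr_coord.
rewrite /bounded_near.
exists (1 * C); split; first by rewrite num_real.
move=> D CD; apply: filterS (@nbhsx_ballx _ _ (0 : 'rV[R]_n) 1 ltr01) => x.
rewrite -ball_normE /= sub0r normrN => /ltW x1.
apply: le_trans (fC x) _; apply: le_trans (ltW CD).
by rewrite ler_wpM2r// sumr_ge0.
Qed.

Lemma convexP n (A : set 'rV[R]_n) : convex_set A <->
  forall x y l, A x -> A y -> 0 < l < 1 -> A (l *: x + (1 - l) *: y).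
Proof.
split=> [cA x y l Ax Ay /andP[l0 l1]|cA].
  have li : 0 <= l <= 1 by rewrite !ltW.
  pose l' : {i01 R} := Itv01 (ltW l0) (ltW l1).
  by have := cA x y l'; rewrite !inE => /(_ Ax Ay).
apply/convex_setW => x y /set_mem Ax /set_mem Ay k k0 k1; apply/mem_set.
by apply: cA => //; rewrite k0.
Qed.

(** The Minkowski combination l A + (1 - l) B. *)
Definition mix n l (A B : set 'rV[R]_n) : set 'rV[R]_n :=
  [set l *: p.1 + (1 - l) *: p.2 | p in A `*` B].

Lemma mix_mem n l (A B : set 'rV[R]_n) x y : A x -> B y -> mix l A B (l *: x + (1 - l) *: y).
Proof. by move=> Ax By; exists (x, y). Qed.

Lemma mix_compact n l (A B : set 'rV[R]_n) : compact A -> compact B -> compact (mix l A B).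
Proof.
move=> cA cB; apply: continuous_compact; last exact: compact_setX.
apply: continuous_subspaceT => p.
by apply: cvgD; apply: cvgZ; (try exact: cvg_cst); [exact: cvg_fst|exact: cvg_snd].
Qed.

Lemma mix_convex n l (A B : set 'rV[R]_n) : convex_set A -> convex_set B -> convex_set (mix l A B).
Proof.
move=> /convexP cA /convexP cB; apply/convexP => _ _ k [[x y] /= [Ax By] <-] [[x' y'] /= [Ax' By'] <-] k01.
rewrite (_ : _ + _ = l *: (k *: x + (1 - k) *: x') + (1 - l) *: (k *: y + (1 - k) *: y')).
  by apply: mix_mem; [exact: cA|exact: cB].
by apply/rowP => i; rewrite !mxE; ring.
Qed.

Lemma compact_norm_bound n (A : set 'rV[R]_n) : compact A ->
  exists2 M, 0 < M & forall x, A x -> `|x| < M.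
Proof.
move=> /compact_bounded [M [_ AM]]; exists (`|M| + 2); first by rewrite ltr_wpDl.
move=> x Ax; apply: le_lt_trans (AM (`|M| + 1) _ x Ax) _.
  by apply: le_lt_trans (ler_norm M) _; rewrite ltrDl.
by rewrite ltrD2l ltr1n.
Qed.

Lemma rV_closed n (A : set 'rV[R]_n) : compact A -> closed A.
Proof. by move=> cA; apply: compact_closed cA; exact: norm_hausdorff. Qed.

(** Written exactly as in [vol], so that [volS] holds by computation. *)
Definition cns n (t : R) (y : 'rV[R]_n) : 'rV[R]_n.+1 := row_mx (t%:M : 'rV[R]_1) y.

Lemma cns0 n t (y : 'rV[R]_n) : cns t y ord0 ord0 = t.
Proof.
have := row_mxEl (t%:M : 'rV[R]_1) y ord0 ord0; rewrite [X in _ = X]mxE eqxx mulr1n => tE.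
rewrite -[RHS]tE; by congr (row_mx _ _ _ _); exact: val_inj.
Qed.

Lemma cnsS n t (y : 'rV[R]_n) i : cns t y ord0 (lift ord0 i) = y ord0 i.
Proof.
rewrite -[RHS](row_mxEr (t%:M : 'rV[R]_1)).
by congr (row_mx _ _ _ _); exact: val_inj.
Qed.

Definition slice n (A : set 'rV[R]_n.+1) t : set 'rV[R]_n := [set y | A (cns t y)].

Lemma volS n (A : set 'rV[R]_n.+1) :
  vol A = (\int[@lebesgue_measure R]_t vol (slice A t))%E.
Proof. by []. Qed.

Lemma sliceE n (A : set 'rV[R]_n.+1) t y : slice A t y = A (cns t y).
Proof. by []. Qed.

Lemma rvD n (x y : 'rV[R]_n) i : (x + y) ord0 i = x ord0 i + y ord0 i.
Proof. by rewrite mxE. Qed.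

Lemma rvN n (x : 'rV[R]_n) i : (- x) ord0 i = - x ord0 i.
Proof. by rewrite mxE. Qed.

Lemma rvZ n c (x : 'rV[R]_n) i : (c *: x) ord0 i = c * x ord0 i.
Proof. by rewrite mxE. Qed.

Lemma rv0 n i : (0 : 'rV[R]_n) ord0 i = 0.
Proof. by rewrite mxE. Qed.

Definition rvE := (rvD, rvN, rvZ, rv0).

Lemma row_consP n (x y : 'rV[R]_n.+1) : x ord0 ord0 = y ord0 ord0 ->
  col' ord0 x = col' ord0 y -> x = y.
Proof.
move=> e0 eS; apply/rowP => i; case: (unliftP ord0 i) => [j ->|->//].
by move/rowP: eS => /(_ j); rewrite !mxE.
Qed.

Lemma col'_cns n t (y : 'rV[R]_n) : col' ord0 (cns t y) = y.
Proof. by apply/rowP => i; rewrite mxE cnsS. Qed.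

Lemma cnsE n (x : 'rV[R]_n.+1) : x = cns (x ord0 ord0) (col' ord0 x).
Proof. by apply: row_consP; rewrite ?cns0 ?col'_cns. Qed.

Lemma cns_mix n l s t (x y : 'rV[R]_n) :
  l *: cns s x + (1 - l) *: cns t y = cns (l * s + (1 - l) * t) (l *: x + (1 - l) *: y).
Proof.
apply/rowP => i; case: (unliftP ord0 i) => [j ->|->]; first by rewrite !(rvE, cnsS).
by rewrite !(rvE, cns0).
Qed.

Lemma cns_norm n t (y : 'rV[R]_n) : `|y| <= `|cns t y| /\ `|t| <= `|cns t y|.
Proof.
split; last by rewrite -[in leLHS](cns0 t y) normr_coord.
by apply: normr_rV_le => // i; rewrite -(cnsS t) normr_coord.
Qed.

Lemma slice_compact n (A : set 'rV[R]_n.+1) t : compact A -> compact (slice A t).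
Proof.
move=> cA.
have c1 : compact (A `&` [set x | x ord0 ord0 = t]).
  apply: compact_closedI => //.
  apply: (@preimage_closed _ _ (fun x : 'rV[R]_n.+1 => x ord0 ord0) [set t]).
    move=> x _; exact: coord_continuous.
  exact: closed_eq.
have -> : slice A t = col' ord0 @` (A `&` [set x | x ord0 ord0 = t]).
  apply/seteqP; split => [y Ay|_ [x [Ax <-] <-]]; last by rewrite /slice/= -cnsE.
  by exists (cns t y); rewrite ?col'_cns//; split=> //=; rewrite cns0.
apply: continuous_compact => //; apply: continuous_subspaceT.
exact: (@linear_continuous_rV _ _ (col' ord0)).
Qed.

Lemma slice_convex n (A : set 'rV[R]_n.+1) t : convex_set A -> convex_set (slice A t).
Proof.
move=> /convexP cA; apply/convexP => x y l Ax Ay l01.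
rewrite /slice/= (_ : t = l * t + (1 - l) * t); last by ring.
by rewrite -cns_mix; apply: cA.
Qed.

Lemma slice_mix n l (A B : set 'rV[R]_n.+1) s t :
  mix l (slice A s) (slice B t) `<=` slice (mix l A B) (l * s + (1 - l) * t).
Proof.
move=> _ [[x y] /= [Ax By] <-]; rewrite /slice/= -cns_mix; exact: mix_mem.
Qed.

Lemma mix_self n l (A : set 'rV[R]_n) : convex_set A -> 0 < l < 1 -> mix l A A `<=` A.
Proof. by move=> /convexP cA l01 _ [[x y] /= [Ax Ay] <-]; exact: cA. Qed.

(** * Monotonicity of the volume and the volume of grid cells *)

Local Notation mu := (@lebesgue_measure R).

(** The integral of a nonnegative function is a supremum over the simple functions below it, hence
    monotone on all functions; the section volumes of an arbitrary set may fail to be measurable. *)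
Lemma ge0_le_integral_any (f g : R -> \bar R) : (forall x, (0 <= f x)%E) ->
  (forall x, (f x <= g x)%E) -> (\int[mu]_x f x <= \int[mu]_x g x)%E.
Proof.
move=> f0 fg; rewrite !ge0_integralTE//; last by move=> x; exact: le_trans (fg x).
apply: le_ereal_sup; apply: image_subset => h hf x; exact: le_trans (hf x) (fg x).
Qed.

Lemma vol_ge0 n (A : set 'rV[R]_n) : (0 <= vol A)%E.
Proof.
elim: n A => [|n IH] A; first by rewrite /= lee_fin.
by rewrite volS; apply: integral_ge0.
Qed.

Lemma vol_le n (A B : set 'rV[R]_n) : A `<=` B -> (vol A <= vol B)%E.
Proof.
elim: n A B => [|n IH] A B AB.
  rewrite /= lee_fin !indicE ler_nat; case: (boolP (0 \in A)) => // /set_mem/AB/mem_set ->//.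
rewrite !volS; apply: ge0_le_integral_any => t; first exact: vol_ge0.
by apply: IH => y; rewrite !sliceE; exact: AB.
Qed.

Lemma vol0 n : vol (set0 : set 'rV[R]_n) = 0%E.
Proof.
elim: n => [|n IH]; first by rewrite /= indicE in_set0.
by rewrite volS (eq_integral (cst 0%E)) ?integral0// => t _; exact: IH.
Qed.

(* The half-open cube c + (z + [0, 1)^n) / k. *)
Definition cell n (c : 'rV[R]_n) (k : R) (z : 'rV[int]_n) : set 'rV[R]_n :=
  [set x | forall i, Num.floor (k * (x ord0 i - c ord0 i)) = z ord0 i].

Definition cells n (c : 'rV[R]_n) k (s : seq 'rV[int]_n) : set 'rV[R]_n :=
  [set x | exists2 z, z \in s & cell c k z x].

Lemma cells_slice n (c : 'rV[R]_n.+1) k s t : slice (cells c k s) t =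
  cells (col' ord0 c) k [seq col' ord0 z | z : 'rV[int]_n.+1 <- s & z ord0 ord0 == Num.floor (k * (t - c ord0 ord0))].
Proof.
apply/seteqP; split => y.
  move=> [z zs zc]; exists (col' ord0 z).
    by apply: map_f; rewrite mem_filter zs andbT -(zc ord0) cns0.
  by move=> i; rewrite !mxE -zc cnsS.
move=> [_ /mapP[z + ->] zc]; rewrite mem_filter => /andP[/eqP z0 zs].
exists z => // i; case: (unliftP ord0 i) => [j ->|->]; last by rewrite cns0.
by rewrite cnsS; have := zc j; rewrite !mxE.
Qed.

Lemma int_row_consP n (x y : 'rV[int]_n.+1) : x ord0 ord0 = y ord0 ord0 ->
  col' ord0 x = col' ord0 y -> x = y.
Proof.
move=> e0 eS; apply/rowP => i; case: (unliftP ord0 i) => [j ->|->//].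
by move/rowP: eS => /(_ j); rewrite !mxE.
Qed.

Lemma floor_itv (k c : R) (j : int) : 0 < k ->
  [set t | Num.floor (k * (t - c)) = j] = `[c + j%:~R / k, c + (j + 1)%:~R / k[%classic.
Proof.
move=> k0; apply/seteqP; split => t /=; rewrite in_itv/=.
  move=> <-; rewrite -lerBrDl -ltrBlDl ler_pdivrMr// ltr_pdivlMr// mulrC.
  by rewrite floor_le_tmp/= mulrC floorD1_gt.
rewrite -lerBrDl -ltrBlDl ler_pdivrMr// ltr_pdivlMr// mulrC => h.
by apply/eqP; rewrite floor_eq.
Qed.

Lemma integral_floor_indic (k c : R) (j : int) : 0 < k ->
  (\int[mu]_t (\1_[set t | Num.floor (k * (t - c)) = j] t)%:E = (k^-1)%:E)%E.
Proof.
move=> k0; rewrite floor_itv// integral_indic//= setIT lebesgue_measure_itv/= lte_fin.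
rewrite ltrD2l ltr_pM2r ?invr_gt0// ltr_int ltzD1 lexx -EFinB.
by congr (_%:E); rewrite intrD; field; rewrite gt_eqF.
Qed.

(** By slicing: at height t only the cells remain whose first index is the floor of k times the
    offset of t, so the section volume is a sum of indicators of intervals of length 1 / k, weighted
    by [k ^- n]. *)
Lemma vol_cells n (c : 'rV[R]_n) k s : 0 < k -> uniq s ->
  vol (cells c k s) = ((size s)%:R / k ^+ n)%:E.
Proof.
move=> k0; elim: n c s => [|n IH] c s us.
  rewrite /= expr0 divr1 indicE.
  case: s us => [|z [|z' s]] us; last 2 first.
  - by rewrite mem_set//; exists z; [rewrite mem_head|case].
  - move: us; rewrite /= in_cons negb_or => /andP[/andP[+ _] _].
    by rewrite (thinmx0 z) (thinmx0 z') eqxx.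
  by rewrite memNset// => -[].
pose I z := [set t | Num.floor (k * (t - c ord0 ord0)) = (z : 'rV[int]_n.+1) ord0 ord0].
have mI z : measurable (I z) by rewrite /I floor_itv.
have -> : vol (cells c k s) =
    (\int[mu]_t (\sum_(z <- s) (k ^- n)%:E * (\1_(I z) t)%:E))%E.
  rewrite volS; apply: eq_integral => t _; rewrite cells_slice IH; last first.
    rewrite map_inj_in_uniq ?filter_uniq// => x y.
    rewrite !mem_filter => /andP[/eqP xt _] /andP[/eqP yt _] /(int_row_consP _); apply.
    by rewrite xt yt.
  rewrite size_map; under eq_bigr do rewrite -EFinM.
  rewrite sumEFin -mulr_sumr mulrC; congr (_ * _)%:E.
  elim: (s) => [|z r IHr]; first by rewrite big_nil.
  rewrite big_cons -IHr indicE; case: (boolP (t \in I z)) => [/set_mem zt|zt] /=.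
    by rewrite ifT ?eqxx -?zt ?eqxx//= -natr1 addrC.
  rewrite ifF ?add0r//; apply/eqP => zt'; move/negP: zt; apply; apply/mem_set.
  by rewrite /I/= zt'.
rewrite ge0_integral_sum//; last 2 first.
- by move=> z; apply: measurable_funeM; apply/measurable_EFinP; apply/measurable_indicP; exact: mI.
- by move=> z t _; rewrite -EFinM lee_fin; apply: mulr_ge0; rewrite ?indicE// invr_ge0 exprn_ge0// ltW.
rewrite (eq_bigr (fun=> (k ^- n.+1)%:E)); last first.
  move=> z _; rewrite ge0_integralZl_EFin//; last first.
  - by rewrite invr_ge0 exprn_ge0// ltW.
  - by apply/measurable_EFinP; apply/measurable_indicP; exact: mI.
  by rewrite integral_floor_indic// -EFinM exprSr invfM.
rewrite big_const_seq count_predT.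
elim: (size s) => [|m IHm]; first by rewrite mul0r.
by rewrite iterS IHm -EFinD -[in RHS]natr1 mulrDl mul1r addrC.
Qed.

Definition volr n (A : set 'rV[R]_n) : R := fine (vol A).

Lemma slice_far n (A : set 'rV[R]_n.+1) M t : (forall x, A x -> `|x| < M) ->
  M <= `|t| -> slice A t = set0.
Proof.
move=> AM Mt; apply/seteqP; split => // y /AM; rewrite ltNge => /negP; apply.
by apply: le_trans Mt _; case: (cns_norm t y).
Qed.

Lemma slice_bound n (A : set 'rV[R]_n.+1) M t : (forall x, A x -> `|x| < M) ->
  forall y, slice A t y -> `|y| < M.
Proof. by move=> AM y /AM; apply: le_lt_trans; case: (cns_norm t y). Qed.

Lemma vol_bounded n (A : set 'rV[R]_n) M : 0 < M -> (forall x, A x -> `|x| < M) ->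
  (vol A <= ((2 * M) ^+ n)%:E)%E.
Proof.
move=> M0; elim: n A => [|n IH] A AM.
  by rewrite /= lee_fin expr0 indicE; case: (_ \in _).
have c0 : 0 <= (2 * M) ^+ n by rewrite exprn_ge0// mulr_ge0// ltW.
have -> : ((2 * M) ^+ n.+1)%:E =
    (\int[mu]_t (((2 * M) ^+ n)%:E * (\1_(`[- M, M]%classic) t)%:E))%E.
  rewrite ge0_integralZl_EFin//.
    rewrite integral_indic//= setIT lebesgue_measure_itv/= lte_fin ifT; last by lra.
    by rewrite -EFinB -EFinM exprSr; congr ((_ * _)%:E); ring.
  by apply/measurable_EFinP; apply/measurable_indicP; exact: measurable_itv.
rewrite volS; apply: ge0_le_integral_any => t; first exact: vol_ge0.
rewrite -EFinM indicE; case: (boolP (t \in _)) => [_|tM].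
  by rewrite mulr1; apply: IH => y; exact: slice_bound AM y.
rewrite (slice_far (M := M))// ?vol0 ?mulr0// leNgt; apply: contra tM => tM.
by apply/mem_set; rewrite /= in_itv/= -ler_norml ltW.
Qed.

Lemma volrE n (A : set 'rV[R]_n) : compact A -> vol A = (volr A)%:E.
Proof.
move=> /compact_norm_bound[M M0 AM]; rewrite /volr fineK// ge0_fin_numE ?vol_ge0//.
exact: le_lt_trans (vol_bounded M0 AM) (ltry _).
Qed.

Lemma volr_ge0 n (A : set 'rV[R]_n) : 0 <= volr A.
Proof. by rewrite /volr fine_ge0// vol_ge0. Qed.

Lemma volr_le n (A B : set 'rV[R]_n) : compact B -> A `<=` B -> volr A <= volr B.
Proof.
move=> cB AB; have vAB := vol_le AB; rewrite /volr; apply: fine_le => //.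
  rewrite ge0_fin_numE ?vol_ge0//; apply: le_lt_trans vAB _.
  by rewrite volrE// ltry.
by rewrite volrE.
Qed.

(** A predicate of the dimension, because the inequality in dimension n is what makes section
    volumes in dimension n + 1 log-concave. *)
Definition brunn_minkowski_at n := forall l (A B : set 'rV[R]_n), 0 < l < 1 ->
  compact A -> convex_set A -> compact B -> convex_set B ->
  volr A `^ l * volr B `^ (1 - l) <= volr (mix l A B).

Lemma slice_profile n (A : set 'rV[R]_n.+1) M : brunn_minkowski_at n -> 0 < M ->
  compact A -> convex_set A -> (forall x, A x -> `|x| < M) ->
  profile M (fun t => volr (slice A t)).
Proof.
move=> BM M0 cA xA AM; split.
- by move=> t; exact: volr_ge0.
- move=> l s t l01; apply: le_trans (BM l _ _ l01 _ _ _ _) _.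
  + exact: slice_compact.
  + exact: slice_convex.
  + exact: slice_compact.
  + exact: slice_convex.
  + apply: volr_le; first exact: slice_compact.
    by apply: subset_trans (@slice_mix _ _ _ _ _ _) _ => y; exact: mix_self.
- by move=> t Mt; rewrite (slice_far AM Mt) /volr vol0.
- exists ((2 * M) ^+ n) => t; rewrite -lee_fin -volrE; last exact: slice_compact.
  by apply: vol_bounded => // y; exact: slice_bound.
Qed.

Lemma volr_mass n (A : set 'rV[R]_n.+1) M : compact A -> (forall x, A x -> `|x| < M) ->
  volr A = mass M (fun t => volr (slice A t)) M.
Proof.
move=> cA AM; rewrite /volr /mass volS /Rintegral integral_mkcond; congr fine.
apply: eq_integral => t _; rewrite patchE; case: ifPn => [_|tM].
  by rewrite volrE//; exact: slice_compact.
rewrite (slice_far (M := M))// ?vol0// leNgt; apply: contra tM => tM.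
by apply/mem_set; rewrite /= in_itv/= -ler_norml ltW.
Qed.

(** The section of a mix contains the mix of the sections, so by induction the section volumes
    satisfy the hypothesis of [prekopa_leindler]. *)
Theorem brunn_minkowski n : brunn_minkowski_at n.
Proof.
elim: n => [|n IH] l A B l01 cA xA cB xB.
  have [l0 l1] := andP l01; rewrite /volr/= !indicE.
  case: (boolP (0 \in A)) => [/set_mem A0|_]; last first.
    by rewrite powR0 ?gt_eqF// mul0r.
  case: (boolP (0 \in B)) => [/set_mem B0|_]; last first.
    by rewrite [X in _ * X]powR0 ?gt_eqF ?subr_gt0// mulr0.
  rewrite !powR1 mulr1 mem_set//.
  by have := mix_mem l A0 B0; rewrite !scaler0 addr0.
have [MA MA0 AM] := compact_norm_bound cA.
have [MB MB0 BM] := compact_norm_bound cB.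
have cC := mix_compact (l := l) cA cB.
have [MC MC0 CM] := compact_norm_bound cC.
pose M := Num.max MA (Num.max MB MC).
have M0 : 0 < M by rewrite lt_max MA0.
have {}AM x : A x -> `|x| < M by move=> /AM; rewrite lt_max => ->.
have {}BM x : B x -> `|x| < M by move=> /BM; rewrite !lt_max => ->; rewrite orbT.
have {}CM x : mix l A B x -> `|x| < M by move=> /CM; rewrite !lt_max => ->; rewrite !orbT.
rewrite (volr_mass cA AM) (volr_mass cB BM) (volr_mass cC CM).
apply: prekopa_leindler => //; first exact: slice_profile.
- exact: slice_profile.
- by apply: slice_profile => //; exact: mix_convex.
move=> s t; apply: le_trans (IH l _ _ l01 _ _ _ _) _.
- exact: slice_compact.
- exact: slice_convex.
- exact: slice_compact.
- exact: slice_convex.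
- by apply: volr_le; [exact: slice_compact|exact: slice_mix].
Qed.

End RowVectors.

(** * Equality in the Brunn-Minkowski inequality *)

Section BrunnMinkowskiEq.
Context {R : realType}.

Lemma interiorP n (A : set 'rV[R]_n) x :
  interior A x <-> exists2 r, 0 < r & forall y, `|y - x| < r -> A y.
Proof.
split=> [/nbhs_ballP[r /= r0 rA]|[r r0 rA]].
  by exists r => // y yx; apply: rA; rewrite -ball_normE/= distrC.
by apply/nbhs_ballP; exists r => // y; rewrite -ball_normE/= distrC => /rA.
Qed.

Lemma interior_mix n (A : set 'rV[R]_n) x y l : convex_set A -> interior A y -> A x ->
  0 < l < 1 -> interior A (l *: y + (1 - l) *: x).
Proof.
move=> /convexP cA /interiorP[r r0 rA] Ax l01; have /andP[l0 l1] := l01.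
apply/interiorP; exists (l * r) => [|z zl]; first exact: mulr_gt0.
have -> : z = l *: (y + l^-1 *: (z - (l *: y + (1 - l) *: x))) + (1 - l) *: x.
  by rewrite scalerDr scalerA mulfV ?gt_eqF// scale1r addrAC [RHS]addrC subrK.
apply: cA => //; apply: rA.
by rewrite addrAC subrr add0r normrZ gtr0_norm ?invr_gt0// ltr_pdivrMl.
Qed.

Lemma closed_mix n (A : set 'rV[R]_n) x y : closed A ->
  (forall l, 0 < l < 1 -> A (l *: y + (1 - l) *: x)) -> A x.
Proof.
move=> cA Al; apply: cA => U /nbhs_ballP[r /= r0 rU].
pose l := Num.min (1 / 2) (r / (2 * (`|y - x| + 1))).
have k0 : 0 < 2 * (`|y - x| + 1) by rewrite mulr_gt0// ltr_wpDl.
have l0 : 0 < l by rewrite lt_min !divr_gt0.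
have l1 : l < 1 by rewrite gt_min; apply/orP; left; lra.
exists (l *: y + (1 - l) *: x); split; first by apply: Al; rewrite l0.
apply: rU; rewrite -ball_normE/=.
have -> : x - (l *: y + (1 - l) *: x) = - l *: (y - x).
  by apply/rowP => i; rewrite !rvE; ring.
rewrite normrZ normrN gtr0_norm//.
have lr : l * (2 * (`|y - x| + 1)) <= r.
  by rewrite -ler_pdivlMr// ge_min lexx orbT.
have := normr_ge0 (y - x); nra.
Qed.

Lemma volr_gt0 n (A : set 'rV[R]_n) : compact A -> interior A !=set0 -> 0 < volr A.
Proof.
move=> cA [c /interiorP[r r0 rA]].
(* One cell of side r / 2 with corner c stays inside the ball of radius r. *)
have k0 : 0 < 2 / r by rewrite divr_gt0.
have cellA : cells c (2 / r) [:: 0] `<=` A.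
  move=> x [z]; rewrite inE => /eqP-> zx; apply: rA.
  apply: le_lt_trans (_ : r / 2 < r); last by rewrite ltr_pdivrMr// ltr_pMr// ltr1n.
  apply: normr_rV_le; first by rewrite divr_ge0// ltW.
  move=> i; have := zx i; rewrite !rvE mxE => /eqP; rewrite floor_eq => /andP[].
  rewrite intrD mulr0z add0r pmulr_rge0// => x0 x1.
  by rewrite ger0_norm// ltW// -(ltr_pM2l k0) (_ : 2 / r * (r / 2) = 1)//; field; rewrite gt_eqF.
have := vol_le cellA; rewrite vol_cells// volrE// lee_fin; apply: lt_le_trans.
by rewrite div1r invr_gt0 exprn_gt0.
Qed.

Lemma interior_slice n (A : set 'rV[R]_n.+1) p : interior A p ->
  interior (slice A (p ord0 ord0)) (col' ord0 p).
Proof.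
move=> /interiorP[r r0 rA]; apply/interiorP; exists r => // y yp.
rewrite sliceE; apply: rA; apply: le_lt_trans yp.
apply: normr_rV_le => // i; rewrite !rvE; case: (unliftP ord0 i) => [j ->|->].
  by apply: le_trans (normr_coord _ j); rewrite cnsS !rvE mxE.
by rewrite cns0 subrr normr0.
Qed.

Lemma translateE n (v : 'rV[R]_n) A x : translate v A x <-> A (x - v).
Proof.
split=> [[y Ay <-]|Axv]; first by rewrite addrK.
by exists (x - v) => //; rewrite subrK.
Qed.

(** Iterating the inclusion keeps x - k v in the bounded set A for every k. *)
Lemma translate_subset n (v : 'rV[R]_n) A : compact A -> A !=set0 ->
  A `<=` translate v A -> v = 0.
Proof.
move=> cA [x Ax] AvA; have [M M0 AM] := compact_norm_bound cA.
have Ak k : A (x - k%:R *: v).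
  elim: k => [|k IH]; first by rewrite scale0r subr0.
  have /translateE := AvA _ IH.
  by rewrite -addrA -opprD -natr1 scalerDl scale1r.
apply/eqP; rewrite -normr_le0 leNgt; apply/negP => v0.
pose k := (Num.truncn ((M + `|x|) / `|v|)).+1.
have : (M + `|x|) / `|v| < k%:R by rewrite truncnS_gt.
rewrite ltr_pdivrMr// ltNge => /negP; apply.
have := AM _ (Ak k) => /ltW; rewrite -lerBlDr; apply: le_trans.
have : `|k%:R *: v| <= `|x - k%:R *: v| + `|x|.
  by set w := _ *: v; rewrite -{1}(subKr x w) [leRHS]addrC ler_normB.
by rewrite normrZ normr_nat -lerBlDr.
Qed.

(* Telescoping the hypothesis along a fine arithmetic progression leaves only
   the two boundary increments of p, which vanish by continuity. *)
Lemma telescope_nondecreasing (a b : R) (p w : R -> R) : concave_on a b p ->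
  (forall s t, a < s < b -> a < t < b ->
    p s + p t - 2 * p ((s + t) / 2) <= w ((s + t) / 2) - w t) ->
  forall x y, a < x -> x < y -> y < b -> w x <= w y.
Proof.
move=> cp H x y ax xy yb.
have cpx : {for x, continuous p} by apply: concave_continuous cp _; rewrite ax (lt_trans xy).
have cpy : {for y, continuous p} by apply: concave_continuous cp _; rewrite yb (lt_trans ax).
have step (h : R) k : 0 < h -> x + k.+1%:R * h < b ->
    (p (x + k.+1%:R * h) - p (x + k%:R * h)) - (p (x + h) - p x) <= w (x + k%:R * h) - w x.
  move=> h0; elim: k => [|k IH] kb.
    by rewrite mul0r addr0 mul1r !subrr.
  have kE : k.+2%:R * h = k%:R * h + 2 * h by rewrite -!natr1; ring.
  have k1E : k.+1%:R * h = k%:R * h + h by rewrite -!natr1; ring.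
  have kh0 : 0 <= k%:R * h by rewrite mulr_ge0// ltW.
  (* Two points two steps apart: the left side of H is then a second difference of p, centred at the
     grid point between them. *)
  have := H (x + k.+2%:R * h) (x + k%:R * h).
  have -> : (x + k.+2%:R * h + (x + k%:R * h)) / 2 = x + k.+1%:R * h.
    by rewrite kE k1E; field.
  move: kb IH; rewrite kE k1E.
  move: (k%:R * h) kh0 => u u0 ub IH.
  have i1 : a < x + (u + 2 * h) < b by rewrite ub andbT; lra.
  have i2 : a < x + u < b by apply/andP; split; lra.
  move=> /(_ i1 i2); have := IH ltac:(lra); lra.
rewrite -subr_ge0; apply/ler_addgt0Pr => e e0.
have e2 : 0 < e / 2 by rewrite divr_gt0.
have [d1 /= d10 P1] : \forall z \near x, `|p x - p z| < e / 2 by move/cvgrPdist_lt : cpx => /(_ _ e2).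
have [d2 /= d20 P2] : \forall z \near y, `|p y - p z| < e / 2 by move/cvgrPdist_lt : cpy => /(_ _ e2).
(* A step h < d keeps y + h below b and both boundary increments of p below e / 2. *)
pose d := Num.min (Num.min d1 d2) (b - y).
have d0 : 0 < d by rewrite !lt_min d10 d20 subr_gt0.
pose N := (Num.truncn ((y - x) / d)).+1.
have N0 : 0 < N%:R :> R by rewrite ltr0n.
pose h := (y - x) / N%:R.
have h0 : 0 < h by rewrite divr_gt0// subr_gt0.
have hd : h < d.
  rewrite ltr_pdivrMr// mulrC -ltr_pdivrMr//; exact: truncnS_gt.
have [hd1 hd2 hb] : [/\ h < d1, h < d2 & h < b - y] by split; apply: lt_le_trans hd _; rewrite !ge_min lexx ?orbT.
have Nh : N%:R * h = y - x by rewrite /h mulrC divfK ?gt_eqF.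
have := step h N h0; rewrite -natr1 mulrDl mul1r Nh => st.
have {}st : p (y + h) - p y - (p (x + h) - p x) <= w y - w x.
  have -> : y + h = x + (y - x + h) by ring.
  have yE : y = x + (y - x) by ring.
  rewrite {2}yE [w y](congr1 w yE); apply: st; lra.
have q1 : `|p x - p (x + h)| < e / 2.
  by apply: P1 => /=; rewrite opprD addrA subrr sub0r normrN gtr0_norm.
have q2 : `|p y - p (y + h)| < e / 2.
  by apply: P2 => /=; rewrite opprD addrA subrr sub0r normrN gtr0_norm.
move: q1 q2; rewrite !ltr_norml => /andP[? ?] /andP[? ?]; lra.
Qed.

(** Concavity and the hypothesis are stable under t -> - t, so w is monotone in both directions. *)
Lemma telescope_constant (a b : R) (p w : R -> R) : concave_on a b p ->
  (forall s t, a < s < b -> a < t < b ->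
    p s + p t - 2 * p ((s + t) / 2) <= w ((s + t) / 2) - w t) ->
  forall x y, a < x < b -> a < y < b -> w x = w y.
Proof.
move=> cp H.
have up := telescope_nondecreasing cp H.
have cp' : concave_on (- b) (- a) (p \o -%R).
  move=> s t l sab tab l01 /=; rewrite opprD -!mulrN; apply: cp => //; lra.
have down := @telescope_nondecreasing _ _ _ (w \o -%R) cp' _.
have eqw x y : a < x -> x < y -> y < b -> w x = w y.
  move=> ax xy yb; apply/eqP; rewrite eq_le up//=.
  have := down _ (- y) (- x); rewrite /= !opprK; apply; [|lra|lra|lra].
  move=> s t sab tab /=; rewrite (_ : - ((s + t) / 2) = (- s - t) / 2); last by field.
  by apply: H; lra.
move=> x y /andP[ax xb] /andP[ay yb].
by case: (ltgtP x y) => [xy|yx|->//]; [exact: eqw|apply/esym; exact: eqw].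
Qed.

Local Notation half := (1 / 2 : R).

Lemma half01 : 0 < half < 1.
Proof. by lra. Qed.

Lemma powR_half_sqr (x : R) : 0 <= x -> (x `^ half) ^+ 2 = x.
Proof. by move=> x0; rewrite div1r powR12_sqrt// sqr_sqrtr. Qed.

Lemma mix_half n (A B : set 'rV[R]_n) x y : A x -> B y -> mix half A B (half *: (x + y)).
Proof.
move=> Ax By; have := mix_mem half Ax By.
by rewrite (_ : 1 - half = half) ?scalerDr//; lra.
Qed.

Lemma mix_half_translate n v (A : set 'rV[R]_n) : convex_set A ->
  mix half A (translate v A) `<=` translate (half *: v) A.
Proof.
move=> cA _ [[x y] /= [Ax /translateE Ay] <-]; apply/translateE.
rewrite (_ : _ - _ = half *: x + (1 - half) *: (y - v)).
  by move/convexP: cA => /(_ _ _ _ Ax Ay half01).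
by apply/rowP => i; rewrite !rvE; field.
Qed.

Definition brunn_minkowski_eq_at n := forall A B : set 'rV[R]_n,
  convex_body A -> convex_body B -> volr B = volr A ->
  volr (mix half A B) <= volr A -> exists v, B = translate v A.

(* The rigidity statement itself, applied to the two bodies, shows that they
   differ by a translation; inclusion forces it to be trivial. *)
Lemma volr_eq_subset n (A B : set 'rV[R]_n) : brunn_minkowski_eq_at n ->
  convex_body A -> convex_body B -> A `<=` B -> volr B <= volr A -> B = A.
Proof.
move=> E bA bB AB BA; have [cA xA [a ia]] := bA; have [cB xB _] := bB.
have vAB : volr B = volr A by apply/eqP; rewrite eq_le BA volr_le.
have [|v BE] := E A B bA bB vAB.
  rewrite -vAB; apply: volr_le => // _ [[x y] /= [Ax By] <-].
  move/convexP : xB => xB; apply: xB => //; [exact: AB|exact: half01].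
have v0 : v = 0.
  apply: (translate_subset cA); last by rewrite -BE.
  by exists a; exact: interior_subset ia.
by rewrite BE v0; apply/seteqP; split => x; rewrite translateE subr0.
Qed.

(** Positive volume makes the sections inside ]a, b[ nonempty; joining an interior point of A to a
    point of A beyond height s yields an interior point of A at height s. *)
Lemma slice_body n (A : set 'rV[R]_n.+1) a b s : convex_body A ->
  support_itv (fun t => volr (slice A t)) a b -> a < s < b -> convex_body (slice A s).
Proof.
move=> [cA xA [y iy]] [apos asupp] /andP[as_ sb].
split; [exact: slice_compact|exact: slice_convex|].
have slice_ne t : a < t < b -> exists x, A x /\ x ord0 ord0 = t.
  move=> /apos vt; apply: contrapT => H.
  have : slice A t = set0.
    apply/seteqP; split => // z Az; apply: H; exists (cns t z); split => //; exact: cns0.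
  by move=> e; move: vt; rewrite e /volr vol0 ltxx.
pose t := y ord0 ord0.
suff [p [Ip ps]] : exists p, interior A p /\ p ord0 ord0 = s.
  by exists (col' ord0 p); rewrite -ps; exact: interior_slice.
case: (ltgtP t s) => [ts|st|ts]; last by exists y.
- have [x [Ax xE]] := slice_ne ((s + b) / 2) ltac:(lra).
  have [|l l01 sE] := @between_convex _ t s ((s + b) / 2); first by lra.
  exists (l *: y + (1 - l) *: x); split; first exact: interior_mix.
  by rewrite [RHS]sE !rvE xE.
- have [x [Ax xE]] := slice_ne ((a + s) / 2) ltac:(lra).
  have [|l l01 sE] := @between_convex _ ((a + s) / 2) s t; first by lra.
  exists ((1 - l) *: y + (1 - (1 - l)) *: x); split; first by apply: interior_mix => //; lra.
  by rewrite [RHS]sE /t !rvE xE; ring.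
Qed.

(** A ball around p gives the sections at all nearby heights positive volume, so the height of p is
    not an endpoint of the support. *)
Lemma interior_support n (A : set 'rV[R]_n.+1) a b p : compact A ->
  support_itv (fun t => volr (slice A t)) a b -> interior A p -> a < p ord0 ord0 < b.
Proof.
move=> cA [_ asupp] /interiorP[r r0 rA].
have key e : `|e| < r -> a <= p ord0 ord0 + e <= b.
  move=> er; apply: asupp; apply: volr_gt0; first exact: slice_compact.
  pose q := cns (p ord0 ord0 + e) (col' ord0 p).
  exists (col' ord0 p); have := @interior_slice n A q; rewrite /q cns0 col'_cns; apply.
  apply/interiorP; exists (r - `|e|); first by rewrite subr_gt0.
  move=> z zq; apply: rA; rewrite -(subrK q z) -addrA.
  apply: le_lt_trans (ler_normD _ _) _; move: zq; rewrite ltrBrDr => /(le_lt_trans _); apply.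
  rewrite lerD2l; apply: normr_rV_le => // i; rewrite !rvE.
  case: (unliftP ord0 i) => [j ->|->]; rewrite /q; last by rewrite cns0 addrAC subrr add0r.
  by rewrite cnsS mxE subrr normr0.
have h1 : `|r / 2| < r by rewrite gtr0_norm; lra.
have h2 : `|- (r / 2)| < r by rewrite normrN.
by have := key _ h1; have := key _ h2; lra.
Qed.

Lemma brunn_minkowski_sqr n (A B : set 'rV[R]_n) : compact A -> convex_set A ->
  compact B -> convex_set B -> volr A * volr B <= volr (mix half A B) ^+ 2.
Proof.
move=> cA xA cB xB; have := brunn_minkowski half01 cA xA cB xB.
rewrite (_ : 1 - half = half); last by lra.
move=> h; rewrite -(powR_half_sqr (volr_ge0 A)) -(powR_half_sqr (volr_ge0 B)) -exprMn.
by rewrite ler_pXn2r// nnegrE ?volr_ge0// mulr_ge0// powR_ge0.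
Qed.

Lemma slice_mix_half n (A B : set 'rV[R]_n.+1) s t :
  mix half (slice A s) (slice B t) `<=` slice (mix half A B) ((s + t) / 2).
Proof.
by rewrite (_ : (s + t) / 2 = half * s + (1 - half) * t); [exact: slice_mix|field].
Qed.

Lemma mix_half_body n (A B : set 'rV[R]_n) : convex_body A -> convex_body B ->
  convex_body (mix half A B).
Proof.
move=> [cA xA [a ia]] [cB xB [b ib]]; split; [exact: mix_compact|exact: mix_convex|].
have Bb : B b by exact: interior_subset.
exists (half *: (a + b)); have /interiorP[r r0 rA] := ia.
apply/interiorP; exists (half * r) => [|z zr]; first by lra.
rewrite (_ : z = half *: ((2 *: z - b) + b)); last by apply/rowP => i; rewrite !rvE; field.
apply: mix_half => //; apply: rA.
rewrite (_ : 2 *: z - b - a = 2 *: (z - half *: (a + b))); last first.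
  by apply/rowP => i; rewrite !rvE; field.
by rewrite normrZ ger0_norm//; lra.
Qed.

(** Concave in t, this is the p of [telescope_constant], with w the i-th coordinate of the vector
    that translates sections of A to sections of B. *)
Definition top n (A : set 'rV[R]_n.+1) i t := sup [set y ord0 i | y in slice A t].

Lemma topP n (A : set 'rV[R]_n.+1) i t : compact A -> slice A t !=set0 ->
  (forall y, slice A t y -> y ord0 i <= top A i t) /\
  (exists2 y, slice A t y & y ord0 i = top A i t).
Proof.
move=> cA ne; have [c /set_mem Ac cmax] := @EVT_max_rV R n (fun y => y ord0 i) (slice A t) ne
  (slice_compact cA) (continuous_subspaceT (@coord_continuous _ _ _ _ _)).
have -> : top A i t = c ord0 i.
  apply/eqP; rewrite eq_le; apply/andP; split.
    by apply: ge_sup => [|_ [y Ay <-]]; [exists (c ord0 i), c|apply: cmax; exact/mem_set].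
  by apply: ub_le_sup; [exists (c ord0 i) => _ [y Ay <-]; apply: cmax; exact/mem_set|exists c].
by split=> [y Ay|]; [apply: cmax; exact/mem_set|exists c].
Qed.

Lemma top_concave n (A : set 'rV[R]_n.+1) i a b : compact A -> convex_set A ->
  (forall t, a < t < b -> slice A t !=set0) -> concave_on a b (top A i).
Proof.
move=> cA /convexP xA ne s t l sab tab l01.
have [_ [x Ax <-]] := topP i cA (ne _ sab).
have [_ [y Ay <-]] := topP i cA (ne _ tab).
have Axy : slice A (l * s + (1 - l) * t) (l *: x + (1 - l) *: y).
  by rewrite sliceE -cns_mix; exact: xA.
have [ub _] : (forall z, slice A (l * s + (1 - l) * t) z -> z ord0 i <= top A i (l * s + (1 - l) * t)) /\ True.
  by split=> //; apply: (topP i cA _).1; exists (l *: x + (1 - l) *: y).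
by have := ub _ Axy; rewrite !rvE.
Qed.

Theorem brunn_minkowski_eq n : brunn_minkowski_eq_at n.
Proof.
elim: n => [|n IH] A B bA bB vBA vC.
  have [_ _ [a ia]] := bA; have [_ _ [b ib]] := bB.
  have Aa := interior_subset ia; have Bb := interior_subset ib.
  exists 0; apply/seteqP; split => x _; last by rewrite (thinmx0 x) -(thinmx0 b).
  by apply/translateE; rewrite (thinmx0 (x - 0)) -(thinmx0 a).
have [cA xA neA] := bA; have [cB xB neB] := bB.
have [cC xC neC] := mix_half_body bA bB.
set C := mix half A B in cC xC neC vC.
have [MA MA0 AM] := compact_norm_bound cA.
have [MB MB0 BM] := compact_norm_bound cB.
have [MC MC0 CM] := compact_norm_bound cC.
pose M := Num.max MA (Num.max MB MC).
have M0 : 0 < M by rewrite lt_max MA0.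
have {}AM x : A x -> `|x| < M by move=> /AM; rewrite lt_max => ->.
have {}BM x : B x -> `|x| < M by move=> /BM; rewrite !lt_max => ->; rewrite orbT.
have {}CM x : C x -> `|x| < M by move=> /CM; rewrite !lt_max => ->; rewrite !orbT.
have pA := slice_profile (@brunn_minkowski R n) M0 cA xA AM.
have pB := slice_profile (@brunn_minkowski R n) M0 cB xB BM.
have pC := slice_profile (@brunn_minkowski R n) M0 cC xC CM.
have VA := volr_gt0 cA neA.
move: vBA vC VA; rewrite (volr_mass cA AM) (volr_mass cB BM) (volr_mass cC CM) => vBA vC VA.
have [|af [bf [ag [bg [c [SA SB sAB sBA]]]]]] := prekopa_leindler_eq pA pB pC _ VA vBA vC.
  move=> s t; apply: le_trans (brunn_minkowski_sqr _ _ _ _) _;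
    [exact: slice_compact|exact: slice_convex|exact: slice_compact|exact: slice_convex|].
  rewrite ler_pXn2r ?nnegrE ?volr_ge0//.
  by apply: volr_le; [exact: slice_compact|exact: slice_mix_half].
have bodyA s : af < s < bf -> convex_body (slice A s) by exact: slice_body SA.
have bodyB t : ag < t < bg -> convex_body (slice B t) by exact: slice_body SB.
(* The section of C is pinned down as well: comparing v at different heights uses points of C that
   come from sections of A and B at unrelated heights. *)
have exv s : exists v, af < s < bf -> slice B (s + c) = translate v (slice A s) /\
    slice C (s + c / 2) `<=` translate (half *: v) (slice A s).
  have [sI|_] := boolP (af < s < bf); last by exists 0.
  have [tI gE hE] := sAB s sI.
  have bAs := bodyA s sI; have bBt := bodyB _ tI.
  have [cAs xAs neAs] := bAs; have [cBt xBt neBt] := bBt.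
  have sub : mix half (slice A s) (slice B (s + c)) `<=` slice C (s + c / 2).
    by rewrite (_ : s + c / 2 = (s + (s + c)) / 2); [exact: slice_mix_half|field].
  have cCr : compact (slice C (s + c / 2)) by exact: slice_compact.
  have le1 : volr (mix half (slice A s) (slice B (s + c))) <= volr (slice A s).
    by rewrite -hE; exact: volr_le.
  have [v BE] := IH _ _ bAs bBt gE le1.
  exists v => _; split => //.
  have bP := mix_half_body bAs bBt.
  have bC : convex_body (slice C (s + c / 2)).
    split; [exact: cCr|exact: slice_convex|].
    have [_ _ [z iz]] := bP; exists z; exact: interiorS iz.
  (* Brunn-Minkowski bounds the mix of the two sections from below by their common volume, which is
     also that of the section of C, so this section is the mix. *)
  rewrite (volr_eq_subset IH bP bC sub); first by rewrite BE; exact: mix_half_translate.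
  rewrite hE -[leLHS]ger0_norm ?volr_ge0// -[leRHS]ger0_norm ?volr_ge0//.
  rewrite -!sqrtr_sqr ler_wsqrtr//; apply: le_trans (brunn_minkowski_sqr cAs xAs cBt xBt).
  by rewrite gE.
have [v vP] := choice exv.
have neAs s : af < s < bf -> slice A s !=set0.
  by move=> /bodyA[_ _ [z iz]]; exists z; exact: interior_subset.
have vcst s t : af < s < bf -> af < t < bf -> v s = v t.
  move=> sI tI; apply/rowP => i.
  apply: (telescope_constant (p := top A i) (w := fun s => v s ord0 i) (a := af) (b := bf)) => //.
    exact: top_concave.
  move=> {}s {}t {}sI {}tI; set m := (s + t) / 2.
  have mI : af < m < bf by rewrite /m; lra.
  have [_ [x Ax <-]] := topP i cA (neAs _ sI).
  have [_ [y Ay <-]] := topP i cA (neAs _ tI).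
  have [topm _] := topP i cA (neAs _ mI).
  (* The midpoint of a top point of A at s and one of B at t + c lies in C at m + c / 2, hence in
     the section of A at m shifted by v m / 2. Its coordinate i gives the telescoping hypothesis. *)
  have : slice C (m + c / 2) (half *: (x + (y + v t))).
    rewrite (_ : m + c / 2 = (s + (t + c)) / 2); last by rewrite /m; field.
    apply: slice_mix_half; apply: mix_half => //.
    by rewrite (vP t tI).1; apply/translateE; rewrite addrK.
  move=> /(vP m mI).2 /translateE/topm; rewrite !rvE; lra.
have [a0 ia0] := neA; have a0I := interior_support cA SA ia0.
pose v0 := v (a0 ord0 ord0).
exists (cns c v0).
have shift s y : af < s < bf -> slice B (s + c) (y + v0) <-> slice A s y.
  by move=> sI; rewrite (vP s sI).1 translateE /v0 (vcst _ s a0I sI) addrK.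
have cnsD s t (y z : 'rV[R]_n) : cns s y + cns t z = cns (s + t) (y + z).
  by have := cns_mix; move=> _; apply/rowP => i; case: (unliftP ord0 i) => [j ->|->]; rewrite ?rvE ?(cnsS, cns0) ?rvE.
apply/seteqP; split => x.
  move=> Bx; apply/translateE; have [b0 ib0] := neB.
  (* The sections are matched over the open support only; points at extreme heights are reached
     along segments from an interior point. *)
  apply: (@closed_mix _ _ _ (b0 - cns c v0)); first exact: rV_closed.
  move=> l l01; have ib := interior_mix xB ib0 Bx l01.
  set z := _ + _; have zE : z = (l *: b0 + (1 - l) *: x) - cns c v0.
    by apply/rowP => i; rewrite !rvE; ring.
  have tI := sBA _ (interior_support cB SB ib).
  move: (interior_subset ib); rewrite (_ : _ + _ = z + cns c v0); last by rewrite zE subrK.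
  have z0E : z ord0 ord0 = (l *: b0 + (1 - l) *: x) ord0 ord0 - c by rewrite zE rvE rvN cns0.
  rewrite -z0E in tI.
  by rewrite (cnsE z) cnsD -sliceE shift// !cns0 ?col'_cns.
move=> /translateE Ax; apply: (@closed_mix _ _ _ (a0 + cns c v0)); first exact: rV_closed.
move=> l l01; have ia := interior_mix xA ia0 Ax l01.
set z := l *: (a0 + _) + _; have zE : l *: a0 + (1 - l) *: (x - cns c v0) = z - cns c v0.
  by apply/rowP => i; rewrite !rvE; ring.
have sI := interior_support cA SA ia; rewrite zE in sI ia.
have := interior_subset ia; rewrite -[in B z](subrK (cns c v0) z).
move: (z - cns c v0) sI => u sI; rewrite {1 2}(cnsE u) cnsD => Au.
by apply/(shift _ _ sI).
Qed.

End BrunnMinkowskiEq.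

(** * Volume and symmetry of lattice tiles *)

Section Counting.
Context {R : realType}.

Definition intv n (z : 'rV[int]_n) : 'rV[R]_n := map_mx intr z.

Lemma intvE n (z : 'rV[int]_n) i : intv z ord0 i = (z ord0 i)%:~R.
Proof. by rewrite mxE. Qed.

Lemma intvD n (z w : 'rV[int]_n) : intv (z + w) = intv z + intv w.
Proof. exact: map_mxD. Qed.

Lemma intvN n (z : 'rV[int]_n) : intv (- z) = - intv z.
Proof. exact: map_mxN. Qed.

Lemma intv0 n : intv (0 : 'rV[int]_n) = 0.
Proof. exact: map_mx0. Qed.

Lemma intv_inj n : injective (@intv n).
Proof.
by move=> z w /rowP e; apply/rowP => i; have := e i; rewrite !intvE => /intr_inj.
Qed.

Lemma int_pointsP n (x : 'rV[R]_n) : int_points x <-> exists z, x = intv z.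
Proof.
split=> [xi|[z ->] i]; last by rewrite intvE.
exists (\row_i Num.floor (x ord0 i)); apply/rowP => i.
by rewrite intvE mxE; have := xi i; rewrite intrEfloor => /eqP.
Qed.

(** The lattice is q Z^n: q = 1 for the tile, and q = 2 for the doubled tile, whose volume 2^n comes
    from the same count. *)
Definition packs (q : nat) n (P : set 'rV[R]_n) := forall x z,
  interior P x -> interior P (x - q%:R *: intv z) -> z = 0.

Definition covers (q : nat) n (P : set 'rV[R]_n) := forall x, exists z, P (x - q%:R *: intv z).

Section Residues.
Context {n N : nat}.

Definition residue (z : 'rV[int]_n) : 'rV['I_N.+1]_n :=
  \row_i inord `|(z ord0 i %% N.+1)%Z|%N.

Definition representative (w : 'rV['I_N.+1]_n) : 'rV[int]_n := \row_i (w ord0 i : nat)%:Z.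

Lemma residue_eq z z' : residue z = residue z' -> exists u, z = z' + N.+1%:Z *: u.
Proof.
move=> /rowP e; exists (\row_i ((z ord0 i - z' ord0 i) %/ N.+1)%Z).
apply/rowP => i; rewrite !mxE mulrC divzK; first by rewrite addrC subrK.
have := congr1 (fun x : 'I_N.+1 => (x : nat)%:Z) (e i); rewrite !mxE.
have absE (y : int) : ((inord `|(y %% N.+1)%Z|%N : 'I_N.+1) : nat)%:Z = (y %% N.+1)%Z.
  rewrite inordK ?gez0_abs ?modz_ge0//.
  by rewrite -ltz_nat gez0_abs ?modz_ge0// ltz_pmod.
by rewrite !absE => /eqP; rewrite eqz_mod_dvd.
Qed.

Lemma residue_representative w u : residue (representative w + N.+1%:Z *: u) = w.
Proof.
apply/rowP => i; rewrite !mxE addrC mulrC modzMDl modz_small ?inord_val//.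
by rewrite lez_nat leq0n ltz_nat ltn_ord.
Qed.

End Residues.

Lemma card_residues n N : #|{: 'rV['I_N]_n}| = (N ^ n)%N.
Proof. by rewrite card_mx card_ord mul1n. Qed.

Lemma le_limit_inv (g : R -> R) V c : {for 0, continuous g} ->
  (forall k : nat, c < k%:R -> V <= g (c / k%:R)) -> V <= g 0.
Proof.
move=> cg H; rewrite leNgt; apply/negP => gV.
have : \forall x \near 0, g x < V by apply: cvgr_lt cg _ _.
move=> /nbhs_ballP[d /= d0 dV].
pose k := (Num.truncn (Num.max `|c| (`|c| / d))).+1.
have : Num.max `|c| (`|c| / d) < k%:R by rewrite truncnS_gt.
rewrite gt_max ltr_pdivrMr// => /andP[ck cdk].
have k0 : 0 < k%:R :> R by rewrite ltr0n.
have := H k (le_lt_trans (ler_norm c) ck); rewrite leNgt => /negP; apply.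
apply: dV; rewrite /ball/= sub0r normrN normrM normfV normr_nat.
by rewrite ltr_pdivrMr// mulrC.
Qed.

Lemma pow_ratio_continuous (q e : R) n : {for 0, continuous (fun x : R => (q * (1 + e * x)) ^+ n)}.
Proof.
apply: (@continuous_comp _ _ _ (fun x : R => q * (1 + e * x)) (fun x => x ^+ n)); last exact: exprn_continuous.
apply: continuousM; first exact: cst_continuous.
apply: continuousD; first exact: cst_continuous.
exact: mulrl_continuous.
Qed.

Lemma le_limit_ratio (V q c : R) n :
  (forall k : nat, c < k%:R -> V <= (q * (1 + c / k%:R)) ^+ n) -> V <= q ^+ n.
Proof.
move=> H; have := @le_limit_inv _ V c (@pow_ratio_continuous q 1 n).
by rewrite mulr0 addr0 mulr1; apply=> k /H; rewrite mul1r.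
Qed.

Lemma ge_limit_ratio (V q c : R) n :
  (forall k : nat, c < k%:R -> (q * (1 - c / k%:R)) ^+ n <= V) -> q ^+ n <= V.
Proof.
move=> H; have := @le_limit_inv (fun x => - (q * (1 + -1 * x)) ^+ n) (- V) c _.
rewrite mulr0 addr0 mulr1 lerN2; apply.
  by apply: continuousN; exact: pow_ratio_continuous.
by move=> k /H; rewrite lerN2 mulN1r.
Qed.

Lemma cell_norm n (c : 'rV[R]_n) k z x : 0 < k -> cell c k z x ->
  `|k *: (x - c) - intv z| <= 1.
Proof.
move=> k0 zx; apply: normr_rV_le => // i; rewrite !rvE intvE.
have := zx i => /eqP; rewrite floor_eq intrD => /andP[? ?].
by rewrite ler_norml; apply/andP; split; lra.
Qed.

(** Count the cells of mesh 1 / k that meet P. The index z of such a cell, read in the finer grid of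
    mesh 1 / (k + j), gives a point [pt z] pulled towards y and thus interior to P. Indices
    congruent modulo q * (k + j) give points differing by a vector of q Z^n, so packing leaves at
    most one index per residue class. Then let k grow. *)
Lemma packs_vol q n (P : set 'rV[R]_n) : (0 < q)%N -> convex_body P -> packs q P ->
  (vol P <= (q%:R ^+ n)%:E)%E.
Proof.
move=> q0 [cP xP [y iy]] pP; have /interiorP[r r0 rP] := iy.
(* The ball of radius r around y has to absorb a rounding error of 1 / j. *)
have [j jr] : exists j : nat, 1 < j%:R * r.
  exists (Num.truncn (1 / r)).+1; rewrite -ltr_pdivrMr//; exact: truncnS_gt.
have j0 : 0 < j%:R :> R by rewrite lt_neqAle ler0n andbT eq_sym; apply/eqP => j0; move: jr; rewrite j0 mul0r; lra.
rewrite volrE// lee_fin; apply: (@le_limit_ratio _ _ j%:R) => k jk.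
have k0 : 0 < k%:R :> R by lra.
have kj0 : 0 < k%:R + j%:R :> R by lra.
pose pt z := y + (k%:R + j%:R)^-1 *: intv z.
pose N := (q * (k + j)).-1.
have NE : N.+1 = (q * (k + j))%N by rewrite /N prednK// muln_gt0 q0 -(ltr_nat R) natrD.
have uniq_class z z' : interior P (pt z) -> interior P (pt z') ->
    residue (N := N) z = residue z' -> z = z'.
  move=> iz iz' /residue_eq[u zE]; rewrite zE.
  suff -> : u = 0 by rewrite scaler0 addr0.
  apply: (pP _ _ iz); suff -> : pt z - q%:R *: intv u = pt z' by exact: iz'.
  rewrite /pt zE NE; apply/rowP => i; rewrite !rvE !intvE !mxE intrD intrM.
  rewrite -pmulrn natrM natrD; field.
  by rewrite -natrD pnatr_eq0 -(eqr_nat R) natrD gt_eqF.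
(* A class without an interior point contributes the index 0, which can only enlarge the union of
   cells. *)
pose pick (w : 'rV['I_N.+1]_n) : 'rV[int]_n :=
  if pselect (exists z, interior P (pt z) /\ residue z = w) is left h then projT1 (cid h) else 0.
have pickP z : interior P (pt z) -> pick (residue z) = z.
  move=> iz; rewrite /pick; case: pselect => [h|[]]; last by exists z.
  by case: cid => z' /= [iz' /uniq_class]; apply.
pose s := undup [seq pick w | w <- enum {: 'rV['I_N.+1]_n}].
have Ps : P `<=` cells y k%:R s.
  move=> x Px; pose z : 'rV[int]_n := \row_i Num.floor (k%:R * (x ord0 i - y ord0 i)).
  have zx : cell y k%:R z x by move=> i; rewrite mxE.
  exists z => //; rewrite mem_undup -(pickP z).
    by apply: map_f; rewrite mem_enum.
  (* Weight j / (k + j) on a point within 1 / j of y, the remaining weight on x. *)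
  have -> : pt z = (j%:R / (k%:R + j%:R)) *: (y + j%:R^-1 *: (intv z - k%:R *: (x - y))) +
      (1 - j%:R / (k%:R + j%:R)) *: x.
    rewrite /pt; apply/rowP => i; rewrite !rvE; field.
    by rewrite -natrD !pnatr_eq0 -!(eqr_nat R) natrD !gt_eqF.
  apply: interior_mix => //; last first.
    by rewrite divr_gt0//= ltr_pdivrMr// mul1r; lra.
  apply/interiorP; exists (r - j%:R^-1).
    by rewrite subr_gt0 -[X in X < _]mul1r ltr_pdivrMr// mulrC.
  move=> p pr; apply: rP; move: pr; rewrite ltrBrDr; apply: le_lt_trans.
  set e := _ *: (_ - _ *: _); have eE : p - y = p - (y + e) + e by rewrite opprD addrA subrK.
  rewrite eE; apply: le_trans (ler_normD _ _) _; rewrite lerD2l /e normrZ distrC.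
  by rewrite ger0_norm ?invr_ge0// ler_piMr ?invr_ge0// cell_norm.
rewrite -lee_fin -volrE//; apply: le_trans (vol_le Ps) _.
rewrite vol_cells ?undup_uniq// lee_fin.
have ss : ((size s)%:R : R) <= (q%:R * (k%:R + j%:R)) ^+ n.
  rewrite -natrD -natrM -NE -natrX ler_nat (leq_trans (size_undup _))//.
  by rewrite size_map -cardE card_residues.
rewrite (_ : (q%:R * (1 + j%:R / k%:R)) ^+ n = (q%:R * (k%:R + j%:R)) ^+ n / k%:R ^+ n); last first.
  by rewrite -expr_div_n; congr (_ ^+ n); field; rewrite gt_eqF.
by rewrite ler_pM2r// invr_gt0 exprn_gt0.
Qed.

(** The opposite count: in the coarser grid of mesh 1 / (k - j), covering provides in each residue
    class modulo q * (k - j) an index z with [pt z] in P, and convexity puts the whole cell of mesh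
    1 / k with that index inside P. *)
Lemma covers_vol q n (P : set 'rV[R]_n) : (0 < q)%N -> convex_body P -> covers q P ->
  ((q%:R ^+ n)%:E <= vol P)%E.
Proof.
move=> q0 [cP xP [y iy]] pP; have /interiorP[r r0 rP] := iy.
have [j jr] : exists j : nat, 1 < j%:R * r.
  exists (Num.truncn (1 / r)).+1; rewrite -ltr_pdivrMr//; exact: truncnS_gt.
have j0 : 0 < j%:R :> R by rewrite lt_neqAle ler0n andbT eq_sym; apply/eqP => j0; move: jr; rewrite j0 mul0r; lra.
rewrite volrE// lee_fin; apply: (@ge_limit_ratio _ _ j%:R) => k jk.
have k0 : 0 < k%:R :> R by lra.
have kj0 : 0 < k%:R - j%:R :> R by lra.
have jk' : (j < k)%N by rewrite -(ltr_nat R).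
pose pt z := y + (k%:R - j%:R)^-1 *: intv z.
pose N := (q * (k - j)).-1.
have NE : N.+1 = (q * (k - j))%N by rewrite /N prednK// muln_gt0 q0 subn_gt0.
have ex (w : 'rV['I_N.+1]_n) : exists z, P (pt z) /\ residue z = w.
  have [u Pu] := pP (pt (representative w)).
  exists (representative w + N.+1%:Z *: (- u)); split; last exact: residue_representative.
  move: Pu; congr (P _); apply/rowP => i; rewrite /pt !rvE !intvE !mxE intrD intrM intrN.
  have -> : N.+1%:~R = q%:R * (k%:R - j%:R) :> R by rewrite -pmulrn NE natrM natrB// ltnW.
  by field; rewrite gt_eqF.
have [pick pickP] := choice ex.
pose s := [seq pick w | w <- enum {: 'rV['I_N.+1]_n}].
have us : uniq s.
  rewrite map_inj_uniq ?enum_uniq// => w w' e.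
  by rewrite -(pickP w).2 -(pickP w').2 e.
have sP : cells y k%:R s `<=` P.
  move=> x [z /mapP[w _ ->] zx]; have [Pz _] := pickP w.
  have -> : x = (j%:R / k%:R) *: (y + j%:R^-1 *: (k%:R *: (x - y) - intv (pick w))) +
      (1 - j%:R / k%:R) *: pt (pick w).
    rewrite /pt; apply/rowP => i; rewrite !rvE; field.
    by rewrite !gt_eqF.
  move/convexP : xP => xP; apply: xP => //; last first.
    by rewrite divr_gt0//= ltr_pdivrMr// mul1r.
  apply: rP; rewrite addrAC subrr add0r normrZ ger0_norm ?invr_ge0//.
  apply: le_lt_trans (_ : j%:R^-1 < r).
    by rewrite ler_piMr ?invr_ge0// cell_norm.
  by rewrite -[X in X < _]mul1r ltr_pdivrMr// mulrC.
rewrite -lee_fin -volrE//; apply: le_trans (vol_le sP).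
rewrite vol_cells// lee_fin size_map -cardE card_residues NE natrX natrM natrB ?(ltnW jk')//.
by rewrite -expr_div_n le_eqVlt; apply/orP; left; apply/eqP; congr (_ ^+ n); field; rewrite gt_eqF.
Qed.

(** * Symmetry of lattice tiles *)

Definition aff n (c : R) (t : 'rV[R]_n) (A : set 'rV[R]_n) : set 'rV[R]_n :=
  [set c *: x + t | x in A].

Lemma affP n (c : R) t (A : set 'rV[R]_n) y : c != 0 -> aff c t A y <-> A (c^-1 *: (y - t)).
Proof.
move=> c0; split=> [[x Ax <-]|Ay]; first by rewrite addrK scalerA mulVf// scale1r.
by exists (c^-1 *: (y - t)) => //; rewrite scalerA mulfV// scale1r subrK.
Qed.

Lemma aff_interior n (c : R) t (A : set 'rV[R]_n) y : c != 0 ->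
  interior (aff c t A) y <-> interior A (c^-1 *: (y - t)).
Proof.
move=> c0; have nc0 : 0 < `|c| by rewrite normr_gt0.
split=> /interiorP[r r0 rA]; apply/interiorP.
  exists (`|c|^-1 * r) => [|z zr]; first by rewrite mulr_gt0// invr_gt0.
  have := rA (c *: z + t); rewrite affP// addrK scalerA mulVf// scale1r; apply.
  rewrite (_ : _ - y = c *: (z - c^-1 *: (y - t))); last first.
    by apply/rowP => i; rewrite !rvE; field.
  by rewrite normrZ -ltr_pdivlMl.
exists (`|c| * r) => [|z zr]; first by rewrite mulr_gt0.
apply/affP => //; apply: rA.
rewrite (_ : _ - _ = c^-1 *: (z - y)); last by apply/rowP => i; rewrite !rvE; field.
by rewrite normrZ normfV ltr_pdivrMl.
Qed.

Lemma aff_body n (c : R) t (A : set 'rV[R]_n) : c != 0 -> convex_body A -> convex_body (aff c t A).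
Proof.
move=> c0 [cA /convexP xA [a ia]]; split.
- apply: continuous_compact cA; apply: continuous_subspaceT => x.
  apply: (@cvgD _ _ _ (nbhs x) _ ( *:%R c) (cst t)); last exact: cvg_cst.
  exact: scaler_continuous.
- apply/convexP => _ _ l [x Ax <-] [y Ay <-] l01.
  exists (l *: x + (1 - l) *: y); first exact: xA.
  by apply/rowP => i; rewrite !rvE; ring.
- by exists (c *: a + t); apply/aff_interior => //; rewrite addrK scalerA mulVf// scale1r.
Qed.

Lemma translate_dilate n c t (A : set 'rV[R]_n) : translate t (dilate c A) = aff c t A.
Proof.
apply/seteqP; split => [_ [_ [x Ax <-] <-]|_ [x Ax <-]]; first by exists x.
by exists (c *: x) => //; exists x.
Qed.

Lemma interior_midpoint n (A : set 'rV[R]_n) x y : convex_set A -> interior A x ->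
  interior A y -> interior A (2^-1 *: (x + y)).
Proof.
move=> xA ix iy; rewrite (_ : _ *: _ = (1 / 2) *: x + (1 - 1 / 2) *: y).
  by apply: interior_mix => //; [exact: interior_subset|exact: half01].
by apply/rowP => i; rewrite !rvE; field.
Qed.

(* Interior points of (A + B)/2 are midpoints of interior points: push them
   away from a fixed interior midpoint before splitting. *)
Lemma interior_mix_half n (A B : set 'rV[R]_n) x : convex_body A -> convex_body B ->
  interior (mix (1 / 2) A B) x ->
  exists a b, [/\ interior A a, interior B b & x = 2^-1 *: (a + b)].
Proof.
move=> [_ xA [a ia]] [_ xB [b ib]] /interiorP[r r0 rC].
pose s := 2^-1 *: (a + b); pose e := r / (2 * (`|x - s| + 1)).
have k0 : 0 < 2 * (`|x - s| + 1) by rewrite mulr_gt0// ltr_wpDl.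
have e0 : 0 < e by rewrite divr_gt0.
have [|[p q] /= [Ap Bq] pq] := rC (x + e *: (x - s)).
  rewrite addrAC subrr add0r normrZ gtr0_norm//.
  have : e * (2 * (`|x - s| + 1)) = r by rewrite divfK// gt_eqF.
  by have := normr_ge0 (x - s); nra.
pose l := e / (1 + e).
have e1 : 0 < 1 + e by rewrite addr_gt0.
have l01 : 0 < l < 1 by rewrite divr_gt0//= ltr_pdivrMr// mul1r ltrDr.
exists (l *: a + (1 - l) *: p), (l *: b + (1 - l) *: q); split.
- exact: interior_mix.
- exact: interior_mix.
have xE : x = (1 + e)^-1 *: ((x + e *: (x - s)) + e *: s).
  by apply/rowP => i; rewrite !rvE; field; rewrite gt_eqF.
rewrite xE -pq /s /l; apply/rowP => i; rewrite !rvE; field.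
by rewrite gt_eqF.
Qed.

(** Let x = (a - b) / 2 and x - z = (a' - b') / 2 with a, b, a', b' interior to P. Then (a + b') / 2
    and (a' + b) / 2 are interior to P and differ by z. *)
Lemma packs_difference n (P : set 'rV[R]_n) : convex_body P -> packs 1 P ->
  packs 1 (mix (1 / 2) P (aff (-1) 0 P)).
Proof.
move=> bP pP x z; have N1 : -1 != 0 :> R by rewrite oppr_eq0 oner_eq0.
have bN := aff_body 0 N1 bP; have [_ xP _] := bP.
have invN1 : (-1)^-1 = -1 :> R by rewrite invrN invr1.
move=> /(interior_mix_half bP bN)[a [b [ia /aff_interior ib xE]]].
move=> /(interior_mix_half bP bN)[a' [b' [ia' /aff_interior ib' xzE]]].
have {}ib := ib N1; have {}ib' := ib' N1.
have i1 := interior_midpoint xP ia ib'; have i2 := interior_midpoint xP ia' ib.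
apply: (pP _ _ i1); move: i2; congr (interior P _).
move: xzE; rewrite xE => /rowP xzE; apply/rowP => i; have := xzE i.
by rewrite !rvE intvE invN1 mul1r => h; lra.
Qed.

Lemma packs_opp q n (P : set 'rV[R]_n) : packs q P -> packs q (aff (-1) 0 P).
Proof.
move=> pP x z; have N1 : -1 != 0 :> R by rewrite oppr_eq0 oner_eq0.
have invN1 : (-1)^-1 = -1 :> R by rewrite invrN invr1.
move=> /aff_interior-/(_ N1) i1 /aff_interior-/(_ N1) i2.
apply/eqP; rewrite -oppr_eq0; apply/eqP; apply: (pP _ _ i1).
by move: i2; congr (interior P _); apply/rowP => i; rewrite !rvE !intvE !mxE intrN invN1; ring.
Qed.

Lemma covers_opp q n (P : set 'rV[R]_n) : covers q P -> covers q (aff (-1) 0 P).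
Proof.
move=> pP x; have N1 : -1 != 0 :> R by rewrite oppr_eq0 oner_eq0.
have invN1 : (-1)^-1 = -1 :> R by rewrite invrN invr1.
have [z Pz] := pP (- x); exists (- z); apply/affP => //.
by move: Pz; congr P; apply/rowP => i; rewrite !rvE !intvE !mxE intrN invN1; ring.
Qed.

Lemma tile_volr n (P : set 'rV[R]_n) : convex_body P -> packs 1 P -> covers 1 P -> volr P = 1.
Proof.
move=> bP pP cP; have [kP _ _] := bP.
have := packs_vol (ltnSn 0) bP pP; have := covers_vol (ltnSn 0) bP cP.
rewrite volrE// !expr1n !lee_fin => h1 h2.
by apply/eqP; rewrite eq_le h1 h2.
Qed.

(** The equality case is applied to the pair -P and P. As -P is again a tile, its volume is found by
    the same count. *)
Theorem tile_symmetric n (P : set 'rV[R]_n) : convex_body P -> packs 1 P -> covers 1 P ->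
  exists v, forall x, P (v - x) <-> P x.
Proof.
move=> bP pP cP; have N1 : -1 != 0 :> R by rewrite oppr_eq0 oner_eq0.
have bN := aff_body 0 N1 bP.
have [|v PE] := brunn_minkowski_eq bN bP (etrans (tile_volr bP pP cP) (esym (tile_volr bN (packs_opp pP) (covers_opp cP)))).
  rewrite (tile_volr bN (packs_opp pP) (covers_opp cP)) -lee_fin.
  have NN : aff (-1) 0 (aff (-1) 0 P) = P.
    by apply/seteqP; split => x; rewrite !affP// !subr0 scalerA invrN invr1 mulrNN mulr1 scale1r.
  have bM := mix_half_body bN bP; have [kM _ _] := bM.
  rewrite -volrE//; have := packs_difference bN (packs_opp pP); rewrite NN => pM.
  by have := packs_vol (ltnSn 0) bM pM; rewrite expr1n.
exists v => x; have -> : P x = translate v (aff (-1) 0 P) x by rewrite -PE.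
by rewrite translateE affP// subr0 invrN invr1 scaleN1r opprB.
Qed.

Lemma interior_symmetric n (P : set 'rV[R]_n) v : (forall x, P (v - x) <-> P x) ->
  forall x, interior P x -> interior P (v - x).
Proof.
move=> Pv x /interiorP[r r0 rP]; apply/interiorP; exists r => // y yx.
apply/Pv; apply: rP; rewrite -normrN; move: yx; congr (`|_| < _).
by apply/rowP => i; rewrite !rvE; ring.
Qed.

(** For a lattice point z interior to 2 P - v, the point (z + v) / 2 and its reflection (v - z) / 2
    are interior to P and differ by z, so z = 0. The volume is the count with q = 2. *)
Theorem tile_extremal n (P : set 'rV[R]_n) v : convex_body P -> packs 1 P -> covers 1 P ->
  (forall x, P (v - x) <-> P x) -> extremal_convex_body (aff 2 (- v) P).
Proof.
move=> bP pP cP Pv; have two0 : 2 != 0 :> R by rewrite pnatr_eq0.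
have bB := aff_body (- v) two0 bP; have [_ xP [c ic]] := bP.
have icB x : interior (aff 2 (- v) P) x <-> interior P (2^-1 *: (x + v)).
  by rewrite (aff_interior _ _ _ two0) opprK.
split.
- split=> //; apply/seteqP; split => [_ [x /affP Bx <-]|x /affP Bx].
    apply/affP => //; apply/Pv; move: (Bx two0); congr P.
    by apply/rowP => i; rewrite !rvE; field.
  exists (- x); last by rewrite opprK.
  apply/affP => //; apply/Pv; move: (Bx two0); congr P.
  by apply/rowP => i; rewrite !rvE; field.
- apply/seteqP; split => [x [/icB ix /int_pointsP[z xz]]|_ ->].
    suff z0 : z = 0 by rewrite /= xz z0 intv0.
    apply: (pP _ _ ix); have := interior_symmetric Pv ix; congr (interior P _).
    by rewrite xz; apply/rowP => i; rewrite !rvE !intvE; field.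
  split; last by apply/int_pointsP; exists 0; rewrite intv0.
  apply/icB; rewrite add0r.
  have := interior_midpoint xP ic (interior_symmetric Pv ic).
  by rewrite addrC subrK.
- apply/eqP; rewrite eq_le; apply/andP; split.
    apply: (packs_vol (q := 2)) => // x z /icB ix /icB ixz.
    apply: (pP _ _ ix); move: ixz; congr (interior P _).
    by apply/rowP => i; rewrite !rvE !intvE; field.
  apply: (covers_vol (q := 2)) => // x.
  have [z Pz] := cP (2^-1 *: (x + v)); exists z; apply/affP => //.
  by move: Pz; congr P; apply/rowP => i; rewrite !rvE !intvE; field.
Qed.

End Counting.

(** * Collision vectors of coverings *)

Section Collisions.
Context {R : realType}.

Lemma covering_seq n m (K : set 'rV[R]_n) x : mfold_covering m (lattice_translates K) ->
  exists s : seq 'rV[int]_n, [/\ uniq s, size s = m & forall z, z \in s -> K (x - intv z)].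
Proof.
move=> /(_ x)/pcard_leP[f].
have fP (i : nat) : (i < m)%N -> exists z, f i = translate (intv z) K /\ K (x - intv z).
  move=> im; have [[_ /int_pointsP[z ->] fE] fx] := 'funS_f (im : `I_m i).
  by exists z; split=> //; apply/translateE; rewrite fE.
have [g gP] : exists g : nat -> 'rV[int]_n, forall i, (i < m)%N ->
    f i = translate (intv (g i)) K /\ K (x - intv (g i)).
  have h i : exists z, (i < m)%N -> f i = translate (intv z) K /\ K (x - intv z).
    case: (ltnP i m) => im; last by exists 0.
    by have [z zP] := fP i im; exists z.
  by have [g gP] := choice h; exists g.
exists [seq g i | i <- iota 0 m]; split.
- rewrite map_inj_in_uniq ?iota_uniq// => i j; rewrite !mem_iota /= !add0n => im jm gij.
  apply: ('inj_f _ _ _); rewrite ?inE//.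
  by apply: (etrans (gP i im).1); rewrite gij; apply: esym; exact: (gP j jm).1.
- by rewrite size_map size_iota.
- by move=> z /mapP[i]; rewrite mem_iota => /andP[_ im] ->; exact: (gP i im).2.
Qed.

Definition collision n (K : set 'rV[R]_n) z :=
  z != 0 /\ exists x, interior K x /\ interior K (x - intv z).

Lemma collision_vectorsP n (K : set 'rV[R]_n) :
  collision_vectors K = (@intv R n) @` [set z | collision K z].
Proof.
apply/seteqP; split => [y [/int_pointsP[z ->] z0 [x [ix /translateE ixz]]]|_ [z [z0 [x [ix ixz]]] <-]].
  exists z => //; split; last by exists x.
  by apply: contra z0 => /eqP ->; rewrite intv0.
split; first by apply/int_pointsP; exists z.
  by apply: contra z0 => /eqP z0; apply/eqP; apply: (@intv_inj R); rewrite z0 intv0.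
by exists x; split=> //; apply/translateE.
Qed.

Lemma collision_seq n k (K : set 'rV[R]_n) : collision_vectors K #= `I_k ->
  exists D : seq 'rV[int]_n, [/\ uniq D, size D = k & forall z, z \in D <-> collision K z].
Proof.
move=> cK; have fK : finite_set (collision_vectors K) by apply/finite_setP; exists k.
have sK := card_fset_set cK.
pose D := [seq \row_i Num.floor (x ord0 i) | x : 'rV[R]_n <- finmap.enum_fset (fset_set (collision_vectors K))].
have memE x : x \in finmap.enum_fset (fset_set (collision_vectors K)) <-> collision_vectors K x.
  by rewrite (in_fset_set fK) inE.
have floorK (z : 'rV[int]_n) : \row_i Num.floor (@intv R n z ord0 i) = z.
  by apply/rowP => i; rewrite mxE intvE intrKfloor.
exists D; split.
- rewrite map_inj_in_uniq ?finmap.fset_uniq// => x y.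
  rewrite !memE collision_vectorsP => -[z _ <-] [w _ <-].
  by rewrite !floorK => ->.
- by rewrite size_map.
- move=> z; split=> [/mapP[x /memE]|Kz].
    by rewrite collision_vectorsP => -[w Kw <-] ->; rewrite floorK.
  rewrite -(floorK z); apply: map_f; apply/memE; rewrite collision_vectorsP.
  by exists z.
Qed.

Lemma collisionN n (K : set 'rV[R]_n) z : collision K z -> collision K (- z).
Proof.
move=> [z0 [x [ix ixz]]]; split; first by rewrite oppr_eq0.
by exists (x - intv z); split; [exact: ixz|rewrite intvN opprK subrK].
Qed.

(* Pushing x - z towards an interior point keeps x in the open set int K. *)
Lemma collision_of_mem n (K : set 'rV[R]_n) x z : convex_body K -> interior K x ->
  K (x - intv z) -> z != 0 -> collision K z.
Proof.
move=> [_ xK [q iq]] ix Kxz z0; split=> //.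
have /interiorP[r r0 rK] := ix.
pose v := q - (x - intv z); pose e := Num.min (1 / 2) (r / 2 / (`|v| + 1)).
have v0 : 0 < `|v| + 1 by rewrite ltr_wpDl.
have e0 : 0 < e by rewrite lt_min !divr_gt0.
have e1 : e < 1 by rewrite gt_min; apply/orP; left; lra.
have er : e * (`|v| + 1) <= r / 2 by rewrite -ler_pdivlMr// ge_min lexx orbT.
exists (x + e *: v); split.
  apply/interiorP; exists (r / 2) => [|y yx]; first by lra.
  apply: rK; rewrite (_ : y - x = y - (x + e *: v) + e *: v); last by rewrite opprD addrA subrK.
  apply: le_lt_trans (ler_normD _ _) _; rewrite normrZ gtr0_norm//.
  by have := normr_ge0 v; lra.
rewrite (_ : _ - _ = e *: q + (1 - e) *: (x - intv z)).
  by apply: interior_mix => //; rewrite e0.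
by rewrite /v; apply/rowP => i; rewrite !rvE; ring.
Qed.

Definition weight n (M : int) (z : 'rV[int]_n) : int := \sum_i z ord0 i * M ^+ i.

Lemma weightD n M (z w : 'rV[int]_n) : weight M (z + w) = weight M z + weight M w.
Proof. by rewrite /weight -big_split; apply: eq_bigr => i _; rewrite mxE mulrDl. Qed.

Lemma weightN n M (z : 'rV[int]_n) : weight M (- z) = - weight M z.
Proof. by rewrite /weight -sumrN; apply: eq_bigr => i _; rewrite mxE mulNr. Qed.

(* Each z is the coefficient row of a nonzero polynomial; take for M a point
   where the product of these polynomials does not vanish. *)
Lemma weight_neq0 n (D : seq 'rV[int]_n) : (forall z, z \in D -> z != 0) ->
  exists M : int, forall z, z \in D -> weight M z != 0.
Proof.
move=> D0; pose p (z : 'rV[int]_n) : {poly int} := rVpoly z.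
have p0 z : z \in D -> p z != 0.
  move=> /D0; apply: contra => /eqP pz; apply/eqP; apply: (can_inj (@rVpolyK _ _)).
  by rewrite -/(p z) pz linear0.
pose P := \prod_(z <- D) p z.
have P0 : P != 0.
  by rewrite prodf_seq_neq0; apply/allP => z zD; apply/implyP => _; exact: p0.
have [M PM] : exists M : int, P.[M] != 0.
  apply: contrapT => /forallNP H.
  have rP : all (root P) [seq (i : nat)%:Z | i <- iota 0 (size P)].
    by apply/allP => x _; apply/rootP; apply/eqP; apply: contrapT => h; apply: (H x); exact/negP.
  have us : uniq [seq (i : nat)%:Z | i <- iota 0 (size P)].
    by rewrite map_inj_uniq ?iota_uniq// => i j [].
  by have := max_poly_roots P0 rP us; rewrite size_map size_iota ltnn.
exists M => z zD; move: PM; rewrite horner_prod prodf_seq_neq0 => /allP/(_ z zD)/=.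
suff -> : (p z).[M] = weight M z by [].
by rewrite /p /rVpoly horner_poly; apply: eq_bigr => i _; rewrite insubT//= => ilt;
  congr (z _ _ * _); exact: val_inj.
Qed.

Definition rweight n (M : int) (x : 'rV[R]_n) : R :=
  (x *m (\col_(i < n) M%:~R ^+ i)) ord0 ord0.

Lemma rweightE n M (x : 'rV[R]_n) : rweight M x = \sum_i x ord0 i * M%:~R ^+ i.
Proof. by rewrite /rweight mxE; apply: eq_bigr => i _; rewrite mxE. Qed.

Lemma rweight_intv n M (z : 'rV[int]_n) : rweight M (intv z) = (weight M z)%:~R.
Proof.
rewrite rweightE /weight rmorph_sum; apply: eq_bigr => i _.
by rewrite intvE rmorphM/= rmorphXn.
Qed.

Lemma rweightD n M (x y : 'rV[R]_n) : rweight M (x + y) = rweight M x + rweight M y.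
Proof. by rewrite /rweight mulmxDl mxE. Qed.

Lemma rweightZ n M c (x : 'rV[R]_n) : rweight M (c *: x) = c * rweight M x.
Proof. by rewrite /rweight -scalemxAl mxE. Qed.

Lemma rweightB n M (x y : 'rV[R]_n) : rweight M (x - y) = rweight M x - rweight M y.
Proof. by rewrite -scaleN1r rweightD rweightZ mulN1r. Qed.

Lemma rweight_continuous n M : continuous (@rweight n M).
Proof.
pose f : {linear 'rV[R]_n -> 'rV[R]_1} := mulmxr (\col_(i < n) M%:~R ^+ i).
move=> x; apply: (@continuous_comp _ _ _ f (fun y : 'rV[R]_1 => y ord0 ord0)).
  exact: linear_continuous_rV.
exact: coord_continuous.
Qed.

(** The margin 1 is made for integrality: for y in this ball and y - z in K with z integral, the
    weight of z is below 1, hence at most 0. *)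
Lemma low_region n M (K : set 'rV[R]_n) : convex_body K -> exists x, exists2 r, 0 < r &
  forall y, `|y - x| < r -> interior K y /\ forall k, K k -> rweight M y < rweight M k + 1.
Proof.
move=> [cK xK [c ic]]; have Kc := interior_subset ic.
have [|k0 /set_mem Kk0 k0min] := @EVT_min_rV R n (rweight M) K _ cK
  (continuous_subspaceT (@rweight_continuous n M)); first by exists c.
pose w := rweight M c - rweight M k0.
have w0 : 0 <= w by rewrite subr_ge0; apply: k0min; exact/mem_set.
(* This makes l * w < 1, where w is the excess of the weight of c over the minimum on K. *)
pose l := 1 / (w + 2); have w2 : 0 < w + 2 by lra.
have l0 : 0 < l by rewrite divr_gt0.
have lw : l * (w + 2) = 1 by rewrite divfK// gt_eqF.
have l01 : 0 < l < 1 by rewrite l0 ltr_pdivrMr//; lra.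
pose x := l *: c + (1 - l) *: k0.
have ix : interior K x by exact: interior_mix.
have xlow : rweight M x < rweight M k0 + 1.
  have -> : rweight M x = rweight M k0 + l * w.
    by rewrite rweightD !rweightZ /w; ring.
  by rewrite ltrD2l; nra.
have : \forall y \near x, interior K y /\ rweight M y < rweight M k0 + 1.
  apply: filterI; first exact: nbhs_interior.
  by apply: cvgr_lt (@rweight_continuous n M x) _ _.
move=> /nbhs_ballP[r /= r0 rP]; exists x, r => // y yx.
have [|iy ylow] := rP y; first by rewrite -ball_normE/= distrC.
split=> // k Kk; apply: lt_le_trans ylow _; rewrite lerD2r.
by apply: k0min; exact/mem_set.
Qed.

(** * Collision vectors of negative weight *)

Section CollisionCount.
Context {n m N : nat} {K : set 'rV[R]_n} {D : seq 'rV[int]_n} {M : int}.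
Hypotheses (bodyK : convex_body K) (coverK : mfold_covering m (lattice_translates K)).
Hypotheses (uniqD : uniq D) (sizeD : size D = (2 * N)%N)
  (memD : forall z, z \in D <-> collision K z)
  (MD : forall z, z \in D -> weight M z != 0).

Let Dneg := [seq z <- D | weight M z < 0].

Lemma mem_Dneg z : (z \in Dneg) = (weight M z < 0) && (z \in D).
Proof. by rewrite mem_filter. Qed.

(** Negation exchanges the vectors of negative and of positive weight. *)
Lemma size_Dneg : size Dneg = N.
Proof.
pose Dpos := [seq z <- D | ~~ (weight M z < 0)].
have s2 : (size Dneg + size Dpos)%N = (2 * N)%N.
  by rewrite !size_filter count_predC.
have oppD z : z \in D -> - z \in D by rewrite !memD; exact: collisionN.
have s1 : (size Dneg <= size Dpos)%N.
  rewrite -(size_map -%R); apply: uniq_leq_size.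
    by rewrite map_inj_uniq ?filter_uniq//; exact: oppr_inj.
  move=> _ /mapP[z + ->]; rewrite !mem_filter => /andP[zneg zD].
  by rewrite oppD// andbT weightN -leNgt oppr_ge0 ltW.
have s3 : (size Dpos <= size Dneg)%N.
  rewrite -(size_map -%R); apply: uniq_leq_size.
    by rewrite map_inj_uniq ?filter_uniq//; exact: oppr_inj.
  move=> _ /mapP[z + ->]; rewrite !mem_filter => /andP[zpos zD].
  by rewrite oppD// andbT weightN oppr_lt0 lt_neqAle eq_sym MD//= leNgt.
lia.
Qed.

Lemma low_translates y : interior K y -> (forall k, K k -> rweight M y < rweight M k + 1) ->
  exists s, [/\ uniq s, (m <= (size s).+1)%N & forall z, z \in s -> z \in Dneg /\ K (y - intv z)].
Proof.
move=> iy ylow; have [s [us sm sP]] := covering_seq y coverK.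
(* If 0 is not among the m vectors, nothing is removed; either way at least m - 1 remain. *)
exists (rem 0 s); split; first exact: rem_uniq.
  by case: (boolP (0 \in s)) => s0; [rewrite size_rem// sm leqSpred|rewrite rem_id// sm].
move=> z; rewrite (mem_rem_uniq _ us) inE => /andP[z0 zs].
have Kz := sP _ zs; split => //.
have zD : z \in D by apply/memD; exact: collision_of_mem Kz z0.
rewrite mem_Dneg zD andbT lt_neqAle MD//=.
have := ylow _ Kz; rewrite rweightB rweight_intv => h.
have : ((weight M z)%:~R : R) < 1%:~R by rewrite mulr1z; lra.
by rewrite ltr_int -[X in _ < X]add0r ltzD1.
Qed.

Theorem multiplicity_le : (m <= N + 1)%N.
Proof.
have [x [r r0 rP]] := low_region M bodyK.
have [ix xlow] := rP x ltac:(by rewrite subrr normr0).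
have [s [us ms sP]] := low_translates ix xlow.
rewrite addn1; apply: leq_trans ms _; rewrite ltnS -size_Dneg.
by apply: uniq_leq_size => // z /sP[].
Qed.

Hypotheses (m2 : (2 <= m)%N) (mN : m = (N + 1)%N).

(** [Dneg] has only m - 1 elements, so at every y near x the covering uses all of them. Hence x - v
    is interior to K for each of them and for v = 0, and the interior points x - w and x - z differ
    by z - w. *)
Lemma low_difference z w : z \in 0 :: Dneg -> w \in 0 :: Dneg -> z != w -> collision K (z - w).
Proof.
move=> zD wD zw; split; first by rewrite subr_eq0.
have [x [r r0 rP]] := low_region M bodyK.
have all y : `|y - x| < r -> forall v, v \in 0 :: Dneg -> K (y - intv v).
  move=> yx v; have [iy ylow] := rP y yx.
  rewrite in_cons => /predU1P[->|vneg]; first by rewrite intv0 subr0; exact: interior_subset.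
  have [s [us ms sP]] := low_translates iy ylow.
  have [||_ sE] := @uniq_min_size _ s Dneg us; first by move=> u /sP[].
    by rewrite size_Dneg; lia.
  by have := sE v; rewrite vneg => /sP[].
have inner u : u \in 0 :: Dneg -> interior K (x - intv u).
  move=> uD; apply/interiorP; exists r => // y yx.
  rewrite -(addrK (intv u) y); apply: all => //.
  by move: yx; congr (`|_| < _); rewrite opprB addrA.
exists (x - intv w); split; first exact: inner.
rewrite intvD intvN (_ : _ - _ = x - intv z); first exact: inner.
by rewrite opprB addrA subrK.
Qed.

Lemma collision_progression : exists u, collision K u /\
  forall z, collision K z -> exists2 j : int, (`|j| < m)%N & z = j *: u.
Proof.
have sN := size_Dneg.
have [u uneg umax] : exists2 u, u \in Dneg & forall z, z \in Dneg -> weight M z <= weight M u.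
  have [u0 u0D] : exists u0, u0 \in Dneg.
    by case: (Dneg) sN => [/=|u0 D' _]; [lia|exists u0; rewrite mem_head].
  elim: (Dneg) u0 u0D => // z s IH u0 _.
  case: s IH => [_|w s /(_ w (mem_head _ _))[u us umax]].
    by exists z => [|y]; [rewrite mem_head|rewrite inE => /eqP ->].
  have [zu|uz] := leP (weight M z) (weight M u).
    exists u => [|y]; first by rewrite in_cons us orbT.
    by rewrite in_cons => /predU1P[->//|]; exact: umax.
  exists z => [|y]; first by rewrite mem_head.
  by rewrite in_cons => /predU1P[->//|/umax /le_trans]; apply; exact: ltW.
have uD : u \in D by move: uneg; rewrite mem_Dneg => /andP[].
have wu : weight M u < 0 by move: uneg; rewrite mem_Dneg => /andP[].
(* By the choice of u the weight of z - u is at most 0, and it does not vanish on collision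
   vectors. *)
have step z : z \in Dneg -> z != u -> z - u \in Dneg.
  move=> zD zu; have zuD : z - u \in D.
    by apply/memD; apply: low_difference => //; rewrite in_cons ?zD ?uneg orbT.
  rewrite mem_Dneg zuD andbT lt_neqAle MD//=.
  by rewrite weightD weightN subr_le0 umax.
have mulu k : weight M (k%:Z *: u) = k%:Z * weight M u.
  by rewrite /weight mulr_sumr; apply: eq_bigr => i _; rewrite mxE mulrA.
(* Induction on [|weight M z|], which drops when u is subtracted. All smaller multiples of u are
   recorded too: counting them bounds j by m - 1. *)
have chain k z : (`|weight M z| <= k)%N -> z \in Dneg ->
    exists j : nat, [/\ (0 < j)%N, z = j%:Z *: u & forall i, (0 < i <= j)%N -> i%:Z *: u \in Dneg].
  elim: k z => [|k IH] z zk zD.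
    by move: zk zD; rewrite leqn0 absz_eq0 mem_Dneg => /eqP -> /andP[]; rewrite ltxx.
  have [->|zu] := eqVneq z u.
    by exists 1%N; split => [//||i i1]; [rewrite scale1r|rewrite (_ : i = 1%N) ?scale1r//; lia].
  have zuD := step z zD zu.
  have [|j [j0 zE jP]] := IH (z - u) _ zuD.
    move: zk zD zuD; rewrite !mem_Dneg weightD weightN => zk /andP[zn _] /andP[zun _].
    lia.
  exists j.+1; have zE' : z = j.+1%:Z *: u.
    by rewrite -[LHS](subrK u) zE -(addn1 j) PoszD scalerDl scale1r.
  split=> // i /andP[i0]; rewrite leq_eqVlt => /predU1P[->|]; first by rewrite -zE'.
  by rewrite ltnS => ij; apply: jP; rewrite i0.
exists u; split; first by apply/memD.
have neg_case z : z \in Dneg -> exists2 j : int, (`|j| < m)%N & z = j *: u.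
  move=> zD; have [j [j0 zE jP]] := chain _ z (leqnn _) zD.
  exists j%:Z => //; rewrite mN addn1 ltnS /= -sN -(size_iota 1 j) -(size_map (fun i : nat => i%:Z *: u)).
  apply: uniq_leq_size.
    rewrite map_inj_uniq ?iota_uniq// => i i' /(congr1 (weight M)); rewrite !mulu.
    by move/(mulIf (ltr0_neq0 wu)) => -[].
  by move=> _ /mapP[i + ->]; rewrite mem_iota add1n ltnS => ij; exact: jP.
move=> z /memD zD; have [zneg|zpos] := boolP (weight M z < 0).
  by apply: neg_case; rewrite mem_Dneg zneg.
have [|j jm jE] := neg_case (- z).
  rewrite mem_Dneg weightN oppr_lt0 lt_neqAle eq_sym MD//= leNgt zpos/=.
  by apply/memD; apply: collisionN; exact/memD.
by exists (- j); rewrite ?abszN// scaleNr -jE opprK.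
Qed.

End CollisionCount.

End Collisions.

(** * Covering bodies with collinear collision vectors *)

Section Cylinder.
Context {R : realType}.

(** As f is affine along segments from y0, its difference quotient there in direction w does not
    depend on the step; the common value H w is additive by the midpoint rule and homogeneous. *)
Lemma affine_extension n (U : set 'rV[R]_n) (f : 'rV[R]_n -> R) : interior U !=set0 ->
  (forall x y l, U x -> U y -> 0 < l < 1 ->
    f (l *: x + (1 - l) *: y) = l * f x + (1 - l) * f y) ->
  exists (a : {linear 'rV[R]_n -> R^o}) (c : R), forall y, U y -> f y = a y + c.
Proof.
move=> [y0 /interiorP[r r0 rU]] aff.
have U0 : U y0 by apply: rU; rewrite subrr normr0.
(* A step short enough to stay in the ball of radius r in direction w; the + 1 covers w = 0. *)
pose e (w : 'rV[R]_n) : R := r / (2 * (`|w| + 1)).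
have e0 w : 0 < e w by rewrite divr_gt0// mulr_gt0// ltr_wpDl.
have eU w : U (y0 + e w *: w).
  apply: rU; rewrite addrAC subrr add0r normrZ gtr0_norm//.
  have : e w * (2 * (`|w| + 1)) = r by rewrite divfK// gt_eqF// mulr_gt0// ltr_wpDl.
  by have := normr_ge0 w; have := e0 w; nra.
pose H (w : 'rV[R]_n) : R := (f (y0 + e w *: w) - f y0) / e w.
have star (d1 d2 : R) (w : 'rV[R]_n) : 0 < d1 -> d1 < d2 -> U (y0 + d2 *: w) ->
    (f (y0 + d1 *: w) - f y0) / d1 = (f (y0 + d2 *: w) - f y0) / d2.
  move=> d10 d12 Ud2; have d20 : 0 < d2 by exact: lt_trans d12.
  have -> : y0 + d1 *: w = (d1 / d2) *: (y0 + d2 *: w) + (1 - d1 / d2) *: y0.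
    by apply/rowP => i; rewrite !rvE; field; rewrite gt_eqF.
  rewrite aff//; first by field; rewrite !gt_eqF.
  by rewrite divr_gt0//= ltr_pdivrMr// mul1r.
have HP (d : R) (w : 'rV[R]_n) : 0 < d -> U (y0 + d *: w) -> f (y0 + d *: w) - f y0 = d * H w.
  move=> d0 Ud; suff -> : H w = (f (y0 + d *: w) - f y0) / d by rewrite mulrC divfK// gt_eqF.
  rewrite /H; case: (ltgtP (e w) d) => [ed|de|->//]; first exact: star.
  by apply/esym; apply: star.
clearbody H.
have small (w1 w2 : 'rV[R]_n) : exists2 d : R, 0 < d & forall w, `|w| <= `|w1| + `|w2| -> U (y0 + d *: w).
  exists (r / (`|w1| + `|w2| + 1)) => [|w ww]; first by rewrite divr_gt0// ltr_wpDl// addr_ge0.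
  apply: rU; rewrite addrAC subrr add0r normrZ gtr0_norm ?divr_gt0 ?ltr_wpDl ?addr_ge0//.
  rewrite mulrAC ltr_pdivrMr ?ltr_wpDl ?addr_ge0// ltr_pM2l//.
  by apply: le_lt_trans ww _; rewrite ltrDl.
have HD (w1 w2 : 'rV[R]_n) : H (w1 + w2) = H w1 + H w2.
  (* The directions are doubled so that the midpoint of the two points is y0 + d (w1 + w2). *)
  have [d d0 dU] := small (2 *: w1) (2 *: w2).
  have n2 (w : 'rV[R]_n) : `|2 *: w| = 2 * `|w| by rewrite normrZ ger0_norm.
  have Ud1 : U (y0 + d *: (2 *: w1)) by apply: dU; rewrite lerDl.
  have Ud2 : U (y0 + d *: (2 *: w2)) by apply: dU; rewrite lerDr.
  have Ud3 : U (y0 + d *: (w1 + w2)).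
    by apply: dU; apply: le_trans (ler_normD _ _) _; rewrite !n2; have := normr_ge0 w1; have := normr_ge0 w2; lra.
  have h1 : f (y0 + d *: (2 *: w1)) - f y0 = (d * 2) * H w1.
    by move: Ud1; rewrite scalerA => Ud1; apply: HP => //; rewrite mulr_gt0.
  have h2 : f (y0 + d *: (2 *: w2)) - f y0 = (d * 2) * H w2.
    by move: Ud2; rewrite scalerA => Ud2; apply: HP => //; rewrite mulr_gt0.
  have h3 := HP _ _ d0 Ud3.
  have := aff _ _ (1 / 2) Ud1 Ud2 half01.
  have -> : (1 / 2) *: (y0 + d *: (2 *: w1)) + (1 - 1 / 2) *: (y0 + d *: (2 *: w2)) = y0 + d *: (w1 + w2).
    by apply/rowP => i; rewrite !rvE; field.
  by move=> h; apply: (mulfI (lt0r_neq0 d0)); lra.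
have HZp (c : R) (w : 'rV[R]_n) : 0 < c -> H (c *: w) = c * H w.
  move=> c0; have [d d0 dU] := small (c *: w) 0.
  have Ud : U (y0 + d *: (c *: w)) by apply: dU; rewrite lerDl.
  have h1 := HP _ _ d0 Ud; rewrite scalerA in Ud h1.
  have h2 := HP _ _ (mulr_gt0 d0 c0) Ud.
  by apply: (mulfI (lt0r_neq0 d0)); rewrite -[LHS]h1 h2 [RHS]mulrA.
have H0 : H 0 = 0 by have := HD 0 0; rewrite addr0 => /esym/eqP; rewrite -subr_eq0 addrK => /eqP.
have HN w : H (- w) = - H w by apply/eqP; rewrite -addr_eq0 -HD addNr H0.
have HZ (c : R) (w : 'rV[R]_n) : H (c *: w) = c * H w.
  case: (ltgtP c 0) => [c0|c0|->]; last by rewrite scale0r H0 mul0r.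
    by have := HZp (- c) w; rewrite oppr_gt0 scaleNr HN mulNr => /(_ c0)/oppr_inj.
  exact: HZp.
have Hlin : linear (H : 'rV[R]_n -> R^o) by move=> c x y; rewrite HD HZ.
pose a : {linear 'rV[R]_n -> R^o} := HB.pack (H : 'rV[R]_n -> R^o) (GRing.isLinear.Build R _ _ _ (H : 'rV[R]_n -> R^o) Hlin).
exists a, (f y0 - a y0) => y Uy.
have := HP 1 (y - y0) ltr01; rewrite scale1r addrC subrK => /(_ Uy); rewrite mul1r HD HN => h.
by rewrite /a /=; lra.
Qed.

(** Splits off the last coordinate, as in [between], whereas [cns] splits off the first, as in
    [vol]. *)
Definition snoc n (y : 'rV[R]_n) (t : R) : 'rV[R]_n.+1 :=
  \row_i (if unlift ord_max i is Some j then y ord0 j else t).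

Lemma snoc_max n (y : 'rV[R]_n) t : snoc y t ord0 ord_max = t.
Proof. by rewrite mxE unlift_none. Qed.

Lemma snoc_lift n (y : 'rV[R]_n) t i : snoc y t ord0 (lift ord_max i) = y ord0 i.
Proof. by rewrite mxE liftK. Qed.

Lemma snocP n (x : 'rV[R]_n.+1) y t : col' ord_max x = y -> x ord0 ord_max = t -> x = snoc y t.
Proof.
move=> <- <-; apply/rowP => i; case: (unliftP ord_max i) => [j ->|->].
  by rewrite snoc_lift mxE.
by rewrite snoc_max.
Qed.

Lemma col'_snoc n (y : 'rV[R]_n) t : col' ord_max (snoc y t) = y.
Proof. by apply/rowP => i; rewrite [LHS]mxE snoc_lift. Qed.

Lemma snocE n (x : 'rV[R]_n.+1) : x = snoc (col' ord_max x) (x ord0 ord_max).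
Proof. exact: snocP. Qed.

Lemma snoc_mix n l k (x y : 'rV[R]_n) s t :
  l *: snoc x s + k *: snoc y t = snoc (l *: x + k *: y) (l * s + k * t).
Proof.
apply: snocP; last by rewrite !rvE !snoc_max.
by apply/rowP => i; rewrite [LHS]mxE !rvE !snoc_lift.
Qed.

Lemma snocB n (x y : 'rV[R]_n) s t : snoc x s - snoc y t = snoc (x - y) (s - t).
Proof. by have := snoc_mix 1 (-1) x y s t; rewrite !scale1r !scaleN1r mul1r mulN1r. Qed.

Lemma snoc_norm n (y : 'rV[R]_n) t e : 0 < e -> `|y| < e -> `|t| < e -> `|snoc y t| < e.
Proof.
move=> e0 ye te; apply: le_lt_trans (_ : Num.max `|y| `|t| < e); last by rewrite gt_max ye.
apply: normr_rV_le => [|i]; first by rewrite le_max normr_ge0.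
case: (unliftP ord_max i) => [j ->|->]; last by rewrite snoc_max le_max lexx orbT.
by rewrite snoc_lift le_max normr_coord.
Qed.

Definition isnoc n (z : 'rV[int]_n) (j : int) : 'rV[int]_n.+1 :=
  \row_i (if unlift ord_max i is Some k then z ord0 k else j).

Lemma intv_isnoc n (z : 'rV[int]_n) j : intv (isnoc z j) = snoc (intv z) j%:~R.
Proof. by apply/rowP => i; rewrite !mxE; case: unlift => [k|//]; rewrite mxE. Qed.

Lemma isnoc_surj n (z : 'rV[int]_n.+1) : z = isnoc (col' ord_max z) (z ord0 ord_max).
Proof.
by apply/rowP => i; rewrite mxE; case: unliftP => [k ->|->//]; rewrite mxE.
Qed.

Lemma conv_le0 (A B : R) : (forall l, 0 < l < 1 -> l * A + (1 - l) * B <= 0) -> B <= 0.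
Proof.
move=> H; rewrite leNgt; apply/negP => B0.
pose l := Num.min (1 / 2) (B / (2 * (`|A| + B + 1))).
have k0 : 0 < 2 * (`|A| + B + 1) by rewrite mulr_gt0// ltr_wpDl// addr_ge0// ltW.
have l0 : 0 < l by rewrite lt_min divr_gt0//= divr_gt0.
have l1 : l < 1 by rewrite gt_min; apply/orP; left; lra.
have lB : l * (2 * (`|A| + B + 1)) <= B by rewrite -ler_pdivlMr// ge_min lexx orbT.
have := H l ltac:(by rewrite l0); have := ler_norm (- A); rewrite normrN => AA.
by have : l * (- A) <= l * `|A| by [rewrite ler_pM2l]; nra.
Qed.

(** * Chords in the direction of the last basis vector *)

Section CylinderStructure.
Context {n m : nat} {K : set 'rV[R]_n.+1}.
Hypotheses (bodyK : convex_body K) (m2 : (2 <= m)%N).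
Hypothesis coverK : forall x, exists s : seq 'rV[int]_n.+1,
  [/\ uniq s, size s = m & forall z, z \in s -> K (x - intv z)].
Hypothesis collK : forall z, collision K z ->
  exists2 j : int, (`|j| < m)%N & z = isnoc 0 j.

Let P := [set y | exists t, K (snoc y t)].
(** The projection of the interior: a chord over a point of U meets the interior of K, so its
    relative interior lies there too. Chords over the rest of P are reached by closure. *)
Let U := [set y | exists t, interior K (snoc y t)].

Lemma m_ge0 : 0 < m%:R :> R. Proof. by rewrite ltr0n; lia. Qed.

Lemma chord_interior y t0 t1 t : interior K (snoc y t0) -> K (snoc y t1) ->
  t0 < t < t1 \/ t1 < t < t0 -> interior K (snoc y t).
Proof.
have [_ xK _] := bodyK; move=> i0 K1 [|] /between_convex[l l01 ->].
  rewrite (_ : snoc _ _ = l *: snoc y t0 + (1 - l) *: snoc y t1); first exact: interior_mix.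
  by rewrite snoc_mix -scalerDl subrKC scale1r.
rewrite (_ : snoc _ _ = (1 - l) *: snoc y t0 + (1 - (1 - l)) *: snoc y t1).
  by apply: interior_mix => //; lra.
by rewrite snoc_mix -scalerDl subrKC scale1r; congr snoc; ring.
Qed.

(** A longer chord contains two interior points at distance m, making m times the last basis vector
    a collision vector, against [collK]. *)
Lemma chord_upper y t1 t2 : U y -> K (snoc y t1) -> K (snoc y t2) -> t2 - t1 <= m%:R.
Proof.
move=> [t0 i0] K1 K2; rewrite leNgt; apply/negP => t12; have m0 := m_ge0.
have inner t : t1 < t < t2 -> interior K (snoc y t).
  move=> /andP[tt1 tt2]; case: (ltgtP t t0) => [tt0|t0t|->//].
    by apply: chord_interior i0 K1 _; right; rewrite tt1.
  by apply: chord_interior i0 K2 _; left; rewrite t0t.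
pose t := (t1 + t2 - m%:R) / 2.
have i1 : interior K (snoc y t) by apply: inner; rewrite /t; lra.
have i2 : interior K (snoc y (t + m%:R)) by apply: inner; rewrite /t; lra.
have [|j jm /(congr1 (fun z : 'rV[int]_n.+1 => z ord0 ord_max))] := collK (z := isnoc 0 m%:Z).
- split; first by apply/eqP => /(congr1 (fun z : 'rV[int]_n.+1 => z ord0 ord_max));
    rewrite !mxE unlift_none => e; move: m2; rewrite -lez_nat e.
  exists (snoc y (t + m%:R)); split; first exact: i2.
  by rewrite intv_isnoc intv0 snocB subr0 addrK.
by rewrite !mxE unlift_none; lia.
Qed.

Lemma U_sub y : U y -> P y.
Proof. by move=> [t it]; exists t; exact: interior_subset. Qed.

Lemma chord_extremes y : P y -> exists b t, [/\ K (snoc y b), K (snoc y t) &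
  forall s, K (snoc y s) -> b <= s <= t].
Proof.
have [cK _ _] := bodyK; move=> [t0 K0].
pose A := K `&` [set x | col' ord_max x = y].
have cA : compact A.
  apply: compact_closedI => //.
  apply: (@preimage_closed _ _ (col' ord_max : 'rV[R]_n.+1 -> 'rV[R]_n) [set y]).
    by move=> x _; exact: (@linear_continuous_rV R _ _ (col' ord_max)).
  by apply: rV_closed; exact: compact_set1.
have A0 : A !=set0 by exists (snoc y t0); split => //=; rewrite col'_snoc.
have ct : {within A, continuous (fun x : 'rV[R]_n.+1 => x ord0 ord_max)}.
  by apply: continuous_subspaceT; exact: coord_continuous.
have [u /set_mem[Ku uy] umin] := EVT_min_rV A0 cA ct.
have [v /set_mem[Kv vy] vmax] := EVT_max_rV A0 cA ct.
exists (u ord0 ord_max), (v ord0 ord_max); split.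
- by rewrite -(snocP uy erefl).
- by rewrite -(snocP vy erefl).
- move=> s Ks; have sA : snoc y s \in A by apply/mem_set; split => //=; rewrite col'_snoc.
  by have := umin _ sA; have := vmax _ sA; rewrite snoc_max => -> ->.
Qed.

(* Just above the lower end of the chord the m translates of the covering differ
   by multiples of the last basis vector, so m - 1 steps up stay inside K. *)
Lemma chord_lower y b t : U y -> K (snoc y b) -> K (snoc y t) ->
  (forall s, K (snoc y s) -> b <= s <= t) -> b + m%:R <= t.
Proof.
move=> [t0 i0] Kb Kt bt; have [_ xK _] := bodyK.
have bt0 : b < t.
  have /interiorP[r r0 rK] := i0.
  have K1 : K (snoc y (t0 + r / 2)).
    apply: rK; rewrite snocB subrr addrAC subrr add0r.
    by apply: snoc_norm; rewrite ?normr0// ger0_norm; lra.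
  have := bt _ (interior_subset i0); have := bt _ K1.
  by move=> /andP[? ?] /andP[? ?]; lra.
have inner s : b < s < t -> interior K (snoc y s).
  move=> /andP[bs st]; case: (ltgtP s t0) => [ss|ss|->//].
    by apply: chord_interior i0 Kb _; right; rewrite bs.
  by apply: chord_interior i0 Kt _; left; rewrite ss.
(* As the chord starts at b, the translates that cover height b + e < b + 1 correspond to upward
   shifts by integers j >= 0, and m distinct values of j include one that is at least m - 1. *)
have key e : 0 < e -> e < 1 -> b + e < t -> b + e + m.-1%:R <= t.
  move=> e0 e1 et; have ie : interior K (snoc y (b + e)) by apply: inner; rewrite ltrDl e0.
  have [s [us sm sP]] := coverK (snoc y (b + e)).
  have zs z : z \in s -> exists2 j : nat, z = isnoc 0 (- j%:Z) & K (snoc y (b + e + j%:R)).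
    move=> zin; have Kz := sP z zin.
    have [j zj] : exists j : int, z = isnoc 0 j.
      have [->|z0] := eqVneq z 0.
        by exists 0; apply/rowP => i; rewrite !mxE; case: unlift => // k; rewrite mxE.
      by have [j _ zj] := collK (collision_of_mem bodyK ie Kz z0); exists j.
    move: Kz; rewrite zj intv_isnoc intv0 snocB subr0 => Kz.
    have : j%:~R < 1%:~R :> R by have := bt _ Kz; rewrite mulr1z => /andP[? ?]; lra.
    rewrite ltr_int => j1; exists `|j|%N; first by congr isnoc; lia.
    suff -> : (`|j|%N)%:R = - j%:~R :> R by [].
    by rewrite -mulrNz pmulrn; congr (_%:~R); lia.
  have [j jm Kj] : exists2 j : nat, (m.-1 <= j)%N & K (snoc y (b + e + j%:R)).
    apply: contrapT => H.
    have sub : {subset s <= [seq isnoc 0 (- i%:Z) | i <- iota 0 m.-1]}.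
      move=> z /zs[j -> Kj]; apply: map_f; rewrite mem_iota add0n /=.
      by rewrite ltnNge; apply/negP => mj; apply: H; exists j.
    by have := uniq_leq_size us sub; rewrite size_map size_iota sm; lia.
  have /andP[_] := bt _ Kj; apply: le_trans.
  by rewrite lerD2l ler_nat.
have mE : m%:R = m.-1%:R + 1 :> R by rewrite natr1 prednK//; lia.
have m1 : 1 <= m.-1%:R :> R by rewrite ler1n; lia.
(* As m - 1 >= 1, a small e already gives this; afterwards every e in ]0, 1[ is admissible in
   [key]. *)
have bt1 : b + 1 < t.
  have := key (Num.min (1 / 2) ((t - b) / 2)).
  rewrite lt_min gt_min divr_gt0//= => k.
  have : 0 < Num.min (1 / 2) ((t - b) / 2) by rewrite lt_min divr_gt0//=; lra.
  have : Num.min (1 / 2) ((t - b) / 2) <= (t - b) / 2 by rewrite ge_min lexx orbT.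
  by have := k ltac:(lra) ltac:(apply/orP; left; lra); move=> k' ? ?; have := k' ltac:(lra); lra.
rewrite leNgt; apply/negP => lt.
(* Strictly between t - b - (m - 1) and 1, so that [key] overshoots t. *)
pose e := (1 + (t - b - m.-1%:R)) / 2.
have e1 : t - b - m.-1%:R < 1 by lra.
have half1 := key (1 / 2) ltac:(lra) ltac:(lra) ltac:(lra).
have := key e ltac:(rewrite /e; lra) ltac:(rewrite /e; lra) ltac:(rewrite /e; lra).
rewrite /e; lra.
Qed.

Lemma chordP y : U y -> exists b, forall t, K (snoc y t) <-> b <= t <= b + m%:R.
Proof.
move=> Uy; have [b [t [Kb Kt bt]]] := chord_extremes (U_sub Uy).
have lo := chord_lower Uy Kb Kt bt; have hi := chord_upper Uy Kb Kt.
have tE : t = b + m%:R by lra.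
exists b => s; rewrite -tE; split; first exact: bt.
have [_ /convexP xK _] := bodyK.
move=> /andP[]; rewrite le_eqVlt => /predU1P[<-//|bs].
rewrite le_eqVlt => /predU1P[->//|st].
have [|l l01 ->] := @between_convex _ b s t; first by rewrite bs.
rewrite (_ : snoc _ _ = l *: snoc y b + (1 - l) *: snoc y t); first exact: xK.
by rewrite snoc_mix -scalerDl subrKC scale1r.
Qed.

Lemma U_mix y z l : U y -> P z -> 0 < l < 1 -> U (l *: y + (1 - l) *: z).
Proof.
have [_ xK _] := bodyK; move=> [t it] [s Ks] l01; exists (l * t + (1 - l) * s).
by rewrite -snoc_mix; exact: interior_mix.
Qed.

Lemma U_interior y : U y -> interior U y.
Proof.
move=> [t /interiorP[r r0 rK]]; apply/interiorP; exists r => // z zy.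
exists t; apply/interiorP; exists (r - `|z - y|); first by rewrite subr_gt0.
move=> x; rewrite ltrBrDr => xz; apply: rK.
rewrite -(subrK (snoc z t) x) -addrA; apply: le_lt_trans (ler_normD _ _) _.
apply: le_lt_trans xz; rewrite lerD2l snocB subrr.
apply: normr_rV_le => // i; case: (unliftP ord_max i) => [j ->|->].
  by rewrite snoc_lift normr_coord.
by rewrite snoc_max normr0.
Qed.

Lemma U_nonempty : U !=set0.
Proof.
have [_ _ [x ix]] := bodyK; exists (col' ord_max x), (x ord0 ord_max).
by rewrite -snocE.
Qed.

Theorem cylinder : exists (a : {linear 'rV[R]_n -> R^o}) (c : R),
  [/\ convex_body P, packs 1 P, covers 1 P &
   forall y t, K (snoc y t) <-> P y /\ a y + c <= t <= a y + c + m%:R].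
Proof.
have [cK /convexP xK neK] := bodyK; have m0 := m_ge0.
have [b bP] : exists b : 'rV[R]_n -> R, forall y, U y ->
    forall t, K (snoc y t) <-> b y <= t <= b y + m%:R.
  have h y : exists b, U y -> forall t, K (snoc y t) <-> b <= t <= b + m%:R.
    by case: (pselect (U y)) => [/chordP[b ?]|nU]; [exists b|exists 0].
  by have [b ?] := choice h; exists b.
have [u0 Uu0] := U_nonempty.
have [||a [c ac]] := @affine_extension n U b.
- by exists u0; exact: U_interior.
- move=> y z l Uy Uz l01; have Ul := U_mix Uy (U_sub Uz) l01; have [l0 l1] := andP l01.
  have Ky : K (snoc y (b y)) by apply/(bP y Uy); lra.
  have Kz : K (snoc z (b z)) by apply/(bP z Uz); lra.
  have Ky' : K (snoc y (b y + m%:R)) by apply/(bP y Uy); lra.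
  have Kz' : K (snoc z (b z + m%:R)) by apply/(bP z Uz); lra.
  have := xK _ _ _ Ky Kz l01; have := xK _ _ _ Ky' Kz' l01.
  rewrite !snoc_mix => /(bP _ Ul)/andP[? ?] /(bP _ Ul)/andP[? ?].
  by apply/eqP; rewrite eq_le; apply/andP; split; lra.
have bodyP : convex_body P.
  split.
  - have -> : P = col' ord_max @` K.
      apply/seteqP; split => [y [t Kt]|_ [x Kx <-]]; first by exists (snoc y t); rewrite ?col'_snoc.
      by exists (x ord0 ord_max); rewrite -snocE.
    apply: continuous_compact cK; apply: continuous_subspaceT.
    exact: (@linear_continuous_rV R _ _ (col' ord_max)).
  - apply/convexP => y z l [s Ks] [t Kt] l01; exists (l * s + (1 - l) * t).
    by rewrite -snoc_mix; exact: xK.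
  - exists u0; apply: interiorS (U_interior Uu0); exact: U_sub.
(* Over U this is [bP]; other points y of P are approached along the segment from u0. *)
have KP y t : K (snoc y t) <-> P y /\ a y + c <= t <= a y + c + m%:R.
  have Klow : K (snoc u0 (b u0)) by apply/(bP _ Uu0); lra.
  have aE (l : R) : a (l *: u0 + (1 - l) *: y) = l * a u0 + (1 - l) * a y.
    by rewrite linearD !linearZ.
  split=> [Kt|[Py /andP[t1 t2]]].
    split; first by exists t.
    have [t0 it0] := Uu0; have Py : P y by exists t.
    have mixK l : 0 < l < 1 -> a (l *: u0 + (1 - l) *: y) + c <= l * t0 + (1 - l) * t <=
        a (l *: u0 + (1 - l) *: y) + c + m%:R.
      move=> l01; have Ul := U_mix Uu0 Py l01; rewrite -ac//.
      by apply/(bP _ Ul); rewrite -snoc_mix; apply: xK => //; exact: interior_subset.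
    apply/andP; split; rewrite -subr_le0.
      apply: (@conv_le0 (a u0 + c - t0)) => l /mixK; rewrite aE => /andP[? _]; lra.
    by apply: (@conv_le0 (t0 - (a u0 + c + m%:R))) => l /mixK; rewrite aE => /andP[_ ?]; lra.
  have kclosed := rV_closed cK.
  (* The point over u0 has the same height above the lower graph as t over y, so the segment stays
     between the two graphs. *)
  apply: (@closed_mix _ _ _ _ (snoc u0 (a u0 + c + (t - (a y + c)))) kclosed) => l l01.
  have Ul := U_mix Uu0 Py l01; rewrite snoc_mix; apply/(bP _ Ul).
  rewrite ac// aE; move: (a u0 : R) (a y : R) t1 t2 => p q t1 t2.
  have -> : l * (p + c + (t - (q + c))) + (1 - l) * t = l * p + (1 - l) * q + c + (t - (q + c)) by ring.
  by apply/andP; split; lra.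
exists a, c; split => //.
- move=> y z iy iyz.
  have Py := interior_subset iy; have Pyz := interior_subset iyz.
  have intK w t : interior P w -> a w + c < t < a w + c + m%:R -> interior K (snoc w t).
    move=> iw /andP[wt1 wt2].
    have : \forall x \near snoc w t, [/\ P (col' ord_max x),
        a (col' ord_max x) + c < x ord0 ord_max &
        x ord0 ord_max < a (col' ord_max x) + c + m%:R].
      have ccol : continuous (col' ord_max : 'rV[R]_n.+1 -> 'rV[R]_n).
        exact: (@linear_continuous_rV R _ _ (col' ord_max)).
      pose g (x : 'rV[R]_n.+1) : R := x ord0 ord_max - a (col' ord_max x).
      have cg : continuous g.
        have ca : continuous (fun x : 'rV[R]_n.+1 => a (col' ord_max x) : R).
          move=> x; apply: (@continuous_comp _ _ _ (col' ord_max) a); first exact: ccol.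
          exact: (@linear_continuous_rV R n R^o a).
        have cm : continuous (fun x : 'rV[R]_n.+1 => x ord0 ord_max) by exact: coord_continuous.
        by move=> x; exact: (continuousB (cm x) (ca x)).
      have n1 : \forall x \near snoc w t, P (col' ord_max x).
        by apply: ccol; rewrite col'_snoc.
      have n2 : \forall x \near snoc w t, c < g x.
        by apply: cvgr_gt (cg (snoc w t)) _ _; rewrite /g snoc_max col'_snoc; lra.
      have n3 : \forall x \near snoc w t, g x < c + m%:R.
        by apply: cvgr_lt (cg (snoc w t)) _ _; rewrite /g snoc_max col'_snoc; lra.
      by apply: filterS3 n1 n2 n3 => x Px; rewrite /g => x1 x2; split=> //; lra.
    apply: filterS => x [Px x1 x2]; rewrite (snocE x); apply/KP; split=> //.
    by rewrite !ltW.
  pose t := a y + c + m%:R / 2.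
  pose w := y - 1%:R *: intv z.
  pose j := Num.floor (t - (a w + c)).
  have fl : j%:~R <= t - (a w + c) by apply: floor_le_tmp.
  have fl' : t - (a w + c) < j%:~R + 1 by rewrite -intrD1 floorD1_gt.
  have m2R : 2 <= m%:R :> R by rewrite ler_nat.
  have [k kP] : exists k : int, a w + c < t - k%:~R < a w + c + m%:R.
    (* The height above the lower graph is then in [1, 2[, strictly between 0 and m because m >=
       2. *)
    exists (j - 1); rewrite intrB mulr1z; apply/andP; split; lra.
  have i1 : interior K (snoc y t) by apply: intK => //; rewrite /t; apply/andP; split; lra.
  have i2 : interior K (snoc w (t - k%:~R)) by apply: intK.
  apply/eqP; apply: contrapT => /negP z0.
  have [|i _ /(congr1 (col' ord_max))] := collK (z := isnoc z k).
    split.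
      apply: contra z0 => /eqP/(congr1 (col' ord_max)) e; apply/eqP/rowP => i.
      by move/rowP: e => /(_ i); rewrite !mxE liftK.
    exists (snoc y t); split; first exact: i1.
    by rewrite intv_isnoc snocB -[intv z]scale1r; exact: i2.
  move=> e; move/negP: z0; apply; apply/eqP/rowP => l.
  by move/rowP: e => /(_ l); rewrite !mxE !liftK !mxE.
- move=> y; have [s [us sm sP]] := coverK (snoc y 0).
  have [z zs] : exists z, z \in s by case: s sm {us sP} => [|z s] sm; [by move: m2; rewrite -sm|exists z; rewrite mem_head].
  exists (col' ord_max z); exists (0 - (z ord0 ord_max)%:~R).
  have := sP z zs; rewrite {1}(isnoc_surj z) intv_isnoc snocB.
  by rewrite scale1r.
Qed.

End CylinderStructure.

End Cylinder.

(** * Unimodular coordinates and the equality case *)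

Section Unimodular.
Context {R : realType}.

(** The Smith form of a single row writes u as k times the first row of an invertible integer matrix
    Q, and primitivity makes k a sign. A transposition moves that row to the last place. *)
Lemma primitive_completion n (u : 'rV[int]_n.+1) :
  (forall (k : int) w, u = k *: w -> `|k|%N = 1%N) ->
  exists A B : 'M[int]_n.+1, [/\ A *m B = 1%:M, B *m A = 1%:M & isnoc 0 1 *m A = u].
Proof.
move=> up; have [L Lu [Q Qu [d _ uE]]] := int_Smith_normal_form u.
pose k := L ord0 ord0 * d`_0.
have uk : u = k *: row ord0 Q.
  rewrite uE; apply/rowP => j; rewrite !mxE (bigD1 ord0)//= big1 ?addr0 => [|i i0].
    by rewrite !mxE big_ord1 !mxE/= mulr1n.
  by rewrite mxE big_ord1 !mxE /= eq_sym (negbTE (i0 : (i : nat) != 0%N)) mulr0n mulr0 mul0r.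
have k2 : k * k = 1.
  by have := up _ _ uk; move: k {uk} => k k1; nia.
pose s : {perm 'I_n.+1} := tperm ord0 ord_max.
have ss : perm_mx s *m perm_mx s = 1%:M :> 'M[int]_n.+1.
  by rewrite -perm_mxM tperm2 perm_mx1.
(* As k * k = 1, the sign is absorbed in both matrices. *)
exists (k *: (perm_mx s *m Q)), (k *: (invmx Q *m perm_mx s)); split.
- rewrite -scalemxAl -scalemxAr scalerA k2 scale1r.
  by rewrite -mulmxA (mulmxA Q) mulmxV// mul1mx.
- rewrite -scalemxAl -scalemxAr scalerA k2 scale1r.
  by rewrite -mulmxA (mulmxA (perm_mx s)) ss mul1mx mulVmx.
- have -> : isnoc (0 : 'rV[int]_n) 1 = delta_mx ord0 ord_max.
    apply/rowP => i; rewrite !mxE; case: unliftP => [j ->|->]; last by rewrite eqxx.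
    by rewrite mxE [lift _ _ == _]eq_sym (negbTE (neq_lift _ _)) andbF.
  rewrite -scalemxAr -rowE -row_permE uk; congr (_ *: _).
  by apply/rowP => i; rewrite !mxE tpermR.
Qed.

Lemma interior_preimage n (f g : 'rV[R]_n -> 'rV[R]_n) (K : set 'rV[R]_n) x :
  continuous f -> continuous g -> cancel f g -> cancel g f ->
  interior (f @^-1` K) x <-> interior K (f x).
Proof.
have imp (f' : 'rV[R]_n -> 'rV[R]_n) (A : set 'rV[R]_n) y : continuous f' -> interior A (f' y) ->
    interior (f' @^-1` A) y by move=> cf iA; exact: (cf y _ iA).
move=> cf cg fK gK; split; last exact: imp.
move=> ix; have -> : K = g @^-1` (f @^-1` K).
  by apply/seteqP; split => y; rewrite /preimage/= gK.
by apply: imp => //; rewrite fK.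
Qed.

Definition intm n (A : 'M[int]_n) : 'M[R]_n := map_mx intr A.

Definition act n (A : 'M[int]_n) : {linear 'rV[R]_n -> 'rV[R]_n} := mulmxr (intm A).

Lemma actE n (A : 'M[int]_n) x : act A x = x *m intm A. Proof. by []. Qed.

Lemma act_intv n (A : 'M[int]_n) z : act A (intv z) = intv (z *m A).
Proof. by rewrite actE /intv map_mxM. Qed.

Lemma act_continuous n (A : 'M[int]_n) : continuous (act A).
Proof. exact: linear_continuous_rV. Qed.

Lemma actK n (A B : 'M[int]_n) : A *m B = 1%:M -> cancel (act A) (act B).
Proof. by move=> AB x; rewrite !actE -mulmxA -map_mxM AB map_mx1 mulmx1. Qed.

Section Transport.
Context {n : nat} {A B : 'M[int]_n} {K : set 'rV[R]_n}.
Hypotheses (AB : A *m B = 1%:M) (BA : B *m A = 1%:M).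

Let K' := act A @^-1` K.

Lemma act_interior x : interior K' x <-> interior K (act A x).
Proof.
by apply: (@interior_preimage _ _ (act B)); [exact: act_continuous|exact: act_continuous|exact: actK|exact: actK].
Qed.

Lemma act_preimage : K' = act B @` K.
Proof.
apply/seteqP; split => [x Kx|_ [x Kx <-]]; first by exists (act A x) => //; rewrite actK.
by suff : K (act A (act B x)) by []; rewrite (actK BA).
Qed.

Lemma act_body : convex_body K -> convex_body K'.
Proof.
move=> [cK /convexP xK [x ix]]; split.
- rewrite act_preimage; apply: continuous_compact cK.
  by apply: continuous_subspaceT; exact: act_continuous.
- apply/convexP => y z l Ky Kz l01; suff : K (act A (l *: y + (1 - l) *: z)) by [].
  by rewrite linearD !linearZ; exact: xK.
- by exists (act B x); apply/act_interior; rewrite actK.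
Qed.

Lemma act_collision z : collision K' z -> collision K (z *m A).
Proof.
move=> [z0 [x [/act_interior ix /act_interior ixz]]]; split.
  apply: contra z0 => /eqP e; apply/eqP.
  by rewrite -[z]mulmx1 -AB mulmxA e mul0mx.
by exists (act A x); split; [exact: ix|move: ixz; rewrite linearB act_intv].
Qed.

Lemma act_cover m : mfold_covering m (lattice_translates K) ->
  forall x, exists s : seq 'rV[int]_n, [/\ uniq s, size s = m & forall z, z \in s -> K' (x - intv z)].
Proof.
move=> cK x; have [s [us sm sP]] := covering_seq (act A x) cK.
exists [seq z *m B | z <- s]; split.
- rewrite map_inj_uniq// => y z /(congr1 (fun w => w *m A)).
  by rewrite -!mulmxA BA !mulmx1.
- by rewrite size_map.
- move=> _ /mapP[z zs ->]; suff : K (act A (x - intv (z *m B))) by [].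
  by rewrite linearB act_intv -mulmxA BA mulmx1; exact: sP.
Qed.

Lemma act_unimodular : unimodular (act A).
Proof.
apply/seteqP; split => [_ [_ /int_pointsP[z ->] <-]|_ /int_pointsP[z ->]].
  by apply/int_pointsP; exists (z *m A); rewrite act_intv.
exists (intv (z *m B)); first by apply/int_pointsP; exists (z *m B).
by rewrite act_intv -mulmxA BA mulmx1.
Qed.

End Transport.

(** The unit vectors have preimages; stacked as rows, these form a one-sided, hence two-sided,
    inverse of the matrix of phi. *)
Lemma unimodular_inverse n (phi : {linear 'rV[R]_n -> 'rV[R]_n}) : unimodular phi ->
  exists psi : {linear 'rV[R]_n -> 'rV[R]_n}, cancel phi psi /\ cancel psi phi.
Proof.
move=> up; have ez i : exists z : 'rV[R]_n, phi z = delta_mx ord0 i.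
  have : (phi @` int_points) (delta_mx ord0 i).
    rewrite up; apply/int_pointsP; exists (delta_mx ord0 i).
    by apply/rowP => j; rewrite intvE !mxE; case: (_ && _).
  by move=> [z _ zE]; exists z.
have [z zE] := choice ez.
pose Z := \matrix_(i < n) z i.
have ZM : Z *m lin1_mx phi = 1%:M.
  apply/row_matrixP => i; rewrite row_mul rowK mul_rV_lin1 zE row1.
  by [].
have MZ := mulmx1C ZM.
exists (mulmxr Z); split => x.
  by rewrite /= -(mul_rV_lin1 phi) -mulmxA MZ mulmx1.
by rewrite -(mul_rV_lin1 phi) /= -mulmxA ZM mulmx1.
Qed.

(** If u = q w' with q >= 2, then x - w' lies on the segment from x to x - u inside the interior of
    K, so w' is a collision vector; being a multiple j u, it gives q * j = 1. *)
Lemma collision_primitive n (K : set 'rV[R]_n) m (u : 'rV[int]_n) : convex_body K -> collision K u ->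
  (forall z, collision K z -> exists2 j : int, (`|j| < m)%N & z = j *: u) ->
  forall (k : int) w, u = k *: w -> `|k|%N = 1%N.
Proof.
move=> bK [u0 [x [ix ixu]]] H k w uk; have [_ xK _] := bK.
have k0 : k != 0 by apply: contra u0 => /eqP k0; rewrite uk k0 scale0r.
pose q := `|k|%N; pose w' := sgz k *: w.
have kE : k = sgz k * q%:Z by rewrite /q abszE -numEsg.
have uq : u = q%:Z *: w' by rewrite uk {1}kE /w' scalerA mulrC.
have q0 : (0 < q)%N by rewrite absz_gt0.
apply/eqP; rewrite -/q eqn_leq q0 andbT leqNgt; apply/negP => q1.
have q0R : 0 < q%:R :> R by rewrite ltr0n.
have [|j _ wj] := H w'.
  split; first by apply: contra u0 => /eqP w0; rewrite uq w0 scaler0.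
  exists x; split; first exact: ix.
  rewrite (_ : _ - _ = q%:R^-1 *: (x - intv u) + (1 - q%:R^-1) *: x).
    apply: interior_mix => //; first exact: interior_subset.
    by rewrite invr_gt0 q0R/= invf_lt1// ltr1n.
  rewrite uq; apply/rowP => i; rewrite !rvE !intvE (_ : (q%:Z *: w') ord0 i = q%:Z * w' ord0 i).
    by rewrite intrM -pmulrn; field; rewrite gt_eqF.
  by rewrite mxE.
have : (1 - q%:Z * j) *: u = 0.
  by rewrite scalerBl scale1r -scalerA -wj -uq subrr.
have /rV0Pn[i ui] := u0.
move=> /rowP/(_ i)/eqP; rewrite !mxE mulf_eq0 (negbTE ui) orbF => /eqP.
by move: (q) q1 => p p1 pj; have [j0|j0] := lerP j 0; nia.
Qed.

Lemma sym_setP n (A : set 'rV[R]_n) : (forall x, A x -> A (- x)) -> [set - x | x in A] = A.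
Proof.
move=> AN; apply/seteqP; split => [_ [x Ax <-]|x Ax]; first exact: AN.
by exists (- x); [exact: AN|rewrite opprK].
Qed.

Lemma sym_set n (A : set 'rV[R]_n) x : [set - x | x in A] = A -> A x -> A (- x).
Proof. by move=> {2}<- Ax; exists x. Qed.

Lemma sym_interior n (A : set 'rV[R]_n) x : [set - x | x in A] = A ->
  interior A x -> interior A (- x).
Proof.
move=> sA ix; have := @interior_symmetric R n A 0 _ x ix; rewrite sub0r; apply => y.
rewrite sub0r; split=> [/(sym_set sA)|/(sym_set sA)//].
by rewrite opprK.
Qed.

Lemma between_sym n (B : set 'rV[R]_n) (a : {linear 'rV[R]_n -> R^o}) (m : R) x :
  [set - x | x in B] = B ->
  between B (fun y => a y - m) (fun y => a y + m) x ->
  between B (fun y => a y - m) (fun y => a y + m) (- x).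
Proof.
move=> sB [Bx /andP[x1 x2]]; rewrite /between/=.
have -> : col' ord_max (- x) = - col' ord_max x by apply/rowP => i; rewrite !mxE.
split; first exact: sym_set.
rewrite linearN rvN; move: (a _ : R) x1 x2 => p x1 x2; apply/andP; split; lra.
Qed.

Theorem lifting_of_equality n m N (K : set 'rV[R]_n.+1) : (2 <= m)%N -> convex_body K ->
  mfold_covering m (lattice_translates K) -> collision_vectors K #= `I_(2 * N) ->
  m = (N + 1)%N ->
  exists (t : 'rV[R]_n.+1) (B : set 'rV[R]_n),
    extremal_convex_body B /\ cylindrical_lifting m B (translate t (dilate 2 K)).
Proof.
move=> m2 bK cK sK mN.
have [D [uD sD memD]] := collision_seq sK.
have [M MD] : exists M : int, forall z, z \in D -> weight M z != 0.
  by apply: weight_neq0 => z /memD[].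
have [u [cu cP]] := collision_progression bK cK uD sD memD MD m2 mN.
have [A [A' [AA' A'A eA]]] := primitive_completion (collision_primitive bK cu cP).
(* K in coordinates where u is the last basis vector. *)
pose K' := act A @^-1` K.
have bK' : convex_body K' := act_body AA' A'A bK.
have collK' z : collision K' z -> exists2 j : int, (`|j| < m)%N & z = isnoc 0 j.
  move=> /(act_collision AA' A'A)/cP[j jm zj]; exists j => //.
  rewrite -[z]mulmx1 -AA' mulmxA zj -eA -scalemxAl -mulmxA AA' mulmx1.
  apply/rowP => i; rewrite !mxE; case: unlift => [k|]; last by rewrite mulr1.
  by rewrite !mxE mulr0.
have [a [c [bP pP cvP KP]]] := cylinder bK' m2 (act_cover A'A cK) collK'.
set P := [set y | _] in bP pP cvP KP.
have [v Pv] := tile_symmetric bP pP cvP.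
have exB := tile_extremal bP pP cvP Pv; set B := aff 2 (- v) P in exB.
have two0 : 2 != 0 :> R by rewrite pnatr_eq0.
have [sB _ _] := exB; have [_ symB] := sB.
(* Recentres the doubled body: the base becomes symmetric about 0 and the heights symmetric about
   the graph of a. *)
pose t' := snoc (- v) (- (a v + 2 * c + m%:R)).
have sclE (y : 'rV[R]_n) s : 2^-1 *: snoc y s = snoc (2^-1 *: y) (2^-1 * s).
  by have := snoc_mix 2^-1 0 y 0 s 0; rewrite scale0r addr0 scaler0 addr0 mulr0 addr0.
have KE (y : 'rV[R]_n) (s : R) : aff 2 t' K' (snoc y s) <-> B y /\ a y - m%:R <= s <= a y + m%:R.
  rewrite affP// /t' snocB sclE /B affP// !opprK KP.
  have -> : a (2^-1 *: (y + v)) = 2^-1 * ((a y : R) + a v) :> R by rewrite linearZ linearD.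
  move: (a y : R) (a v : R) => p q.
  by split=> -[Py /andP[? ?]]; split => //; apply/andP; split; lra.
have LE : aff 2 t' K' = between B (fun y => a y - m%:R) (fun y => a y + m%:R).
  by apply/seteqP; split => x Lx; [apply/KE; rewrite -snocE|rewrite (snocE x); apply/KE].
have CE : translate (act A t') (dilate 2 K) = act A @` between B (fun y => a y - m%:R) (fun y => a y + m%:R).
  rewrite translate_dilate -LE; apply/seteqP; split => [_ [x Kx <-]|_ [_ [x Kx <-] <-]].
    exists (2 *: act A' x + t'); last by rewrite linearD linearZ (actK A'A).
    by exists (act A' x) => //; suff : K (act A (act A' x)) by []; rewrite (actK A'A).
  by exists (act A x) => //; rewrite linearD linearZ.
exists (act A t'), B; split; [exact: exB|split; [|exact: sB|]].
  split; first by rewrite translate_dilate; exact: aff_body.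
  rewrite CE; apply: sym_setP => _ [x Lx <-]; exists (- x); last by rewrite linearN.
  exact: between_sym.
by exists (act A), a; split => //; exact: (act_unimodular A'A).
Qed.

(** With C = 2 K + t symmetric, interior points x and x - z of K give the interior points 2 x + t
    and - (2 (x - z) + t) of C, whose midpoint is z. Conversely, z and - z in the interior of C give
    back two such points of K. *)
Lemma collision_symmetric n (K : set 'rV[R]_n) t z : convex_body K ->
  [set - x | x in aff 2 t K] = aff 2 t K ->
  collision K z <-> z != 0 /\ interior (aff 2 t K) (intv z).
Proof.
move=> bK sC; have two0 : 2 != 0 :> R by rewrite pnatr_eq0.
have iC x : interior (aff 2 t K) x <-> interior K (2^-1 *: (x - t)) by exact: aff_interior.
have [_ xC _] := aff_body t two0 bK.
split=> [[z0 [x [ix ixz]]]|[z0 iz]]; (split; first exact: z0).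
  have i1 : interior (aff 2 t K) (2 *: x + t).
    by apply/iC; rewrite addrK scalerA (mulVf two0) scale1r; exact: ix.
  have i2 : interior (aff 2 t K) (2 *: (x - intv z) + t).
    by apply/iC; rewrite addrK scalerA (mulVf two0) scale1r; exact: ixz.
  have := interior_midpoint xC i1 (sym_interior sC i2); congr (interior _ _).
  by apply/rowP => i; rewrite !rvE; field.
exists (2^-1 *: (intv z - t)); split; first exact/iC.
have := sym_interior sC iz => /iC; congr (interior _ _).
by apply/rowP => i; rewrite !rvE; field.
Qed.

Lemma between_snoc n (B : set 'rV[R]_n) f g y s :
  between B f g (snoc y s) <-> B y /\ f y <= s <= g y.
Proof. by rewrite /between/= col'_snoc snoc_max. Qed.

Lemma interior_between n (B : set 'rV[R]_n) (a : {linear 'rV[R]_n -> R^o}) (m : R) y s :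
  interior (between B (fun y => a y - m) (fun y => a y + m)) (snoc y s) <->
  interior B y /\ `|s - a y| < m.
Proof.
split=> [/interiorP[r r0 rL]|[/interiorP[r r0 rB] sm]].
  split.
    apply/interiorP; exists r => // z zy; have := rL (snoc z s).
    rewrite /between/= col'_snoc snocB subrr => /(_ _)[] //.
    by apply: snoc_norm; rewrite ?normr0.
  have up : between B (fun y => a y - m) (fun y => a y + m) (snoc y (s + r / 2)).
    by apply: rL; rewrite snocB subrr addrAC subrr add0r; apply: snoc_norm; rewrite ?normr0// ger0_norm; lra.
  have lo : between B (fun y => a y - m) (fun y => a y + m) (snoc y (s - r / 2)).
    by apply: rL; rewrite snocB subrr addrAC subrr add0r; apply: snoc_norm; rewrite ?normr0// normrN ger0_norm; lra.
  move: up lo => /between_snoc + /between_snoc; move: (a y : R) => p.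
  move=> [_ /andP[? ?]] [_ /andP[? ?]]; rewrite ltr_norml; apply/andP; split; lra.
pose g (x : 'rV[R]_n.+1) : R := x ord0 ord_max - a (col' ord_max x).
have ccol : continuous (col' ord_max : 'rV[R]_n.+1 -> 'rV[R]_n).
  exact: (@linear_continuous_rV R _ _ (col' ord_max)).
have ca : continuous (fun x : 'rV[R]_n.+1 => a (col' ord_max x) : R).
  move=> x; apply: (@continuous_comp _ _ _ (col' ord_max) a); first exact: ccol.
  exact: (@linear_continuous_rV R n R^o a).
have cm : continuous (fun x : 'rV[R]_n.+1 => x ord0 ord_max) by exact: coord_continuous.
have cg : continuous g by move=> x; exact: (continuousB (cm x) (ca x)).
have n1 : \forall x \near snoc y s, B (col' ord_max x).
  by apply: ccol; rewrite col'_snoc; apply/interiorP; exists r.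
have gE : g (snoc y s) = s - a y by rewrite /g snoc_max col'_snoc.
move: sm; rewrite ltr_norml -gE => /andP[s1 s2].
have n2 : \forall x \near snoc y s, - m < g x by exact: cvgr_gt (cg (snoc y s)) _ s1.
have n3 : \forall x \near snoc y s, g x < m by exact: cvgr_lt (cg (snoc y s)) _ s2.
apply: filterS3 n1 n2 n3 => x Bx; rewrite /g => x1 x2; split => //=.
by apply/andP; split; lra.
Qed.

(** As 0 is the only lattice point interior to B, the collision vectors are the images under phi of
    (0, j) with 0 < [|j|] < m, which are 2 (m - 1) vectors. *)
Theorem equality_of_lifting n m N (K : set 'rV[R]_n.+1) t (B : set 'rV[R]_n) : (2 <= m)%N ->
  convex_body K -> collision_vectors K #= `I_(2 * N) -> extremal_convex_body B ->
  cylindrical_lifting m B (translate t (dilate 2 K)) -> m = (N + 1)%N.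
Proof.
move=> m2 bK sK [_ B0 _]; rewrite translate_dilate => -[[_ sC] _ [phi [a [uphi CE]]]].
have [D [uD sD memD]] := collision_seq sK.
have [psi [phiK psiK]] := unimodular_inverse uphi.
set L := between _ _ _ in CE.
have iC x : interior (aff 2 t K) x <-> interior L (psi x).
  have -> : aff 2 t K = psi @^-1` L.
    rewrite CE; apply/seteqP; split => [_ [y Ly <-]|y Ly]; first by rewrite /preimage/= phiK.
    by exists (psi y) => //; rewrite psiK.
  by apply: (@interior_preimage _ psi phi) => //; exact: linear_continuous_rV.
have psi_int z : exists w, psi (intv z) = intv w.
  have : (phi @` int_points) (intv z) by rewrite uphi; apply/int_pointsP; exists z.
  by move=> [x /int_pointsP[w ->] <-]; exists w; rewrite phiK.
have phi_int w : exists z, phi (intv w) = intv z.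
  have : (phi @` int_points) (phi (intv w)) by exists (intv w) => //; apply/int_pointsP; exists w.
  by rewrite uphi => /int_pointsP.
have iL w : interior L (intv w) <-> exists2 j : int, (`|j| < m)%N & w = isnoc 0 j.
  split=> [|[j jm ->]].
    rewrite (isnoc_surj w) intv_isnoc => /interior_between[iw].
    have w0 : (interior B `&` int_points) (intv (col' ord_max w)).
      by split => //; apply/int_pointsP; exists (col' ord_max w).
    have wE : col' ord_max w = 0 by apply: (@intv_inj R); rewrite intv0; move: w0; rewrite B0.
    rewrite wE intv0 linear0 subr0 -intr_norm -[m%:R]/(m%:~R) ltr_int => wm.
    by exists (w ord0 ord_max); [lia|].
  rewrite intv_isnoc intv0; apply/interior_between; split.
    by have : [set 0 : 'rV[R]_n] 0 by []; rewrite -B0 => -[].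
  rewrite linear0 subr0 -intr_norm -[m%:R]/(m%:~R) ltr_int; lia.
have memDE z : z \in D <-> exists2 j : int, (0 < `|j| < m)%N & psi (intv z) = intv (isnoc 0 j).
  rewrite memD (collision_symmetric z bK sC) iC; split.
    move=> [z0]; have [w wE] := psi_int z; rewrite wE iL => -[j jm wj].
    exists j; last by rewrite wj.
    rewrite jm andbT absz_gt0; apply: contra z0 => /eqP j0; apply/eqP.
    apply: (@intv_inj R); rewrite -(psiK (intv z)) wE wj j0 intv_isnoc !intv0.
    rewrite (_ : snoc _ _ = 0) ?linear0//; apply/rowP => i; rewrite !mxE.
    by case: unlift => // k; rewrite mxE.
  move=> [j /andP[j0 jm] zE]; split; last by rewrite zE; apply/iL; exists j.
  apply/eqP => z0; move: zE; rewrite z0 intv0 linear0 intv_isnoc.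
  move=> /(congr1 (fun x : 'rV[R]_n.+1 => x ord0 ord_max)); rewrite snoc_max mxE.
  by move/eqP; rewrite eq_sym intr_eq0 => /eqP; lia.
pose js : seq int := [seq i%:Z | i <- iota 1 m.-1] ++ [seq - i%:Z | i <- iota 1 m.-1].
have ujs : uniq js.
  rewrite cat_uniq !map_inj_uniq ?iota_uniq /= ?andbT; last 2 first.
  - by move=> i j /oppr_inj[].
  - by move=> i j [].
  apply/hasPn => _ /mapP[i + ->]; rewrite mem_iota => i0.
  by apply/mapP => -[j]; rewrite mem_iota; lia.
have mem_js j : (j \in js) = (0 < `|j| < m)%N.
  rewrite mem_cat; apply/idP/idP.
    by case/orP => /mapP[i + ->]; rewrite mem_iota; lia.
  move=> jm; have [j0|j0] := leP 0 j; apply/orP; [left|right]; apply/mapP; exists `|j|%N;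
    rewrite ?mem_iota; lia.
have sjs : size js = (2 * m.-1)%N by rewrite size_cat !size_map size_iota; lia.
(* Reads j back from the last coordinate; the floor merely turns an integral real into an
   integer. *)
pose h z : int := Num.floor ((psi (intv z) : 'rV[R]_n.+1) ord0 ord_max).
have hE z j : psi (intv z) = intv (isnoc 0 j) -> h z = j.
  by move=> zE; rewrite /h zE intv_isnoc snoc_max intrKfloor.
have s1 : (size D <= size js)%N.
  rewrite -(size_map h); apply: uniq_leq_size.
    rewrite map_inj_in_uniq// => z w /memDE[j _ zj] /memDE[k _ wk].
    rewrite (hE _ _ zj) (hE _ _ wk) => jk; apply: (@intv_inj R).
    by rewrite -(psiK (intv z)) -(psiK (intv w)) zj wk jk.
  by move=> _ /mapP[z /memDE[j jm zj] ->]; rewrite (hE _ _ zj) mem_js.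
have [g gP] := choice phi_int.
have s2 : (size js <= size D)%N.
  rewrite -(size_map (fun j => g (isnoc 0 j))); apply: uniq_leq_size.
    rewrite map_inj_uniq// => j k /(congr1 (@intv R _)); rewrite -!gP.
    move=> /(can_inj phiK)/intv_inj/(congr1 (fun x : 'rV[int]_n.+1 => x ord0 ord_max)).
    by rewrite !mxE unlift_none.
  move=> _ /mapP[j + ->]; rewrite mem_js => jm; apply/memDE; exists j => //.
  by rewrite -gP phiK.
lia.
Qed.

End Unimodular.

(* The dimension is d.+1, i.e. ranges over the positive integers. *)
Theorem corollary2 (R : realType) (d m N : nat) (K : set 'rV[R]_d.+1)
    (m_ge2 : (2 <= m)%N)
    (bodyK : convex_body K)
    (tilingK : mfold_tiling m (lattice_translates K))
    (collK : collision_vectors K #= `I_(2 * N)) :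
  (m <= N + 1)%N /\
  ((2 <= d.+1)%N ->
   (m = (N + 1)%N <->
    exists (t : 'rV[R]_d.+1) (B : set 'rV[R]_d),
      extremal_convex_body B /\
      cylindrical_lifting m B (translate t (dilate 2 K)))).
Proof.
have [_ coverK] := tilingK.
split=> [|_].
  have [D [uD sD memD]] := collision_seq collK.
  have [M MD] : exists M : int, forall z, z \in D -> weight M z != 0.
    by apply: weight_neq0 => z /memD[].
  exact: (multiplicity_le bodyK coverK uD sD memD MD).
split=> [|[t [B [extB liftB]]]]; first exact: lifting_of_equality.
exact: (equality_of_lifting m_ge2 bodyK collK extB liftB).
Qed.
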